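(* In the algorithm setup, assume Property (P2). Fix a variable $i$, a factor $a\in\partial i$ and $1\le\ell\le L$. Then there exists (on a suitable extension of the probability space) a random variable $U\sim\mathcal N(0,\nu_\ell)$ independent of $\mathcal G_i^{\ell-1}$ such that for every $p>0$, $$\mathrm{plim}_{d\to\infty}\ \mathbb E\big[|u^\ell_{i\to a}-U|^p\,\big|\,\mathcal G_i^{\ell-1}\big]=0.$$
   Context: Algorithm setup. Fix $r\ge2$ and a predicate $f:\{\pm1\}^r\to\{0,1\}$, identified with its multilinear extension $f(x)=\sum_{S\subseteq[r]}\hat f(S)\prod_{\iota\in S}x_\iota$ on $\mathbb R^r$, and assume $\hat f(S)=0$ whenever $|S|=1$. Let $\xi(s)=\sum_{j=1}^r\big(\sum_{|S|=j}\hat f(S)^2\big)s^j$. Fix $\delta>0$, let $L=\lfloor1/\delta\rfloor$, and for $\ell\ge1$ let $\nu_\ell=\big(\xi'(\ell\delta)-\xi'((\ell-1)\delta)\big)/r$. Let $G=(V,E)$ be a hypergraph whose hyperedges (factors) $a$ are ordered $r$-tuples $\partial a=(v_{a,1},\dots,v_{a,r})$ of distinct vertices (variables), which is $d$-index-regular: every variable lies in exactly $d$ factors, and for each $\iota\in[r]$ it is the $\iota$-th entry of exactly $d/r$ factors. Write $\partial i$ for the set of factors containing $i$. Assume the bipartite variable–factor incidence graph (factor graph) of $G$ has no cycle of length less than $4L+4$. For a factor $a$ and $j\in\partial a$, $\mathsf D_{j;a}f$ is the partial derivative of (multilinear) $f$ in the coordinate $\iota$ with $v_{a,\iota}=j$.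 Fix $K>0$ and functions $F_{\to,\ell},F_\ell:\mathbb R^\ell\to[-K,K]$ for $0\le\ell\le L-1$ (constants when $\ell=0$). Randomness: $z_i^0$, $i\in V$, i.i.d. $\mathcal N(0,\delta)$; set $z^0_{i\to a}=z_i^0$, $w_i^0=w^0_{i\to a}=0$. For $\ell=0,\dots,L-1$: $A^\ell_{i\to a}=F_{\to,\ell}(u^1_{i\to a},\dots,u^\ell_{i\to a})$, $A^\ell_i=F_\ell(u^1_i,\dots,u^\ell_i)$; with $\mathbf z^\ell_{\partial b\to b}=(z^\ell_{v_{b,1}\to b},\dots,z^\ell_{v_{b,r}\to b})$, $w^{\ell+1}_{i\to a}=(d-1)^{-1/2}\sum_{b\in\partial i\setminus a}\mathsf D_{i;b}f(\mathbf z^\ell_{\partial b\to b})$, $u^{\ell+1}_{i\to a}=w^{\ell+1}_{i\to a}-w^\ell_{i\to a}$, $z^{\ell+1}_{i\to a}=z_i^0+\sum_{s=1}^{\ell+1}A^{s-1}_{i\to a}u^s_{i\to a}$; $w^{\ell+1}_i=d^{-1/2}\sum_{b\in\partial i}\mathsf D_{i;b}f(\mathbf z^\ell_{\partial b\to b})$, $u^{\ell+1}_i=w^{\ell+1}_i-w^\ell_i$, $z^{\ell+1}_i=z_i^0+\sum_{s=1}^{\ell+1}A^{s-1}_iu^s_i$. Sigma-algebras: the distance between variables $i,j$ is the least $k$ such that there are variables $i=v_0,\dots,v_k=j$ with consecutive ones sharing a factor. $\mathsf B_i(\ell)$ is the set of variables at distance $\le\ell$ from $i$; $\mathcal G_i^\ell=\sigma(z_j^0:j\in\mathsf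 B_i(\ell))$. Asymptotics: $r,f,\delta,L,K$ are fixed and $d\to\infty$ along such hypergraphs (nonlinearities may depend on $d$); $\mathrm{plim}$ is limit in probability. Property (P2): for all $0\le\ell\le L-1$, variables $i$, factors $a\in\partial i$: $\mathbb E[(A^\ell_i)^2]=\mathbb E[(A^\ell_{i\to a})^2]=\delta/\nu_{\ell+1}$. *)

(* Defs.v *)
From HB Require Import structures.
From mathcomp Require Import all_boot all_order all_algebra.
From mathcomp Require Import all_classical all_reals all_analysis measurable_realfun.

Set Implicit Arguments.
Unset Strict Implicit.
Unset Printing Implicit Defensive.

Import Order.TTheory GRing.Theory Num.Theory.

Local Open Scope classical_set_scope.
Local Open Scope ring_scope.

(* Predicate f : {+-1}^r -> {0,1}.  A point of {+-1}^r is encoded as  *)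
(* x : {ffun 'I_r -> bool} with true = +1, false = -1; the value of f *)
(* is a bool (true = 1, false = 0).                                    *)

Definition pm1 {R : pzRingType} (b : bool) : R := if b then 1 else -1.

Definition fhat (R : realType) (r : nat) (f : {ffun 'I_r -> bool} -> bool)
    (S : {set 'I_r}) : R :=
  (2 ^ r)%:R^-1 * \sum_(x : {ffun 'I_r -> bool}) (f x)%:R * \prod_(i in S) pm1 (x i).

Definition fext (R : realType) (r : nat) (f : {ffun 'I_r -> bool} -> bool)
    (x : 'I_r -> R) : R :=
  \sum_(S : {set 'I_r}) fhat R f S * \prod_(k in S) x k.

Definition fderiv (R : realType) (r : nat) (f : {ffun 'I_r -> bool} -> bool)
    (io : 'I_r) (x : 'I_r -> R) : R :=
  \sum_(S : {set 'I_r} | io \in S) fhat R f S * \prod_(k in S :\ io) x k.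

Definition xi_poly (R : realType) (r : nat) (f : {ffun 'I_r -> bool} -> bool)
    : {poly R} :=
  \poly_(j < r.+1)
     (if j == 0%N then 0 else \sum_(S : {set 'I_r} | #|S| == j) fhat R f S ^+ 2).

Definition nu (R : realType) (r : nat) (f : {ffun 'I_r -> bool} -> bool)
    (delta : R) (l : nat) : R :=
  (((xi_poly R f)^`()).[l%:R * delta] - ((xi_poly R f)^`()).[l.-1%:R * delta]) / r%:R.

Definition Lof (R : realType) (delta : R) : nat := Num.truncn (delta^-1).

Section Hypergraph.
Variables (r : nat) (V E : finType) (vtx : E -> 'I_r -> V).

Definition incident (a : E) (i : V) : bool := [exists io, vtx a io == i].

Definition dpart (i : V) : {set E} := [set a | incident a i].

Definition index_regular (d : nat) : Prop :=
  (forall a, injective (vtx a)) /\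
  (forall i, #|dpart i| = d) /\
  (forall i (io : 'I_r), (#|[set a | vtx a io == i]| * r)%N = d).

(* the bipartite factor graph has a cycle of length 2k (k >= 2):
   distinct variables v_0..v_{k-1}, distinct factors a_0..a_{k-1},
   with v_j, v_{j+1 mod k} in a_j *)
Definition fg_cycle (k : nat) : Prop :=
  exists (vs : nat -> V) (fs : nat -> E),
    {in gtn k &, injective vs} /\ {in gtn k &, injective fs} /\
    (forall j, (j < k)%N -> incident (fs j) (vs j) && incident (fs j) (vs ((j.+1) %% k)%N)).

Definition girth_ge (m : nat) : Prop :=
  forall k, (2 <= k)%N -> (2 * k < m)%N -> ~ fg_cycle k.

Fixpoint vball (l : nat) (i : V) : {set V} :=
  match l with
  | 0 => [set i]
  | l'.+1 => vball l' i :|: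
      [set j | [exists k in vball l' i, exists b, incident b k && incident b j]]
  end.

End Hypergraph.

(* The message passing algorithm, as a deterministic function of the  *)
(* initialization z0 : V -> R.  Nonlinearities F_{->,l}, F_l are       *)
(* given as functions on sequences; only their values on sequences of  *)
(* length l are ever used (F_l : R^l -> R).                             *)
Section Algorithm.
Variables (R : realType) (r : nat) (f : {ffun 'I_r -> bool} -> bool)
  (V E : finType) (vtx : E -> 'I_r -> V) (d : nat)
  (Fto Fv : nat -> seq R -> R) (z0 : V -> R).

(* D_{j;b} f (x) : derivative in the coordinate io with vtx b io = j *)
Definition Dfat (b : E) (j : V) (x : 'I_r -> R) : R :=
  \sum_(io | vtx b io == j) fderiv f io x.

(* z given the history h = [u^1; ...; u^l] and z_j^0 *)
Definition zof (F : nat -> seq R -> R) (h : seq R) (z0j : R) : R :=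
  z0j + \sum_(s < size h) F s (take s h) * nth 0 h s.

Definition wstep (h : V -> E -> seq R) (i : V) (a : E) : R :=
  (Num.sqrt (d.-1)%:R)^-1 *
    \sum_(b in dpart vtx i :\ a)
       Dfat b i (fun io => zof Fto (h (vtx b io) b) (z0 (vtx b io))).

(* (histories [u^1_{i->a};...;u^l_{i->a}],  w^l_{i->a}) *)
Fixpoint msgs (l : nat) : (V -> E -> seq R) * (V -> E -> R) :=
  match l with
  | 0 => (fun _ _ => [::], fun _ _ => 0)
  | l'.+1 =>
      let h := (msgs l').1 in let w := (msgs l').2 in
      let w' := wstep h in
      (fun i a => rcons (h i a) (w' i a - w i a), w')
  end.

Definition umsg (l : nat) (i : V) (a : E) : R := nth 0 ((msgs l).1 i a) l.-1.

Definition Amsg (l : nat) (i : V) (a : E) : R := Fto l ((msgs l).1 i a).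

Definition wvstep (h : V -> E -> seq R) (i : V) : R :=
  (Num.sqrt d%:R)^-1 *
    \sum_(b in dpart vtx i)
       Dfat b i (fun io => zof Fto (h (vtx b io) b) (z0 (vtx b io))).

(* (histories [u^1_i;...;u^l_i], w^l_i) *)
Fixpoint vmsgs (l : nat) : (V -> seq R) * (V -> R) :=
  match l with
  | 0 => (fun _ => [::], fun _ => 0)
  | l'.+1 =>
      let h := (vmsgs l').1 in let w := (vmsgs l').2 in
      let w' := wvstep (msgs l').1 in
      (fun i => rcons (h i) (w' i - w i), w')
  end.

Definition Avar (l : nat) (i : V) : R := Fv l ((vmsgs l).1 i).

End Algorithm.

(* law N(0,v) on R (v >= 0); N(0,0) is the Dirac mass at 0 *)
Definition gauss (R : realType) (v : R) (A : set R) : \bar R :=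
  if v <= 0 then (\1_A (0 : R))%:E else normal_prob 0 (Num.sqrt v) A.

Definition gen_sigma (R : realType) (V : finType) (O : Type)
    (Z : V -> O -> R) (B : {set V}) : set (set O) :=
  <<s \big[setU/set0]_(j in B) preimage_set_system setT (Z j) measurable >>.

Definition iid_gauss (R : realType) (V : finType) (dO : measure_display)
    (O : measurableType dO) (P : probability O R) (Z : V -> O -> R) (v : R) : Prop :=
  (forall j, measurable_fun setT (Z j)) /\
  (forall A : V -> set R, (forall j, measurable (A j)) ->
     P (\bigcap_(j in setT) (Z j @^-1` A j)) = (\prod_(j : V) gauss v (A j))%E).

Definition indep_rv_sigma (R : realType) (dO : measure_display)
    (O : measurableType dO) (P : probability O R) (U : O -> R) (G : set (set O)) : Prop :=
  forall (A : set R) (S : set O), measurable A -> G S ->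
    P (U @^-1` A `&` S) = (P (U @^-1` A) * P S)%E.

(* Y is a version of the conditional expectation E[X | G] of the
   nonnegative random variable X (extended-real valued) *)
Definition cond_exp_version (R : realType) (dO : measure_display)
    (O : measurableType dO) (P : probability O R) (G : set (set O))
    (X : O -> \bar R) (Y : O -> \bar R) : Prop :=
  (forall w, (0 <= Y w)%E) /\
  (forall B : set (\bar R), measurable B -> G (Y @^-1` B)) /\
  (forall S, G S -> (\int[P]_(w in S) Y w = \int[P]_(w in S) X w)%E).

(* Main.v *)
Require Import Defs.
From HB Require Import structures.
From mathcomp Require Import all_boot all_order all_algebra.
From mathcomp Require Import all_classical all_reals all_analysis measurable_realfun.
From mathcomp Require Import ring lra zify.

(* Off the deepest layer of the computation tree of (i, a), the message u^l is a
   normalized sum of d - 1 conditionally independent centred terms. By (P2) the second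
   moments E[(z^m)^2] grow by delta at each step, so that the conditional variance of
   u^l concentrates at nu_l, and Lindeberg's replacement gives a conditional central
   limit theorem, in L^1 with rate d^(-1/2), tested against cubic splines.
   Let phi_k be a partition of unity by cubic B-splines. U is obtained from u^l by
   choosing a cell k with probability phi_k(u^l), moving to a cell k' according to the
   maximal coupling of the conditional expectations of the phi_k(u^l) with the Gaussian
   expectations p_k of the phi_k, and sampling from the Gaussian with density
   phi_k' / p_k'. Conditionally on the variables off the deepest layer, U is then exactly
   Gaussian, hence independent of G_i^(l-1), and U is within the mesh of u^l up to an
   event controlled by the central limit theorem. Let the mesh tend to 0 slowly with d.
   Uniform moments give convergence in L^p, and Markov's inequality concludes. *)

Set Implicit Arguments.
Unset Strict Implicit.
Unset Printing Implicit Defensive.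

Import Order.TTheory GRing.Theory Num.Theory.
Import numFieldTopology.Exports numFieldNormedType.Exports.

Local Open Scope classical_set_scope.
Local Open Scope ring_scope.

(** * Expectations of functions of polynomial growth *)

(** Convergence in law is not enough: [U] must live on the same space, be exactly Gaussian and
    exactly independent, whereas the central limit theorem is approximate and holds only on average
    over the conditioning. The coupling therefore corrects the conditional cell probabilities to the
    Gaussian ones pointwise, and pays only their [L^1] distance, summed over finitely many cells.
    The cells are splines because Lindeberg's method needs a third-order Taylor bound, which
    indicators lack.

    The girth keeps the deepest layer away from the ball of radius [l - 1], so conditioning off that
    layer refines [G_i^(l-1)]. On the law of the initialization over [V -> R] such conditional
    expectations are partial integrals, defined pointwise: unconditional results apply with the
    other coordinates frozen.

    All constants are uniform over the hypergraphs, but their dependence on the mesh is not tracked;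
    a diagonal choice of the couplings replaces it. If [f] is constant then [nu_l = 0], the Gaussian
    degenerates, and [u^l = U = 0] is treated apart. *)

Section DensityMeasure.
Local Open Scope ereal_scope.
Context d (T : measurableType d) (R : realType).
Variables (m Q : {measure set T -> \bar R}) (f : T -> R).
Hypotheses (mf : measurable_fun setT f) (f0 : forall x, (0 <= f x)%R).
Hypothesis Qf : forall A, measurable A -> Q A = \int[m]_(x in A) (f x)%:E.

Import HBNNSimple.

Let mfE : measurable_fun setT (EFin \o f).
Proof. exact/measurable_EFinP. Qed.

Let integral_density_nnsfun (h : {nnsfun T >-> R}) :
  \int[Q]_x (h x)%:E = \int[m]_x ((h x)%:E * (f x)%:E).
Proof.
under [LHS]eq_integral do rewrite fimfunE -fsumEFin//.
rewrite [LHS]ge0_integral_fsum//; last 2 first.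
  - by move=> r; exact/measurable_EFinP/measurableT_comp.
  - by move=> n x _; rewrite EFinM nnfun_muleindic_ge0.
under [RHS]eq_integral.
  move=> x xD; rewrite fimfunE -fsumEFin// ge0_mule_fsuml; last first.
    by move=> r; rewrite EFinM nnfun_muleindic_ge0.
  over.
rewrite [RHS]ge0_integral_fsum//; last 2 first.
  - by move=> r; apply: emeasurable_funM => //; exact/measurable_EFinP/measurableT_comp.
  - move=> n x _; rewrite EFinM mule_ge0//; first by rewrite nnfun_muleindic_ge0.
    by rewrite lee_fin.
apply: eq_fsbigr => r rh.
under [LHS]eq_integral do rewrite EFinM.
rewrite integralZl_indic_nnsfun//.
under [RHS]eq_integral do rewrite EFinM -muleA.
rewrite ge0_integralZl//=; last 3 first.
- by apply: emeasurable_funM => //; exact/measurable_EFinP.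
- by move=> x _; rewrite mule_ge0// lee_fin.
- by rewrite lee_fin; move: rh; rewrite inE => -[x _ <-].
congr (_ * _).
rewrite integral_indic// setIT Qf//.
rewrite integral_mkcond; apply: eq_integral => x _.
by rewrite patchE indicE; case: ifPn => _ /=; rewrite ?mul1e ?mul0e.
Qed.

(** The normal law is known on sets, as an integral of its density; this turns Gaussian expectations
    into Lebesgue integrals. Simple functions first, then monotone convergence. *)
Lemma ge0_integral_density (g : T -> \bar R) :
  measurable_fun setT g -> (forall x, 0 <= g x) ->
  \int[Q]_x g x = \int[m]_x (g x * (f x)%:E).
Proof.
move=> mg g0.
pose g_ := nnsfun_approx measurableT mg.
transitivity (lim (\int[Q]_x (g_ n x)%:E @[n --> \oo])%E).
  rewrite -monotone_convergence//=.
  - apply: eq_integral => ? /[!inE] xD; apply/esym/cvg_lim => //=.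
    exact: cvg_nnsfun_approx.
  - by move=> n; exact/measurable_EFinP/measurable_funTS.
  - by move=> n ? _; rewrite lee_fin.
  - by move=> ? _ ? ? mn; rewrite lee_fin; exact/lefP/nd_nnsfun_approx.
transitivity (lim (\int[m]_x ((g_ n x)%:E * (f x)%:E) @[n --> \oo])%E).
  by apply: congr_lim; apply/funext => n /=; exact: integral_density_nnsfun.
rewrite -monotone_convergence//=.
- apply: eq_integral => x _; apply/cvg_lim => //.
  by apply: cvgeZr => //; exact: cvg_nnsfun_approx.
- by move=> n; apply: emeasurable_funM => //; exact/measurable_EFinP/measurable_funTS.
- by move=> n ? _; rewrite mule_ge0// lee_fin.
- move=> x _ p q pq; rewrite lee_wpmul2r ?lee_fin//; exact/lefP/nd_nnsfun_approx.
Qed.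

End DensityMeasure.

Section WeightedClass.
Context d (T : measurableType d) (R : realType).
Variables (mu : probability T R) (W : T -> R).

Definition admissible_weight :=
  [/\ measurable_fun setT W, forall x, 1 <= W x &
      forall k, mu.-integrable setT (fun x => (W x ^+ k)%:E)].

(* The functions of polynomial growth: all moments are finite, so that below
   the expectation is linear on a class closed under products. *)
Definition pg (g : T -> R) := measurable_fun setT g /\
  exists C k, 0 <= C /\ forall x, `|g x| <= C * W x ^+ k.

Definition EE (g : T -> R) : R := \int[mu]_x g x.

Hypothesis hW : admissible_weight.

Let W1 x : 1 <= W x. Proof. by case: hW. Qed.
Let W0 x : 0 <= W x. Proof. by apply: le_trans (W1 x). Qed.
Let Wk1 k x : 1 <= W x ^+ k. Proof. by rewrite exprn_ege1. Qed.

Lemma pg_int g : pg g -> mu.-integrable setT (EFin \o g).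
Proof.
move=> [mg [C [k [C0 hC]]]]; case: hW => mW _ /(_ k) iW.
apply: (@le_integrable _ _ _ _ _ measurableT _ (fun x => (C * W x ^+ k)%:E)).
- exact/measurable_EFinP.
- move=> x _ /=; rewrite lee_fin; apply: le_trans (hC x) _.
  exact: ler_norm.
- by under eq_fun do rewrite EFinM; exact: integrableZl.
Qed.

Lemma pg_meas g : pg g -> measurable_fun setT g. Proof. by case. Qed.

Lemma pg_le (g h : T -> R) : measurable_fun setT g -> (forall x, `|g x| <= `|h x|) -> pg h -> pg g.
Proof.
move=> mg gh [_ [C [k [C0 hC]]]]; split => //; exists C, k; split => // x.
exact: le_trans (gh x) (hC x).
Qed.

Lemma pg_bounded (g : T -> R) C : measurable_fun setT g -> (forall x, `|g x| <= C) -> pg g.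
Proof.
move=> mg hg; split => //; exists `|C|, 0%N; split => // x.
by rewrite expr0 mulr1; apply: le_trans (hg x) (ler_norm _).
Qed.

Lemma pg_cst (c : R) : pg (fun=> c).
Proof. exact: (@pg_bounded _ `|c|). Qed.

Lemma pg_ext (g h : T -> R) : g =1 h -> pg g -> pg h.
Proof. by move=> /funext ->. Qed.

Lemma pg_W : pg W.
Proof.
split; first by case: hW.
by exists 1, 1%N; split => // x; rewrite mul1r expr1 ger0_norm.
Qed.

Lemma pgD g h : pg g -> pg h -> pg (fun x => g x + h x).
Proof.
move=> [mg [C [k [C0 hC]]]] [mh [D [l [D0 hD]]]]; split; first exact: measurable_funD.
exists (C + D), (k + l)%N; split; first exact: addr_ge0.
move=> x; apply: le_trans (ler_normD _ _) _; rewrite mulrDl lerD//.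
- by apply: le_trans (hC x) _; rewrite ler_wpM2l// ler_weXn2l// leq_addr.
- by apply: le_trans (hD x) _; rewrite ler_wpM2l// ler_weXn2l// leq_addl.
Qed.

Lemma pgM g h : pg g -> pg h -> pg (fun x => g x * h x).
Proof.
move=> [mg [C [k [C0 hC]]]] [mh [D [l [D0 hD]]]]; split; first exact: measurable_funM.
exists (C * D), (k + l)%N; split; first exact: mulr_ge0.
by move=> x; rewrite normrM exprD mulrACA ler_pM.
Qed.

Lemma pgZ c g : pg g -> pg (fun x => c * g x).
Proof. by move=> hg; apply: pgM => //; exact: pg_cst. Qed.

Lemma pgZr c g : pg g -> pg (fun x => g x * c).
Proof. by move=> hg; apply: pgM => //; exact: pg_cst. Qed.

Lemma pgN g : pg g -> pg (fun x => - g x).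
Proof. by move=> /(pgZ (-1)) h; rewrite (_ : (fun x => - g x) = fun x => -1 * g x)//; apply/funext => x; rewrite mulN1r. Qed.

Lemma pgB g h : pg g -> pg h -> pg (fun x => g x - h x).
Proof. by move=> hg /pgN; exact: pgD. Qed.

Lemma pgX g k : pg g -> pg (fun x => g x ^+ k).
Proof.
move=> hg; elim: k => [|k ih]; first exact: pg_cst.
by apply: pg_ext (pgM hg ih) => x; rewrite exprS.
Qed.

Lemma pg_norm g : pg g -> pg (fun x => `|g x|).
Proof.
move=> hg; apply: (pg_le _ _ hg); first exact: measurableT_comp (pg_meas hg).
by move=> x; rewrite normr_id.
Qed.

Lemma pg_sum (I : Type) (s : seq I) (p : pred I) (g : I -> T -> R) :
  (forall i, p i -> pg (g i)) -> pg (fun x => \sum_(i <- s | p i) g i x).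
Proof.
move=> hg; elim: s => [|i s ih].
  by apply: pg_ext (pg_cst 0) => x; rewrite big_nil.
case: (boolP (p i)) => pi; last by apply: pg_ext ih => x; rewrite big_cons (negbTE pi).
by apply: pg_ext (pgD (hg _ pi) ih) => x; rewrite big_cons pi.
Qed.

Lemma pg_prod (I : Type) (s : seq I) (p : pred I) (g : I -> T -> R) :
  (forall i, p i -> pg (g i)) -> pg (fun x => \prod_(i <- s | p i) g i x).
Proof.
move=> hg; elim: s => [|i s ih].
  by apply: pg_ext (pg_cst 1) => x; rewrite big_nil.
case: (boolP (p i)) => pi; last by apply: pg_ext ih => x; rewrite big_cons (negbTE pi).
by apply: pg_ext (pgM (hg _ pi) ih) => x; rewrite big_cons pi.
Qed.

Lemma E_fin g : pg g -> (\int[mu]_x (g x)%:E)%E = (EE g)%:E.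
Proof.
by move=> /pg_int ig; rewrite /EE /Rintegral fineK//; exact: integrable_fin_num.
Qed.

Lemma E_ext (g h : T -> R) : g =1 h -> EE g = EE h.
Proof. by move=> /funext ->. Qed.

Lemma E_cst (c : R) : EE (fun=> c) = c.
Proof.
rewrite /EE /Rintegral integral_cst//.
by rewrite [X in (_ * X)%E](@probability_setT _ _ _ mu) mule1.
Qed.

Lemma E_D g h : pg g -> pg h -> EE (fun x => g x + h x) = EE g + EE h.
Proof. by move=> /pg_int ? /pg_int ?; rewrite /EE RintegralD. Qed.

Lemma E_B g h : pg g -> pg h -> EE (fun x => g x - h x) = EE g - EE h.
Proof. by move=> /pg_int ? /pg_int ?; rewrite /EE RintegralB. Qed.

Lemma E_Z c g : pg g -> EE (fun x => c * g x) = c * EE g.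
Proof. by move=> /pg_int ?; rewrite /EE RintegralZl. Qed.

Lemma E_Zr c g : pg g -> EE (fun x => g x * c) = EE g * c.
Proof. by move=> /pg_int ?; rewrite /EE RintegralZr. Qed.

Lemma E_sum (I : Type) (s : seq I) (p : pred I) (g : I -> T -> R) :
  (forall i, p i -> pg (g i)) ->
  EE (fun x => \sum_(i <- s | p i) g i x) = \sum_(i <- s | p i) EE (g i).
Proof.
move=> hg; elim: s => [|i s ih].
  rewrite big_nil -[RHS](E_cst 0); apply: E_ext => x.
  by rewrite big_nil.
rewrite big_cons -ih; case: (boolP (p i)) => pi; last first.
  by apply: E_ext => x; rewrite big_cons (negbTE pi).
rewrite -E_D; [|exact: hg|exact: pg_sum].
by apply: E_ext => x; rewrite big_cons pi.
Qed.

Lemma E_ge0 (g : T -> R) : (forall x, 0 <= g x) -> 0 <= EE g.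
Proof. by move=> g0; apply: Rintegral_ge0. Qed.

Lemma E_le g h : pg g -> pg h -> (forall x, g x <= h x) -> EE g <= EE h.
Proof. by move=> /pg_int ? /pg_int ? gh; apply: le_Rintegral. Qed.

Lemma E_norm g : pg g -> `|EE g| <= EE (fun x => `|g x|).
Proof. by move=> /pg_int ?; apply: le_normr_Rintegral. Qed.

Lemma E_normB g h : pg g -> pg h -> `|EE g - EE h| <= EE (fun x => `|g x - h x|).
Proof. by move=> pgg pgh; rewrite -E_B//; apply: E_norm; exact: pgB. Qed.

(** The arithmetic-geometric mean inequality with a free parameter: [e] of order [d^(-1/2)] turns a
    second moment of order [1/d] into a first moment of order [d^(-1/2)]. *)
Lemma E_norm_le g e : pg g -> 0 < e ->
  EE (fun x => `|g x|) <= (e + EE (fun x => g x ^+ 2) / e) / 2.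
Proof.
move=> hg e0.
have h2 : pg (fun x => g x ^+ 2 / e) by apply: pgZr; exact: pgX.
have -> : (e + EE (fun x => g x ^+ 2) / e) / 2 = EE (fun x => (e + g x ^+ 2 / e) / 2).
  rewrite E_Zr; last by apply: pgD => //; exact: pg_cst.
  by rewrite E_D ?E_cst ?E_Zr//; [exact: pgX|exact: pg_cst].
apply: E_le; [exact: pg_norm| |move=> x].
  by apply: pgZr; apply: pgD => //; exact: pg_cst.
rewrite -real_normK ?num_real//; set t := `|g x|.
rewrite -subr_ge0 (_ : _ - t = (e - t) ^+ 2 / (2 * e)); last by field; rewrite gt_eqF.
by rewrite divr_ge0 ?sqr_ge0// mulr_ge0// ltW.
Qed.

Lemma E_sqr_le g : pg g -> EE g ^+ 2 <= EE (fun x => g x ^+ 2).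
Proof.
move=> hg; set c := EE g; rewrite -subr_ge0.
have -> : EE (fun x => g x ^+ 2) - c ^+ 2 = EE (fun x => (g x - c) ^+ 2).
  have -> : (fun x => (g x - c) ^+ 2) = (fun x => g x ^+ 2 - ((2 * c) * g x - c ^+ 2)).
    by apply/funext => x; ring.
  have p2 := pgX 2 hg; have p1 := pgZ (2 * c) hg.
  by rewrite E_B ?E_B ?E_cst ?E_Z -/c//; [ring|exact: pg_cst|apply: pgB => //; exact: pg_cst].
by apply: E_ge0 => x; exact: sqr_ge0.
Qed.

End WeightedClass.

Section ImageMeasure.
Context d1 d2 (T1 : measurableType d1) (T2 : measurableType d2) (R : realType).
Variables (m1 : {measure set T1 -> \bar R}) (phi : T1 -> T2).
Hypothesis mphi : measurable_fun setT phi.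

Definition image_measure : {measure set T2 -> \bar R} :=
  measure_function_pushforward__canonical__measure_function_Measure m1 mphi.

Lemma image_measureE A : image_measure A = m1 (phi @^-1` A).
Proof. by []. Qed.

Lemma ge0_integral_image (m2 : {measure set T2 -> \bar R}) (g : T2 -> \bar R) :
  (forall A, measurable A -> m1 (phi @^-1` A) = m2 A) ->
  measurable_fun setT g -> (forall x, 0 <= g x)%E ->
  (\int[m2]_x g x = \int[m1]_x g (phi x))%E.
Proof.
move=> m12 mg g0; rewrite (@eq_measure_integral _ _ _ _ image_measure).
  by rewrite (ge0_integral_pushforward mphi m1 measurableT mg).
by move=> A mA _; rewrite image_measureE m12.
Qed.

Lemma integral_image (m2 : {measure set T2 -> \bar R}) (g : T2 -> \bar R) :
  (forall A, measurable A -> m1 (phi @^-1` A) = m2 A) ->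
  measurable_fun setT g -> m1.-integrable setT (g \o phi) ->
  (\int[m2]_x g x = \int[m1]_x g (phi x))%E.
Proof.
move=> m12 mg ig; rewrite (@eq_measure_integral _ _ _ _ image_measure).
  by rewrite (integral_pushforward mphi mg _ measurableT).
by move=> A mA _; rewrite image_measureE m12.
Qed.

Lemma integrable_image (m2 : {measure set T2 -> \bar R}) (g : T2 -> \bar R) :
  (forall A, measurable A -> m1 (phi @^-1` A) = m2 A) ->
  measurable_fun setT g ->
  m2.-integrable setT g <-> m1.-integrable setT (g \o phi).
Proof.
move=> m12 mg.
have e : (\int[m2]_x `|g x| = \int[m1]_x `|g (phi x)|)%E.
  by apply: (ge0_integral_image m12) => //; exact: measurableT_comp.
by split=> /integrableP[h1 h2]; apply/integrableP; split => //;
  [exact: measurableT_comp|rewrite -e|rewrite e].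
Qed.

End ImageMeasure.

(** * Configurations and conditional expectations *)

Section Configurations.
Context (R : realType) (V : finType).

Definition rect (A : V -> set R) : set (V -> R) := [set x | forall j, A j (x j)].

(** Rectangles, unlike preimages under single coordinates, are closed under intersection, and the
    law is prescribed on them: uniqueness of measures applies directly. *)
Definition rects : set (set (V -> R)) :=
  [set S | exists A : V -> set R, (forall j, measurable (A j)) /\ S = rect A].

Definition cfg := g_sigma_algebraType rects.

Lemma measurable_rect (A : V -> set R) :
  (forall j, measurable (A j)) -> measurable (rect A : set cfg).
Proof. by move=> mA; apply: sub_sigma_algebra; exists A. Qed.

Lemma measurable_coord j : measurable_fun setT (fun x : cfg => x j).
Proof.
move=> _ A mA; rewrite setTI.
rewrite (_ : _ @^-1` A = rect (fun k => if k == j then A else setT)).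
  by apply: measurable_rect => k; case: ifP.
apply/seteqP; split => x /=; first by move=> Ax k; case: eqP => // ->.
by move=> /(_ j); rewrite eqxx.
Qed.

Lemma measurable_to_cfg d (T : measurableType d) (F : T -> cfg) :
  (forall j, measurable_fun setT (fun t => F t j)) -> measurable_fun setT F.
Proof.
move=> mF; apply: (@measurability _ _ T cfg setT F rects) => //.
move=> _ [_ [A [mA ->]] <-]; rewrite setTI.
rewrite (_ : _ @^-1` _ = \big[setI/setT]_(j : V) ((fun t => F t j) @^-1` A j)).
  apply: bigsetI_measurable => j _; rewrite -[X in measurable X]setTI; exact: mF.
by apply/seteqP; split => t /=; rewrite -bigcap_seq => h j;
  [move=> _; exact: h|apply: h; rewrite /= mem_index_enum].
Qed.

(** Invariance under changes off [D] instead of measurability for a sub-sigma-algebra: independence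
    and conditioning become questions about finite sets of variables. *)
Definition depends (T : Type) (D : {set V}) (g : cfg -> T) :=
  forall x y : cfg, (forall j, j \in D -> x j = y j) -> g x = g y.

Lemma dependsW (T : Type) (D D' : {set V}) (g : cfg -> T) :
  D \subset D' -> depends D g -> depends D' g.
Proof. by move=> /fintype.subsetP s dg x y xy; apply: dg => j /s; exact: xy. Qed.

Lemma depends2 (T1 T2 T : Type) (F : T1 -> T2 -> T) D g h :
  depends D g -> depends D h -> depends D (fun x => F (g x) (h x)).
Proof. by move=> dg dh x y xy; rewrite (dg x y xy) (dh x y xy). Qed.

Lemma depends1 (T1 T : Type) (F : T1 -> T) D g :
  depends D g -> depends D (fun x => F (g x)).
Proof. by move=> dg x y xy; rewrite (dg x y xy). Qed.

Lemma depends_big (I : Type) (op : R -> R -> R) (idx : R) (s : seq I) (p : pred I)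
    D (g : I -> cfg -> R) : (forall i, p i -> depends D (g i)) ->
  depends D (fun x => \big[op/idx]_(i <- s | p i) g i x).
Proof. by move=> dg x y xy; apply: eq_bigr => i pi; exact: dg. Qed.

Definition mix (B : {set V}) (x y : cfg) : cfg := fun j => if j \in B then x j else y j.

Lemma mix_in (T : Type) (B D : {set V}) (g : cfg -> T) x y : depends D g ->
  D \subset B -> g (mix B x y) = g x.
Proof. by move=> dg /fintype.subsetP s; apply: dg => j /s; rewrite /mix => ->. Qed.

Lemma mix_out (T : Type) (B D : {set V}) (g : cfg -> T) x y : depends D g ->
  [disjoint D & B]%B -> g (mix B x y) = g y.
Proof. by move=> dg s; apply: dg => j jD; rewrite /mix (disjointFr s jD). Qed.

(** This weight dominates every coordinate and is submultiplicative under [mix] ([Wc_mix]), so that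
    partial integration preserves polynomial growth. *)
Definition Wc (x : cfg) : R := 1 + \sum_j x j ^+ 2.

Variables (gam : probability R R) (mu : probability cfg R).
Hypothesis hgam : admissible_weight gam (fun t => 1 + t ^+ 2).
Hypothesis mu_rect : forall A : V -> set R, (forall j, measurable (A j)) ->
  mu (rect A) = (\prod_j gam (A j))%E.

Lemma mu_coord j A : measurable A -> mu ((fun x : cfg => x j) @^-1` A) = gam A.
Proof.
move=> mA.
rewrite (_ : _ @^-1` A = rect (fun k => if k == j then A else setT)).
  rewrite mu_rect; last by move=> k; case: ifP.
  rewrite (bigD1 j)//= eqxx big1 ?mule1// => k /negbTE ->.
  exact: probability_setT.
apply/seteqP; split => x /=; first by move=> Ax k; case: eqP => // ->.
by move=> /(_ j); rewrite eqxx.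
Qed.

Lemma ge0_integral_coord j (g : R -> \bar R) : measurable_fun setT g ->
  (forall t, 0 <= g t)%E -> (\int[mu]_x g (x j) = \int[gam]_t g t)%E.
Proof.
move=> mg g0.
rewrite (ge0_integral_image (m1 := mu) (@measurable_coord j) (m2 := gam))//.
by move=> A mA; exact: (mu_coord j mA).
Qed.

Lemma Wc_ge1 x : 1 <= Wc x.
Proof. by rewrite /Wc lerDl sumr_ge0// => j _; exact: sqr_ge0. Qed.

Lemma measurable_Wc : measurable_fun setT Wc.
Proof.
apply: measurable_funD => //; apply: measurable_sum => j.
by apply: measurable_funX; exact: measurable_coord.
Qed.

Lemma exprD_le2 (a b : R) k : 0 <= a -> 0 <= b -> (a + b) ^+ k <= 2 ^+ k * (a ^+ k + b ^+ k).
Proof.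
move=> a0 b0; wlog ab : a b a0 b0 / a <= b.
  move=> h; case: (leP a b) => [|/ltW] ab; first exact: h.
  by rewrite addrC (addrC (a ^+ k)); exact: h.
apply: (@le_trans _ _ ((2 * b) ^+ k)).
  by rewrite lerXn2r ?nnegrE ?addr_ge0 ?mulr_ge0//; lra.
by rewrite exprMn ler_wpM2l ?exprn_ge0// lerDr exprn_ge0.
Qed.

(** Coordinates are added one at a time, each at the cost of a factor [2 ^+ k], which reduces the
    claim to moments of a single coordinate. *)
Lemma cfg_weight : admissible_weight mu Wc.
Proof.
split; [exact: measurable_Wc|exact: Wc_ge1|move=> k].
rewrite /Wc; have mS (s : seq V) : measurable_fun setT (fun x : cfg => 1 + \sum_(j <- s) x j ^+ 2).
  apply: measurable_funD => //; apply: measurable_sum => j.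
  by apply: measurable_funX; exact: measurable_coord.
elim: (index_enum V) => [|j s ih].
  have -> : (fun x : cfg => ((1 + \sum_(j <- [::]) x j ^+ 2) ^+ k)%:E) = (EFin \o cst 1).
    by apply/funext => x /=; rewrite big_nil addr0 expr1n.
  exact: finite_measure_integrable_cst.
have ij : mu.-integrable setT (fun x : cfg => ((1 + x j ^+ 2) ^+ k)%:E).
  apply/integrableP; split.
    by apply/measurable_EFinP/measurable_funX/measurable_funD => //;
      apply: measurable_funX; exact: measurable_coord.
  have h0 (t : R) : (0 <= ((1 + t ^+ 2) ^+ k)%:E)%E.
    by rewrite lee_fin exprn_ge0// addr_ge0// sqr_ge0.
  have mh : measurable_fun setT (fun t : R => ((1 + t ^+ 2) ^+ k)%:E).
    by apply/measurable_EFinP/measurable_funX/measurable_funD => //; exact: measurable_funX.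
  under eq_integral do rewrite gee0_abs ?h0//.
  rewrite (ge0_integral_coord j mh h0).
  case: hgam => _ _ /(_ k) /integrableP[_]; apply: le_lt_trans.
  by apply: ge0_le_integral => //; [exact: measurableT_comp|move=> t _; rewrite gee0_abs ?h0].
apply: (@le_integrable _ _ _ _ _ measurableT _
  (fun x : cfg => (2 ^+ k * ((1 + x j ^+ 2) ^+ k + (1 + \sum_(i <- s) x i ^+ 2) ^+ k))%:E)).
- by apply/measurable_EFinP/measurable_funX; exact: mS.
- move=> x _ /=; rewrite lee_fin big_cons.
  have S0 : 0 <= \sum_(i <- s) x i ^+ 2 by apply: sumr_ge0 => i _; exact: sqr_ge0.
  have x0 := sqr_ge0 (x j).
  rewrite !ger0_norm ?mulr_ge0 ?addr_ge0 ?exprn_ge0 ?addr_ge0//.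
  apply: le_trans (exprD_le2 k _ _); rewrite ?addr_ge0//.
  by rewrite lerXn2r ?nnegrE ?addr_ge0//; lra.
- exact: (integrableZl measurableT (2 ^+ k) (integrableD measurableT ij ih)).
Qed.

Lemma Wc_mix B x y : Wc (mix B x y) <= Wc x * Wc y.
Proof.
have S0 (z : cfg) : 0 <= \sum_j z j ^+ 2 by apply: sumr_ge0 => i _; exact: sqr_ge0.
apply: (@le_trans _ _ (1 + (\sum_j x j ^+ 2 + \sum_j y j ^+ 2))).
  rewrite /Wc lerD2l -big_split/=; apply: ler_sum => j _; rewrite /mix.
  by case: ifP => _; rewrite ?lerDl ?lerDr sqr_ge0.
by rewrite /Wc; have := mulr_ge0 (S0 x) (S0 y); nra.
Qed.

Let cfg2 : measurableType _ := (cfg * cfg)%type.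

Lemma measurable_mix B : measurable_fun setT (fun p : cfg2 => mix B p.1 p.2).
Proof.
apply: measurable_to_cfg => j; rewrite /mix; case: (j \in B).
- exact: measurableT_comp (measurable_coord j) measurable_fst.
- exact: measurableT_comp (measurable_coord j) measurable_snd.
Qed.

Let mixp B : cfg2 -> cfg := fun p => mix B p.1 p.2.

(** Resampling the coordinates off [B] independently preserves the law: the preimage of a rectangle
    is a product of two rectangles, [A1] free off [B] and [A2] free on [B], and measures that agree
    on rectangles are equal. *)
Lemma product_law B A : measurable A -> (mu \x mu)%E (mixp B @^-1` A) = mu A.
Proof.
pose pm := image_measure (mu \x mu)%E (measurable_mix B).
pose A1 (A : V -> set R) j := if j \in B then A j else setT.
pose A2 (A : V -> set R) j := if j \in B then setT else A j.
move=> mA; apply: esym; change (mu A = pm A); move: A mA.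
apply: (@measure_unique _ R cfg rects (fun=> setT) _ _ _ _ mu pm) => //.
- move=> _ _ [C [mC ->]] [D [mD ->]]; exists (fun j => C j `&` D j); split.
    by move=> j; exact: measurableI.
  by apply/seteqP; split => x /= => [[h1 h2] j|h]; [split|split => j; case: (h j)].
- move=> _; exists (fun=> setT); split => //.
  by apply/seteqP; split => x.
- by apply/seteqP; split => // x _; exists 0%N.
- move=> _ [C [mC ->]].
  have -> : pm (rect C) = (mu \x mu)%E (rect (A1 C) `*` rect (A2 C)).
    rewrite image_measureE; congr ((mu \x mu)%E _); apply/seteqP; split => -[x y] /=.
      by move=> h; split => j; move: (h j); rewrite /A1 /A2 /mixp /mix/=; case: ifP.
    by move=> [h1 h2] j; move: (h1 j) (h2 j); rewrite /A1 /A2 /mixp /mix/=; case: ifP.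
  have m1 : forall j, measurable (A1 C j) by move=> j; rewrite /A1; case: ifP.
  have m2 : forall j, measurable (A2 C j) by move=> j; rewrite /A2; case: ifP.
  rewrite product_measure1E; [|exact: measurable_rect|exact: measurable_rect].
  rewrite [LHS]mu_rect// [X in (X * _)%E](mu_rect m1) [X in (_ * X)%E](mu_rect m2).
  rewrite -big_split/=; apply: eq_bigr => j _; rewrite /A1 /A2.
  by case: ifP => _; rewrite (@probability_setT _ _ _ gam) ?mule1 ?mul1e.
- by move=> _; rewrite [X in (X < _)%E](@probability_setT _ _ _ mu) ltry.
Qed.
End Configurations.

Section ConditionalExpectation.
Context (R : realType) (V : finType).
Variables (gam : probability R R) (mu : probability (cfg R V) R).
Hypothesis hgam : admissible_weight gam (fun t => 1 + t ^+ 2).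
Hypothesis mu_rect : forall A : V -> set R, (forall j, measurable (A j)) ->
  mu (rect A) = (\prod_j gam (A j))%E.

Notation cfg := (cfg R V).
Notation E := (EE mu).
Notation pg := (pg (@Wc R V)).

Let hW := cfg_weight hgam mu_rect.

(* The expectation given the coordinates in [B]. *)
Definition CE (B : {set V}) (g : cfg -> R) : cfg -> R := fun x => E (fun y => g (mix B x y)).

Lemma measurable_mixr B (x : cfg) : measurable_fun setT (mix B x).
Proof.
by apply: measurable_to_cfg => j; rewrite /mix; case: (j \in B) => //; exact: measurable_coord.
Qed.

Lemma pg_mix B g x : pg g -> pg (fun y => g (mix B x y)).
Proof.
move=> [mg [C [k [C0 hC]]]]; split; first exact: measurableT_comp mg (measurable_mixr B x).
exists (C * Wc x ^+ k), k; split.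
  by rewrite mulr_ge0 ?exprn_ge0// (le_trans _ (Wc_ge1 x)).
move=> y; apply: le_trans (hC _) _; rewrite -mulrA ler_wpM2l// -exprMn.
by rewrite lerXn2r ?nnegrE ?mulr_ge0 ?(le_trans _ (Wc_ge1 _))//; exact: Wc_mix.
Qed.

Let integrable_mix B g : pg g ->
  (mu \x mu)%E.-integrable setT (fun p => (g (mix B p.1 p.2))%:E).
Proof.
move=> pgg; have mg : measurable_fun setT (EFin \o g) by apply/measurable_EFinP; exact: (proj1 pgg).
have [h _] := integrable_image (measurable_mix (V := V) B) (product_law mu_rect B) mg.
by apply: h; exact: (pg_int hW pgg).
Qed.

Lemma CE_fin B g x : pg g -> (\int[mu]_y (g (mix B x y))%:E)%E = (CE B g x)%:E.
Proof. by move=> pgg; rewrite (E_fin hW)//; exact: pg_mix. Qed.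

Lemma pg_CE B g : pg g -> pg (CE B g).
Proof.
move=> pgg; split.
  apply/measurable_EFinP.
  rewrite (_ : EFin \o _ = fun x => \int[mu]_y (g (mix B (x, y).1 (x, y).2))%:E)%E.
    exact: (measurable_fubini_F (integrable_mix B pgg)).
  by apply/funext => x /=; rewrite CE_fin.
have [_ [C [k [C0 hC]]]] := pgg.
exists (C * E (fun y => Wc y ^+ k)), k; split.
  by rewrite mulr_ge0// E_ge0// => y; rewrite exprn_ge0// (le_trans _ (Wc_ge1 y)).
move=> x; apply: le_trans (E_norm hW (pg_mix B x pgg)) _.
have pW := pgX k (pg_W hW).
rewrite mulrAC -(E_Z hW)//; apply: (E_le hW); [exact: (pg_norm (pg_mix B x pgg))| |move=> y].
  exact: pgZ.
apply: le_trans (hC _) _; rewrite -mulrA ler_wpM2l// -exprMn.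
by rewrite lerXn2r ?nnegrE ?mulr_ge0 ?(le_trans _ (Wc_ge1 _))//; exact: Wc_mix.
Qed.

(** The tower property: Fubini for [mu \x mu], whose image under [mix] is [mu] by [product_law]. *)
Lemma E_CE B g : pg g -> E (CE B g) = E g.
Proof.
move=> pgg; apply: EFin_inj; rewrite -(E_fin hW pgg) -(E_fin hW (pg_CE B pgg)).
have -> : (\int[mu]_x (g x)%:E = \int[mu \x mu]_p (g (mix B p.1 p.2))%:E)%E.
  apply: (integral_image (measurable_mix (V := V) B) (g := EFin \o g)).
  - by move=> A mA; exact: (product_law mu_rect).
  - (apply/measurable_EFinP; exact: (proj1 pgg)).
  - exact: integrable_mix.
rewrite -(integral12_prod_meas1 (integrable_mix B pgg)).
by apply: eq_integral => x _; rewrite -CE_fin.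
Qed.

Lemma CE_depends B D g : depends D g -> depends (D :&: B) (CE B g).
Proof.
move=> dg x x' xx'; apply: E_ext => y; apply: dg => j jD; rewrite /mix.
by case: ifP => // jB; apply: xx'; rewrite inE jD.
Qed.

Lemma CE_mull B g h x : pg h -> depends B g -> CE B (fun x => g x * h x) x = g x * CE B h x.
Proof.
move=> ph dg; rewrite /CE -(E_Z hW); last exact: pg_mix.
by apply: E_ext => y; rewrite (mix_in _ _ dg).
Qed.

Lemma CE_id B g x : depends B g -> CE B g x = g x.
Proof.
move=> dg; rewrite /CE -[RHS](E_cst mu); apply: E_ext => y.
by rewrite (mix_in _ _ dg).
Qed.

Lemma CE_D B g h x : pg g -> pg h -> CE B (fun x => g x + h x) x = CE B g x + CE B h x.
Proof. by move=> pgg ph; rewrite /CE (E_D hW)//; exact: pg_mix. Qed.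

Lemma CE_B B g h x : pg g -> pg h -> CE B (fun x => g x - h x) x = CE B g x - CE B h x.
Proof. by move=> pgg ph; rewrite /CE (E_B hW)//; exact: pg_mix. Qed.

Lemma CE_Z B c g x : pg g -> CE B (fun x => c * g x) x = c * CE B g x.
Proof. by move=> pgg; rewrite /CE (E_Z hW)//; exact: pg_mix. Qed.

Lemma CE_sum B (I : Type) (s : seq I) (p : pred I) (g : I -> cfg -> R) x :
  (forall i, p i -> pg (g i)) ->
  CE B (fun x => \sum_(i <- s | p i) g i x) x = \sum_(i <- s | p i) CE B (g i) x.
Proof. by move=> hg; rewrite /CE (E_sum hW)// => i pi; exact: pg_mix (hg i pi). Qed.

Lemma CE_ge0 B g x : (forall x, 0 <= g x) -> 0 <= CE B g x.
Proof. by move=> g0; apply: E_ge0. Qed.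

Lemma CE_sqr_le B g x : pg g -> CE B g x ^+ 2 <= CE B (fun x => g x ^+ 2) x.
Proof. by move=> pgg; apply: (E_sqr_le hW); exact: pg_mix. Qed.

(** Resampling a coordinate that [g] does not read has no effect. This exchanges the deepest layer
    of a node for that of its child. *)
Lemma CE_restrict B B' D g x : depends D g -> B :&: D = B' :&: D -> CE B g x = CE B' g x.
Proof.
move=> dg BB'; apply: E_ext => y; apply: dg => j jD; rewrite /mix.
suff -> : (j \in B) = (j \in B') by [].
by have /setP/(_ j) := BB'; rewrite !inE jD !andbT.
Qed.

Lemma E_indep D D' g h : pg g -> pg h -> depends D g -> depends D' h ->
  [disjoint D & D']%B -> E (fun x => g x * h x) = E g * E h.
Proof.
move=> pgg ph dg dh DD'.
have pM : pg (fun x => g x * h x) by exact: pgM.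
rewrite -(E_CE D pM) -(E_Zr hW)//; apply: E_ext => x.
rewrite (CE_mull _ ph)//; congr (_ * _); apply: E_ext => y.
by rewrite (mix_out _ _ dh)// disjoint_sym.
Qed.

Lemma E_prod_indep (I : eqType) (s : seq I) (D : I -> {set V}) (g : I -> cfg -> R) :
  uniq s -> (forall i, i \in s -> pg (g i)) -> (forall i, i \in s -> depends (D i) (g i)) ->
  (forall i i', i \in s -> i' \in s -> i != i' -> [disjoint D i & D i']%B) ->
  E (fun x => \prod_(i <- s) g i x) = \prod_(i <- s) E (g i).
Proof.
elim: s => [|i s ih] /=.
  by move=> *; rewrite big_nil -[RHS](E_cst mu); apply: E_ext => x; rewrite big_nil.
move=> /andP[si us] hg hd hD; rewrite big_cons -ih//; last first.
- by move=> j k js ks; apply: hD; rewrite inE ?js ?ks orbT.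
- by move=> j js; apply: hd; rewrite inE js orbT.
- by move=> j js; apply: hg; rewrite inE js orbT.
have pgs : pg (fun x => \prod_(j <- s) g j x).
  rewrite (_ : (fun x => _) = fun x => \prod_(j <- s | j \in s) g j x).
    by apply: pg_prod => j js; apply: hg; rewrite inE js orbT.
  by apply/funext => x; rewrite [LHS]big_seq.
rewrite -(E_indep (D := D i) (D' := \bigcup_(j <- s) D j))//.
- by apply: E_ext => x; rewrite big_cons.
- by apply: hg; rewrite mem_head.
- by apply: hd; rewrite mem_head.
- have : forall j, j \in s -> depends (\bigcup_(k <- s) D k) (g j).
    move=> j js; apply: (dependsW (D := D j)); last by apply: hd; rewrite inE js orbT.
    by rewrite (big_rem j js)/= finset.subsetUl.
  move=> h x y xy; rewrite [LHS]big_seq [RHS]big_seq; apply: eq_bigr => j js; exact: h.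
- have : forall s1 : seq I, {subset s1 <= s} -> [disjoint D i & \bigcup_(j <- s1) D j]%B.
    elim=> [|j s1 ih1] hs; first by rewrite big_nil finset.disjoints_subset finset.setC0 finset.subsetT.
    rewrite big_cons finset.disjoints_subset finset.setCU finset.subsetI -!finset.disjoints_subset.
    apply/andP; split.
      apply: hD; rewrite ?mem_head ?inE ?hs ?mem_head ?orbT//.
      by apply: contraNneq si => ->; rewrite hs// mem_head.
    by rewrite ih1// => k ks; apply: hs; rewrite inE ks orbT.
  by apply.
Qed.

End ConditionalExpectation.

(** * Gaussian expectations *)

Section Gaussian.
Context (R : realType).
Implicit Types (v w t a b : R) (G : R -> R).

Notation leb := (@lebesgue_measure R).

Let measurable_idR : measurable_fun setT (fun x : measurableTypeR R => x : R).
Proof. by move=> _ A mA; rewrite setTI. Qed.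

(** [normal_prob] lives on [measurableTypeR R]; the image under the identity carries it to the
    measurable structure of [R] itself. The parameter is the variance. *)
Definition gaussP v : set R -> \bar R :=
  image_measure (normal_prob (0 : R) (Num.sqrt v)) measurable_idR.

HB.instance Definition _ v := Measure.on (gaussP v).

Let gaussP_setT v : gaussP v setT = 1%E.
Proof. exact: (@probability_setT _ _ _ (normal_prob (0 : R) (Num.sqrt v))). Qed.

HB.instance Definition _ v :=
  Measure_isProbability.Build _ _ _ (gaussP v) (gaussP_setT v).

Lemma gaussPE v A : 0 < v -> gaussP v A = gauss v A.
Proof. by move=> v0; rewrite /gauss leNgt v0. Qed.

Lemma ge0_integral_gaussP v (g : R -> \bar R) : measurable_fun setT g ->
  (forall x, 0 <= g x)%E ->
  (\int[gaussP v]_x g x = \int[leb]_x (g x * (normal_pdf 0 (Num.sqrt v) x)%:E))%E.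
Proof.
move=> mg g0.
rewrite (@ge0_integral_image _ _ _ _ _ (normal_prob (0 : R) (Num.sqrt v)) _ measurable_idR
  (gaussP v) g)//.
apply: ge0_integral_density => //; first exact: measurable_normal_pdf.
exact: normal_pdf_ge0.
Qed.

Lemma normal_pdf_affine a b t : 0 < b ->
  normal_pdf a b (a + b * t) * b = normal_pdf 0 1 t.
Proof.
move=> b0; rewrite !normal_pdfE ?gt_eqF ?oner_eq0//.
rewrite /normal_peak /normal_fun.
have -> : - (a + b * t - a) ^+ 2 / (b ^+ 2 *+ 2) = - (t - 0) ^+ 2 / (1 ^+ 2 *+ 2) :> R.
  by rewrite !mulr2n expr1n subr0; field; rewrite gt_eqF// addr_gt0 ?exprn_gt0.
rewrite mulrAC; congr (_ * _).
rewrite -!mulrnAr sqrtrM ?sqr_ge0// sqrtr_sqr gtr0_norm// invfM mulrAC mulVf ?gt_eqF// mul1r.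
by rewrite expr1n mul1r.
Qed.

(** The substitution [s = a + b t]. Continuity and nonnegativity of [G] come from the substitution
    theorem, and are inherited by all test functions below. *)
Lemma ge0_integral_gaussian_affine a b G : 0 < b -> continuous G -> (forall x, 0 <= G x) ->
  (\int[gaussP 1]_t (G (a + b * t))%:E = \int[leb]_s (G s * normal_pdf a b s)%:E)%E.
Proof.
move=> b0 cG G0.
have cF : continuous (fun t => a + b * t).
  by move=> x; apply: cvgD; [exact: cvg_cst|apply: cvgM; [exact: cvg_cst|exact: cvg_id]].
rewrite ge0_integral_gaussP; last 2 first.
- apply/measurable_EFinP; apply: continuous_measurable_fun => x.
  by apply: continuous_comp; [exact: cF|exact: cG].
- by move=> x; rewrite lee_fin.
have D (x : R^o) : is_derive x (1 : R^o) (fun t => a + b * t : R^o) b.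
  rewrite (_ : (fun t => _) = (cst a : R^o -> R^o) + b *: (id : R^o -> R^o)).
    have h1 : is_derive x (1 : R^o) (b *: (id : R^o -> R^o)) (b *: (1 : R^o)).
      by apply: is_deriveZ.
    apply: (is_derive_eq (is_deriveD (is_derive_cst (a : R^o) x (1 : R^o)) h1)).
    by rewrite add0r; exact: mulr1.
  by apply/funext => t.
have D1 : (fun t => a + b * t : R^o)^`()%classic = cst b.
  by apply/funext => x; rewrite derive1E; exact: derive_val.
rewrite (@increasing_ge0_integration_by_substitutionT R (fun t => a + b * t)
   (fun s => G s * normal_pdf a b s)).
- apply: eq_integral => t _; rewrite D1 /= -EFinM; congr EFin.
  by rewrite /GRing.mul/= -mulrA normal_pdf_affine// sqrtr1.
- by move=> x y xy; rewrite ltrD2l ltr_pM2l.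
- by rewrite D1; exact: cst_continuous.
- by rewrite D1; apply: is_cvg_cst.
- by rewrite D1; apply: is_cvg_cst.
- by move=> x; exact: ex_derive.
- apply: (@cvg_comp _ _ _ (fun t => b * t) (fun t => a + t) _ -oo _); last exact: cvg_addrl_Ny.
  exact: gt0_cvgMrNy.
- apply: (@cvg_comp _ _ _ (fun t => b * t) (fun t => a + t) _ +oo _); last exact: cvg_addrl.
  exact: gt0_cvgMry.
- move=> x; apply: cvgM; first exact: cG.
  by apply: continuous_normal_pdf; rewrite gt_eqF.
- by move=> x; rewrite mulr_ge0// normal_pdf_ge0.
Qed.
End Gaussian.

Section GaussianMoments.
Context (R : realType).
Implicit Types (v w t a b s x : R) (G : R -> R).

Notation leb := (@lebesgue_measure R).
Notation gam1 := (gaussP (1 : R)).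
Definition Wr (t : R) : R := 1 + t ^+ 2.

Let continuous_Wr : continuous Wr.
Proof. by move=> x; apply: cvgD; [exact: cvg_cst|exact: exprn_continuous]. Qed.

Lemma Wr_ge1 t : 1 <= Wr t. Proof. by rewrite /Wr lerDl sqr_ge0. Qed.

(** From [1 + y / k <= expR (y / k)]. The exponential uses half of the Gaussian decay; the other
    half is the density of variance [2 * v], which is integrable. *)
Let expR_dominates v t k : 0 < v ->
  Wr t ^+ k <= (1 + 4 * v * k%:R) ^+ k * expR (t ^+ 2 / (4 * v)).
Proof.
move=> v0; have v4 : 0 < 4 * v by lra.
case: k => [|k]; first by rewrite !expr0 mul1r -[leLHS]expR0 ler_expR divr_ge0 ?sqr_ge0 ?ltW.
set y := t ^+ 2 / (4 * v).
have y0 : 0 <= y by rewrite divr_ge0 ?sqr_ge0 ?ltW.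
have k0 : 0 < k.+1%:R :> R by [].
rewrite (_ : y = k.+1%:R * (y / k.+1%:R)); last by rewrite mulrCA divff ?gt_eqF// mulr1.
rewrite expRM_natl -exprMn lerXn2r ?nnegrE ?(le_trans _ (Wr_ge1 t))//.
  by rewrite mulr_ge0 ?expR_ge0// addr_ge0// !mulr_ge0 ?ltW.
apply: (@le_trans _ _ ((1 + 4 * v * k.+1%:R) * (1 + y / k.+1%:R))); last first.
  by rewrite ler_wpM2l ?expR_ge1Dx// addr_ge0// !mulr_ge0 ?ltW.
rewrite /Wr (_ : t ^+ 2 = 4 * v * k.+1%:R * (y / k.+1%:R)); last first.
  by rewrite /y; field; rewrite !gt_eqF// -natr1 addr_gt0.
set p := 4 * v * k.+1%:R; set q := y / k.+1%:R.
have p0 : 0 <= p by rewrite /p !mulr_ge0 ?ltW.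
have q0 : 0 <= q by rewrite /q divr_ge0.
nra.
Qed.

Let gaussP_Wr_lty v k : 0 < v -> (\int[gaussP v]_x (Wr x ^+ k)%:E < +oo)%E.
Proof.
move=> v0; have sv0 : 0 < Num.sqrt v by rewrite sqrtr_gt0.
have s2 : 0 < Num.sqrt (2 * v) by rewrite sqrtr_gt0; lra.
rewrite ge0_integral_gaussP; last 2 first.
- apply/measurable_EFinP/measurable_funX; exact: continuous_measurable_fun.
- by move=> x; rewrite lee_fin exprn_ge0// (le_trans _ (Wr_ge1 x)).
pose C := (1 + 4 * v * k%:R) ^+ k * (normal_peak (Num.sqrt v) / normal_peak (Num.sqrt (2 * v))).
have C0 : 0 <= C.
  have v0' := ltW v0.
  by rewrite mulr_ge0 ?divr_ge0 ?normal_peak_ge0// exprn_ge0// addr_ge0// !mulr_ge0.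
apply: (@le_lt_trans _ _ (\int[leb]_x (C%:E * (normal_pdf 0 (Num.sqrt (2 * v)) x)%:E))%E).
  apply: ge0_le_integral => //.
  - by move=> x _; rewrite -EFinM lee_fin mulr_ge0 ?normal_pdf_ge0// exprn_ge0// (le_trans _ (Wr_ge1 x)).
  - apply: emeasurable_funM; apply/measurable_EFinP.
      by apply: measurable_funX; exact: continuous_measurable_fun.
    exact: measurable_normal_pdf.
  - apply: emeasurable_funM => //; apply/measurable_EFinP; exact: measurable_normal_pdf.
  - move=> x _; rewrite -!EFinM lee_fin.
    apply: le_trans (ler_wpM2r (normal_pdf_ge0 _ _ _) (expR_dominates x k v0)) _.
    have v0' := ltW v0; have v2' : 0 <= 2 * v by lra.
    rewrite /C !normal_pdfE ?gt_eqF// /normal_fun !subr0 !sqr_sqrtr//.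
    rewrite (_ : - x ^+ 2 / (v *+ 2) = - (x ^+ 2 / (4 * v)) + - x ^+ 2 / (2 * v *+ 2)); last first.
      by rewrite !mulr2n; field; do ?[apply/andP; split]; rewrite gt_eqF//; lra.
    rewrite expRD expRN le_eqVlt; apply/orP; left; apply/eqP.
    by field; rewrite !gt_eqF// ?expR_gt0// normal_peak_gt0// gt_eqF.
rewrite ge0_integralZl//.
- by rewrite integral_normal_pdf mule1 ltry.
- by apply/measurable_EFinP; exact: measurable_normal_pdf.
- by move=> x _; rewrite lee_fin normal_pdf_ge0.
Qed.

Lemma gaussP_weight v : 0 < v -> admissible_weight (gaussP v) Wr.
Proof.
move=> v0; split; [exact: continuous_measurable_fun|exact: Wr_ge1|move=> k].
have W0 (x : R) : 0 <= Wr x ^+ k by rewrite exprn_ge0// (le_trans _ (Wr_ge1 x)).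
apply/integrableP; split.
  by apply/measurable_EFinP/measurable_funX; exact: continuous_measurable_fun.
under eq_integral do rewrite gee0_abs ?lee_fin//.
exact: gaussP_Wr_lty.
Qed.

Notation pg := (pg Wr).
Notation E1 := (EE gam1).
Notation hW1 := (gaussP_weight (@ltr01 R)).

Lemma pg_id : pg idfun.
Proof.
split; first exact: measurable_id.
exists 1, 1%N; split => // x; rewrite mul1r expr1 /Wr /=.
by rewrite -(real_normK (num_real x)); have := normr_ge0 x; have := sqr_ge0 (`|x| - 1); nra.
Qed.

Lemma ge0_pg_affine a b G : pg G -> pg (fun t => G (a + b * t)).
Proof.
move=> [mG [C [k [C0 hC]]]]; split.
  apply: measurableT_comp => //; apply: measurable_funD => //; exact: mulrl_measurable.
exists (C * (2 * Wr a * Wr b) ^+ k), k; split.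
  by rewrite mulr_ge0// exprn_ge0// !mulr_ge0// (le_trans _ (Wr_ge1 _)).
move=> t; apply: le_trans (hC _) _; rewrite -mulrA -exprMn ler_wpM2l//.
have ? := Wr_ge1; rewrite lerXn2r ?nnegrE ?mulr_ge0 ?(le_trans _ (Wr_ge1 _))//.
rewrite /Wr.
have h : (a + b * t) ^+ 2 <= 2 * a ^+ 2 + 2 * (b ^+ 2 * t ^+ 2).
  have : 0 <= (a - b * t) ^+ 2 by exact: sqr_ge0.
  by rewrite -exprMn; nra.
have A := sqr_ge0 a; have B := sqr_ge0 b; have T := sqr_ge0 t.
have BT := mulr_ge0 B T; have AB := mulr_ge0 A B; have AT := mulr_ge0 A T.
have ABT := mulr_ge0 A BT.
apply: le_trans (_ : 1 + (2 * a ^+ 2 + 2 * (b ^+ 2 * t ^+ 2)) <= _); first by rewrite lerD2l.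
by rewrite -subr_ge0; move: A B T BT AB AT ABT; move: (a ^+ 2) (b ^+ 2) (t ^+ 2); move=> A B T; nra.
Qed.

(* By completing the square in the product of the two densities. *)
Let normal_pdf_conv v w a s t : 0 < v -> 0 < w ->
  normal_pdf t (Num.sqrt w) s * normal_pdf a (Num.sqrt v) t =
  normal_pdf a (Num.sqrt (v + w)) s *
    normal_pdf ((v * s + w * a) / (v + w)) (Num.sqrt (v * w / (v + w))) t.
Proof.
move=> v0 w0; have vw0 : 0 < v + w by exact: addr_gt0.
have r0 : 0 < v * w / (v + w) by rewrite divr_gt0 ?mulr_gt0.
have [v0' w0' r0' vw0'] : [/\ 0 <= v, 0 <= w, 0 <= v * w / (v + w) & 0 <= v + w].
  by split; exact: ltW.
rewrite !normal_pdfE ?gt_eqF ?sqrtr_gt0// /normal_fun /normal_peak !sqr_sqrtr//.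
rewrite mulrACA [RHS]mulrACA -!expRD -!invfM -!sqrtrM ?mulrn_wge0 ?mulr_ge0 ?pi_ge0//.
have pi0 := pi_gt0 R.
congr (_ * _).
  congr (Num.sqrt _)^-1; rewrite !mulr2n; field; rewrite gt_eqF//.
congr expR; rewrite !mulr2n; field.
by have vw := mulr_gt0 v0 w0; rewrite !gt_eqF// addr_gt0.
Qed.

(** By Tonelli [t] is integrated first, and [normal_pdf_conv] leaves there a density of mass 1. Zero
    variances have no density and are handled apart. *)
Lemma gaussian_conv v w a G : 0 <= v -> 0 <= w -> continuous G -> (forall x, 0 <= G x) ->
  (\int[gam1]_t \int[gam1]_s (G (a + Num.sqrt v * t + Num.sqrt w * s))%:E =
   \int[gam1]_t (G (a + Num.sqrt (v + w) * t))%:E)%E.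
Proof.
move=> v0 w0 cG G0.
have mG : measurable_fun setT G by exact: continuous_measurable_fun.
have mA b c : measurable_fun setT (fun t => G (b + c * t)).
  by apply: measurableT_comp => //; apply: measurable_funD => //; exact: mulrl_measurable.
have cst1 (c : \bar R) : (\int[gam1]_s c = c)%E.
  by rewrite integral_cst// [X in (_ * X)%E](@probability_setT _ _ _ gam1) mule1.
move: v0; rewrite le_eqVlt => /predU1P[<-|v0].
  under eq_integral do rewrite sqrtr0 mul0r addr0.
  by rewrite cst1 add0r.
move: w0; rewrite le_eqVlt => /predU1P[<-|w0].
  rewrite addr0; apply: eq_integral => t _.
  by under eq_integral do rewrite sqrtr0 mul0r addr0; rewrite cst1.
have sv : 0 < Num.sqrt v by rewrite sqrtr_gt0.
have sw : 0 < Num.sqrt w by rewrite sqrtr_gt0.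
have vw0 : 0 < v + w by exact: addr_gt0.
have svw : 0 < Num.sqrt (v + w) by rewrite sqrtr_gt0.
under eq_integral do rewrite ge0_integral_gaussian_affine//.
have cpdf s : continuous (fun t => normal_pdf t (Num.sqrt w) s).
  move=> t; rewrite (_ : (fun t => _) = fun t => normal_pdf s (Num.sqrt w) t).
    by apply: continuous_normal_pdf; rewrite gt_eqF.
  apply/funext => x; rewrite !normal_pdfE ?gt_eqF// /normal_fun.
  by rewrite -sqrrN opprB.
rewrite (fubini_tonelli (m1 := gam1) (m2 := leb) (fun p : R * measurableTypeR R =>
  (G p.2 * normal_pdf (a + Num.sqrt v * p.1) (Num.sqrt w) p.2)%:E)); last 2 first.
- apply/measurable_EFinP; apply: measurable_funM.
    exact: measurableT_comp mG measurable_snd.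
  rewrite (_ : (fun p => _) = fun p : R * measurableTypeR R =>
     normal_pdf 0 (Num.sqrt w) (p.2 - (a + Num.sqrt v * p.1))); last first.
    apply/funext => p; rewrite !normal_pdfE ?gt_eqF// /normal_fun subr0//.
  apply: measurableT_comp; first exact: measurable_normal_pdf.
  apply: measurable_funB; first exact: measurable_snd.
  by apply: measurable_funD => //; apply: measurable_funM => //; exact: measurable_fst.
- by move=> p; rewrite lee_fin mulr_ge0// normal_pdf_ge0.
rewrite ge0_integral_gaussian_affine//.
apply: eq_integral => s _ /=.
under eq_integral do rewrite EFinM.
rewrite ge0_integralZl//; last 3 first.
- apply/measurable_EFinP.
  apply: (measurableT_comp (continuous_measurable_fun (cpdf s))
    (_ : measurable_fun setT (fun t => a + Num.sqrt v * t))).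
  by apply: measurable_funD => //; exact: mulrl_measurable.
- by move=> t _; rewrite lee_fin normal_pdf_ge0.
- by rewrite lee_fin.
rewrite EFinM; congr (_ * _)%E.
rewrite (ge0_integral_gaussian_affine a sv (cpdf s)); last by move=> x; exact: normal_pdf_ge0.
under eq_integral do rewrite normal_pdf_conv// EFinM.
rewrite ge0_integralZl//.
- by rewrite integral_normal_pdf mule1.
- by apply/measurable_EFinP; exact: measurable_normal_pdf.
- by move=> x _; rewrite lee_fin normal_pdf_ge0.
- by rewrite lee_fin normal_pdf_ge0.
Qed.
End GaussianMoments.

Section GaussianExpectation.
Context (R : realType).
Implicit Types (v w a b s x : R) (G : R -> R).

Notation leb := (@lebesgue_measure R).
Notation gam1 := (gaussP (1 : R)).
Notation pg := (pg (@Wr R)).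
Notation E1 := (EE gam1).
Notation hW1 := (gaussP_weight (@ltr01 R)).

Lemma E_gaussP_scale v G : 0 < v -> continuous G -> (forall x, 0 <= G x) ->
  EE (gaussP v) G = E1 (fun t => G (Num.sqrt v * t)).
Proof.
move=> v0 cG G0; have sv : 0 < Num.sqrt v by rewrite sqrtr_gt0.
suff h : (\int[gaussP v]_x (G x)%:E = \int[gam1]_t (G (Num.sqrt v * t))%:E)%E.
  exact: (congr1 fine h).
have mG : measurable_fun setT (fun x => (G x)%:E).
  by apply/measurable_EFinP; exact: continuous_measurable_fun.
have G0' x : (0 <= (G x)%:E)%E by rewrite lee_fin.
apply: (etrans (ge0_integral_gaussP v mG G0')).
have := ge0_integral_gaussian_affine 0 sv cG G0.
by under [in X in X = _ -> _]eq_integral do rewrite add0r.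
Qed.

Let csqr : continuous (fun t : R => t ^+ 2). Proof. exact: exprn_continuous. Qed.

(** Replaces an integration by parts: for [c = (s ^+ 2 - 1) / 2] a change of scale evaluates the
    expectation of [expR (- (c * x ^+ 2))] as [s^-1], and the exponential lies above its tangent at
    0. *)
Let E1_sqr_bound s : 0 < s -> 1 - s^-1 <= (s ^+ 2 - 1) / 2 * E1 (fun t => t ^+ 2).
Proof.
move=> s0; have is0 : 0 < s^-1 by rewrite invr_gt0.
set c := (s ^+ 2 - 1) / 2.
have p2 := pgX 2 (pg_id R).
have mK : measurable_fun setT (fun x : R => (expR (- (c * x ^+ 2)))%:E).
  apply/measurable_EFinP/measurableT_comp => //; apply: measurable_funN.
  by apply: measurable_funM => //; exact: measurable_funX.
have K : (\int[gam1]_x (expR (- (c * x ^+ 2)))%:E = (s^-1)%:E)%E.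
  rewrite ge0_integral_gaussP//.
  transitivity (\int[leb]_x ((s^-1)%:E * (normal_pdf 0 s^-1 x)%:E))%E.
    apply: eq_integral => x _; rewrite -!EFinM; congr EFin.
    rewrite sqrtr1 [RHS]mulrC (_ : x = 0 + s^-1 * (s * x)); last first.
      by rewrite add0r mulKf ?gt_eqF.
    rewrite normal_pdf_affine// add0r mulKf ?gt_eqF// !normal_pdfE ?oner_eq0// /normal_fun.
    rewrite mulrCA -expRD; congr (_ * expR _); rewrite /c !mulr2n; field.
    by [].
  rewrite ge0_integralZl ?integral_normal_pdf ?mule1//.
  - by apply/measurable_EFinP; exact: measurable_normal_pdf.
  - by move=> x _; rewrite lee_fin normal_pdf_ge0.
  - by rewrite lee_fin ltW.
have iK : gam1.-integrable setT (fun x : R => (expR (- (c * x ^+ 2)))%:E).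
  apply/integrableP; split => //.
  by under eq_integral do rewrite gee0_abs ?lee_fin ?expR_ge0//; rewrite K ltry.
have eK : \int[gam1]_x expR (- (c * x ^+ 2)) = s^-1 by rewrite /Rintegral K.
have pc : pg (fun x => 1 - c * x ^+ 2).
  by apply: (pgB hW1); [exact: pg_cst|exact: pgZ].
rewrite lerBlDr -lerBlDl -eK.
have -> : 1 - c * E1 (fun t => t ^+ 2) = E1 (fun x => 1 - c * x ^+ 2).
  by rewrite (E_B hW1) ?E_cst ?(E_Z hW1)//; [exact: pg_cst|exact: pgZ].
apply: le_Rintegral => //; first exact: (pg_int hW1).
by move=> x _; have := expR_ge1Dx (- (c * x ^+ 2)); lra.
Qed.

(** The bound above is an equality at [s = 1] and holds on both sides of it, so the two slopes there
    agree; this says [m = 1]. *)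
Lemma E1_sqr : E1 (fun t => t ^+ 2) = 1.
Proof.
set m := E1 _; have h s : 0 < s -> 2 * (s - 1) <= (s ^+ 2 - 1) * m * s.
  move=> s0; have := E1_sqr_bound s0; rewrite -/m -(ler_pM2r s0) mulrBl mul1r mulVf ?gt_eqF//.
  lra.
have m0 : 0 <= m by apply: E_ge0 => x; exact: sqr_ge0.
apply/eqP; rewrite eq_le; apply/andP; split; rewrite leNgt; apply/negP => m1.
  (* s = 1 - q with q small *)
  pose q := (m - 1) / (4 * m); have q0 : 0 < q by rewrite divr_gt0//; lra.
  have e : q * (4 * m) = m - 1 by rewrite /q mulfVK// gt_eqF; lra.
  have q1 : q < 1 by rewrite /q ltr_pdivrMr; lra.
  have := h (1 - q) ltac:(lra).
  have -> : ((1 - q) ^+ 2 - 1) * m * (1 - q) = q * ((q - 2) * (1 - q) * m) by ring.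
  rewrite (_ : 2 * (1 - q - 1) = q * (- 2)); last by ring.
  by rewrite ler_pM2l//; nra.
pose q := (1 - m) / 4; have q0 : 0 < q by rewrite divr_gt0//; lra.
have := h (1 + q) ltac:(lra).
have -> : ((1 + q) ^+ 2 - 1) * m * (1 + q) = q * ((2 + q) * (1 + q) * m) by ring.
rewrite (_ : 2 * (1 + q - 1) = q * 2); last by ring.
rewrite ler_pM2l// (_ : m = 1 - 4 * q); last by rewrite /q; lra.
have : q <= 1 / 4 by rewrite /q; lra.
by nra.
Qed.

Definition heat v G a : R := E1 (fun t => G (a + Num.sqrt v * t)).

Lemma heat_conv v w a G : 0 <= v -> 0 <= w -> continuous G -> (forall x, 0 <= G x) -> pg G ->
  E1 (fun t => heat w G (a + Num.sqrt v * t)) = heat (v + w) G a.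
Proof.
move=> v0 w0 cG G0 pG; suff h : (\int[gam1]_t (heat w G (a + Num.sqrt v * t))%:E =
    \int[gam1]_t (G (a + Num.sqrt (v + w) * t))%:E)%E by rewrite /heat /EE /Rintegral -h.
rewrite -gaussian_conv//.
by apply: eq_integral => t _; rewrite (E_fin hW1)//; exact: ge0_pg_affine.
Qed.

(** The semigroup identity for the square, with [v = w = 1] and [a = 0], reads
    [2 + 2 * m ^+ 2 = 2]. *)
Lemma E1_id : E1 idfun = 0.
Proof.
have pid := pg_id R; have p2 := pgX 2 pid; set m := E1 idfun.
have h a b : heat b (fun t => t ^+ 2) a = a ^+ 2 + (2 * a * Num.sqrt b * m + Num.sqrt b ^+ 2).
  rewrite /heat (_ : (fun t => _) = fun t => a ^+ 2 + ((2 * a * Num.sqrt b) * idfun t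
    + Num.sqrt b ^+ 2 * t ^+ 2)); last by apply/funext => t /=; ring.
  have q1 := pgZ (2 * a * Num.sqrt b) pid; have q2 := pgZ (Num.sqrt b ^+ 2) p2.
  rewrite (E_D hW1) ?E_cst ?(E_D hW1) ?(E_Z hW1)//; [|exact: pg_cst|exact: (pgD hW1)].
  by rewrite E1_sqr mulr1.
have := @heat_conv 1 1 0 _ ler01 ler01 csqr (fun x => sqr_ge0 x) p2.
rewrite h; under E_ext do rewrite h sqrtr1 add0r mul1r expr1n mulr1.
have q1 := pgZr m (pgZ 2 pid); have q2 : pg (fun=> 1 : R) by exact: pg_cst.
rewrite (E_D hW1) ?(E_D hW1) ?E_cst ?(E_Zr hW1) ?(E_Z hW1) ?E1_sqr//; last 2 first.
- exact: pgZ.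
- exact: (pgD hW1).
rewrite sqr_sqrtr; last by lra.
rewrite -/m => e; have {e} : m ^+ 2 = 0 by move: e; nra.
by move/eqP; rewrite sqrf_eq0 => /eqP.
Qed.

Lemma E_gaussP_sqr v : 0 < v -> EE (gaussP v) (fun t => t ^+ 2) = v.
Proof.
move=> v0; rewrite E_gaussP_scale//; last by move=> x; exact: sqr_ge0.
under E_ext do rewrite exprMn sqr_sqrtr ?(ltW v0)//.
by rewrite (E_Z hW1) ?E1_sqr ?mulr1//; apply: pgX; exact: pg_id.
Qed.

(** The scaling lemma needs a nonnegative function, so the mean is read off the expectation of
    [(1 + t) ^+ 2]. *)
Lemma E_gaussP_id v : 0 < v -> EE (gaussP v) idfun = 0.
Proof.
move=> v0; have hW := gaussP_weight v0; have pid := pg_id R; have p2 := pgX 2 pid.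
have : EE (gaussP v) (fun t => (1 + t) ^+ 2) = 1 + v.
  rewrite E_gaussP_scale//; last 2 first.
  - by move=> x; apply: cvgM; (apply: cvgD; [exact: cvg_cst|exact: cvg_id]).
  - by move=> x; exact: sqr_ge0.
  rewrite (_ : (fun t => _) = fun t => 1 + ((2 * Num.sqrt v) * idfun t + v * t ^+ 2)).
    have q1 := pgZ (2 * Num.sqrt v) pid; have q2 := pgZ v p2.
    rewrite (E_D hW1) ?E_cst ?(E_D hW1) ?(E_Z hW1)//; [|exact: pg_cst|exact: (pgD hW1)].
    by rewrite E1_sqr E1_id; ring.
  apply/funext => t /=; rewrite -[in v * _](sqr_sqrtr (ltW v0)); ring.
rewrite (_ : (fun t => _) = fun t => 1 + (2 * idfun t + t ^+ 2)); last by apply/funext => t /=; ring.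
have q1 := pgZ 2 pid.
rewrite (E_D hW) ?E_cst ?(E_D hW) ?(E_Z hW)//; [|exact: pg_cst|exact: (pgD hW)].
rewrite E_gaussP_sqr//; lra.
Qed.

Let Wr_affine a b t : Wr (a + b * t) <= 2 * Wr a * Wr b * Wr t.
Proof.
rewrite /Wr.
have h : (a + b * t) ^+ 2 <= 2 * a ^+ 2 + 2 * (b ^+ 2 * t ^+ 2).
  have : 0 <= (a - b * t) ^+ 2 by exact: sqr_ge0.
  by rewrite -exprMn; nra.
have A := sqr_ge0 a; have B := sqr_ge0 b; have T := sqr_ge0 t.
have BT := mulr_ge0 B T; have AB := mulr_ge0 A B; have AT := mulr_ge0 A T.
have ABT := mulr_ge0 A BT.
apply: le_trans (_ : 1 + (2 * a ^+ 2 + 2 * (b ^+ 2 * t ^+ 2)) <= _); first by rewrite lerD2l.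
by rewrite -subr_ge0; move: A B T BT AB AT ABT; move: (a ^+ 2) (b ^+ 2) (t ^+ 2); move=> A B T; nra.
Qed.

Lemma pg_heat v G : continuous G -> (forall x, 0 <= G x) -> pg G -> pg (heat v G).
Proof.
move=> cG G0 pG; split.
  apply/measurable_EFinP.
  rewrite (_ : EFin \o _ = fun x => \int[gam1]_t (G ((x, t).1 + Num.sqrt v * (x, t).2))%:E)%E.
    apply: (measurable_fun_fubini_tonelli_F (m2 := gam1)
      (fun p : R * R => (G (p.1 + Num.sqrt v * p.2))%:E)) => //.
      apply/measurable_EFinP; apply: (measurableT_comp (pg_meas pG)).
      apply: measurable_funD; first exact: measurable_fst.
      by apply: measurable_funM => //; exact: measurable_snd.
    by move=> p; rewrite lee_fin.
  by apply/funext => x /=; rewrite (E_fin hW1)//; exact: ge0_pg_affine.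
have [_ [C [k [C0 hC]]]] := pG.
have W0 (z : R) : 0 <= Wr z by rewrite (le_trans _ (Wr_ge1 z)).
exists (C * (2 * Wr (Num.sqrt v)) ^+ k * E1 (fun t => Wr t ^+ k)), k; split.
  have e0 : 0 <= E1 (fun t => Wr t ^+ k) by apply: E_ge0 => t; rewrite exprn_ge0.
  by rewrite mulr_ge0// mulr_ge0// exprn_ge0// mulr_ge0.
move=> z; apply: le_trans (E_norm hW1 (ge0_pg_affine _ _ pG)) _.
have pW : pg (fun t => Wr t ^+ k) by apply: pgX; exact: pg_W hW1.
rewrite mulrAC -(E_Z hW1)//; apply: (E_le hW1).
- by apply: pg_norm; exact: ge0_pg_affine.
- exact: pgZ.
move=> t; apply: le_trans (hC _) _; rewrite -!mulrA ler_wpM2l// -!exprMn.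
rewrite lerXn2r ?nnegrE ?mulr_ge0//; apply: le_trans (Wr_affine _ _ _) _.
by rewrite le_eqVlt; apply/orP; left; apply/eqP; ring.
Qed.

(* [G1] and [G2] play the first two derivatives of [G]; only the Taylor bound is used. *)
Definition test_fun (c : R) (G G1 G2 : R -> R) :=
  [/\ continuous G, forall x, 0 <= G x, pg G, pg G1 & pg G2] /\
  (forall x y, `|G (x + y) - (G x + G1 x * y + G2 x / 2 * y ^+ 2)| <= `|y| ^+ 3) /\
  (forall x, `|G2 x| <= c * (1 + `|x|)).

Section Test.
Variables (c : R) (G G1 G2 : R -> R).
Hypothesis tG : test_fun c G G1 G2.

Lemma heat_taylor v a y :
  `|heat v G (a + y) - (heat v G a + heat v G1 a * y + heat v G2 a / 2 * y ^+ 2)| <= `|y| ^+ 3.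
Proof.
case: tG => -[cG G0 pG pG1 pG2] [hT _].
have p0 b := ge0_pg_affine b (Num.sqrt v) pG.
have p1 := pgZr y (ge0_pg_affine a (Num.sqrt v) pG1).
have p2 := pgZr (y ^+ 2) (pgZr 2^-1 (ge0_pg_affine a (Num.sqrt v) pG2)).
have p12 : pg (fun t => G (a + Num.sqrt v * t) + G1 (a + Num.sqrt v * t) * y +
   G2 (a + Num.sqrt v * t) / 2 * y ^+ 2).
  by apply: (pgD hW1) => //; apply: (pgD hW1).
rewrite /heat.
have -> : E1 (fun t => G (a + Num.sqrt v * t)) + E1 (fun t => G1 (a + Num.sqrt v * t)) * y +
   E1 (fun t => G2 (a + Num.sqrt v * t)) / 2 * y ^+ 2 =
   E1 (fun t => G (a + Num.sqrt v * t) + G1 (a + Num.sqrt v * t) * y +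
   G2 (a + Num.sqrt v * t) / 2 * y ^+ 2).
  rewrite (E_D hW1) ?(E_D hW1) ?(E_Zr hW1)//; [exact: ge0_pg_affine| |exact: ge0_pg_affine|exact: (pgD hW1)].
  by apply: pgZr; exact: ge0_pg_affine.
apply: le_trans (E_normB hW1 (p0 _) p12) _.
rewrite -[leRHS](E_cst gam1); apply: (E_le hW1); [|exact: pg_cst|].
  by apply: pg_norm; apply: (pgB hW1).
by move=> t; rewrite addrAC; exact: hT.
Qed.

Definition K3 : R := E1 (fun t => `|t| ^+ 3).

(** A Gaussian increment of variance [v] is centred, so it has the same second-order expansion as
    any centred summand of variance [v]; comparing the two expansions is one step of Lindeberg's
    replacement. *)
Lemma heat_incr v w a : 0 <= v -> 0 <= w ->
  `|heat (v + w) G a - (heat w G a + heat w G2 a / 2 * v)| <= K3 * Num.sqrt v ^+ 3.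
Proof.
case: tG => -[cG G0 pG pG1 pG2] [hT _] v0 w0.
rewrite -heat_conv//; have pid := pg_id R.
have q1 := pgZ (heat w G1 a * Num.sqrt v) pid.
have q2 := pgZ (heat w G2 a / 2 * v) (pgX 2 pid).
have q0 : pg (fun=> heat w G a) by exact: pg_cst.
have q12 : pg (fun t => heat w G a + heat w G1 a * Num.sqrt v * idfun t + heat w G2 a / 2 * v * idfun t ^+ 2).
  by apply: (pgD hW1) => //; apply: (pgD hW1).
have -> : heat w G a + heat w G2 a / 2 * v =
   E1 (fun t => heat w G a + heat w G1 a * Num.sqrt v * idfun t + heat w G2 a / 2 * v * idfun t ^+ 2).
  rewrite (E_D hW1) ?(E_D hW1) ?E_cst ?(E_Z hW1) ?E1_id ?E1_sqr//; last 2 first.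
  - by apply: pgX.
  - by apply: (pgD hW1).
  by rewrite mulr0 addr0 mulr1.
have ph : pg (fun t => heat w G (a + Num.sqrt v * t)) by apply: ge0_pg_affine; exact: pg_heat.
apply: le_trans (E_normB hW1 ph q12) _.
have p3 : pg (fun t : R => `|t| ^+ 3) by apply: pgX; apply: pg_norm.
have -> : K3 * Num.sqrt v ^+ 3 = E1 (fun t => `|t| ^+ 3 * Num.sqrt v ^+ 3) by rewrite (E_Zr hW1).
apply: (E_le hW1).
- by apply: pg_norm; apply: (pgB hW1).
- exact: pgZr.
move=> t /=; have := heat_taylor w a (Num.sqrt v * t).
rewrite exprMn sqr_sqrtr// normrM exprMn (ger0_norm (sqrtr_ge0 v)) mulrA mulrA.
by rewrite [X in _ <= X]mulrC.
Qed.

Lemma K3_ge0 : 0 <= K3. Proof. by apply: E_ge0 => t; rewrite exprn_ge0. Qed.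

(** Will be applied with [v] the random conditional variance and [w] its limit, hence a constant
    free of [v]: the expansion is made at the smaller of the two. The quadratic term absorbs large
    deviations, by [q ^+ 3 <= q ^+ 2 + q ^+ 4]. *)
Lemma heat_close v w : 0 <= c -> 0 <= v -> 0 <= w ->
  `|heat v G 0 - heat w G 0| <= (c * (2 + w) + K3) * (`|v - w| + `|v - w| ^+ 2).
Proof.
case: (tG) => -[cG G0 pG pG1 pG2] [hT hc] c0 v0 w0.
have h2 u : 0 <= u -> `|heat u G2 0| <= c * (2 + u).
  move=> u0; apply: le_trans (E_norm hW1 (ge0_pg_affine _ _ pG2)) _.
  have pid := pg_norm (pg_id R).
  apply: (@le_trans _ _ (E1 (fun t => c * (1 + Num.sqrt u * `|idfun t|)))).
    apply: (E_le hW1); first by apply: pg_norm; exact: ge0_pg_affine.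
      by apply: pgZ; apply: (pgD hW1); [exact: pg_cst|exact: pgZ].
    move=> t /=; apply: le_trans (hc _) _.
    by rewrite add0r normrM (ger0_norm (sqrtr_ge0 u)).
  rewrite (E_Z hW1); last by apply: (pgD hW1); [exact: pg_cst|exact: pgZ].
  rewrite (E_D hW1) ?E_cst ?(E_Z hW1)//; [|exact: pg_cst|exact: pgZ].
  rewrite ler_wpM2l//.
  have := E_norm_le hW1 (pg_id R) ltr01.
  rewrite E1_sqr; set e := E1 _ => he.
  have e0 : 0 <= e by apply: E_ge0.
  have := sqr_sqrtr u0; have := sqrtr_ge0 u; move: (Num.sqrt u) => q q0 qq; nra.
have key u u' : 0 <= u -> u <= u' ->
    `|heat u' G 0 - heat u G 0| <= (c * (2 + u) + K3) * (`|u' - u| + `|u' - u| ^+ 2).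
  move=> u0 uu'; have d0 : 0 <= u' - u by rewrite subr_ge0.
  have := heat_incr 0 d0 u0; rewrite subrK (ger0_norm d0); set d := u' - u => hi.
  have {}d0 : 0 <= d by [].
  have q2 := sqr_sqrtr d0; have q0 := sqrtr_ge0 d; have k0 := K3_ge0.
  have k3 : K3 * Num.sqrt d ^+ 3 <= K3 * (d + d ^+ 2).
    rewrite ler_wpM2l//.
    suff : Num.sqrt d ^+ 3 <= Num.sqrt d ^+ 2 + (Num.sqrt d ^+ 2) ^+ 2 by rewrite q2.
    move: (Num.sqrt d) q0 => q q0.
    have -> : q ^+ 2 + (q ^+ 2) ^+ 2 = q ^+ 3 + q ^+ 2 * (q ^+ 2 - q + 1) by ring.
    by rewrite lerDl mulr_ge0 ?sqr_ge0//; nra.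
  have -> : heat u' G 0 - heat u G 0 = (heat u' G 0 - (heat u G 0 + heat u G2 0 / 2 * d)) +
    heat u G2 0 / 2 * d by ring.
  apply: le_trans (ler_normD _ _) _; rewrite mulrDl addrC lerD//; last exact: le_trans hi k3.
  rewrite normrM (ger0_norm d0) normrM [`|2^-1|]gtr0_norm ?invr_gt0//.
  have hz := h2 _ u0; have z0 := normr_ge0 (heat u G2 0).
  have C0 := le_trans z0 hz.
  apply: (@le_trans _ _ (c * (2 + u) * d)).
    rewrite ler_wpM2r//; apply: le_trans hz.
    by rewrite ler_pdivrMr// mulr_natr mulr2n lerDl.
  by rewrite ler_wpM2l// lerDl sqr_ge0.
case: (leP v w) => vw.
  rewrite distrC [`|v - w|]distrC; apply: le_trans (key _ _ v0 vw) _.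
  by rewrite ler_wpM2r ?addr_ge0 ?exprn_ge0// lerD2r ler_wpM2l// lerD2l.
exact: key (ltW vw).
Qed.
End Test.
End GaussianExpectation.

(** * Sums of independent functions *)

Section IndependentSums.
Context (R : realType) (V : finType).
Variables (gam : probability R R) (mu : probability (cfg R V) R).
Hypothesis hgam : admissible_weight gam (fun t => 1 + t ^+ 2).
Hypothesis mu_rect : forall A : V -> set R, (forall j, measurable (A j)) ->
  mu (rect A) = (\prod_j gam (A j))%E.

Notation cfg := (cfg R V).
Notation E := (EE mu).
Notation pgR := (pg (@Wr R)).
Notation pg := (pg (@Wc R V)).

Let hW := cfg_weight hgam mu_rect.

Lemma pg_comp (G : R -> R) (X : cfg -> R) : pgR G -> pg X -> pg (fun y => G (X y)).
Proof.
move=> [mG [C [k [C0 hC]]]] pX; have p : pg (fun y => C * Wr (X y) ^+ k).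
  by apply: pgZ; apply: pgX; apply: (pgD hW); [exact: pg_cst|exact: pgX].
apply: (pg_le _ _ p); first exact: measurableT_comp mG (proj1 pX).
by move=> y; apply: le_trans (hC _) _; exact: ler_norm.
Qed.

(* Disjoint supports make the family independent. *)
Definition indep_family (I : eqType) (s : seq I) (D : I -> {set V}) (X : I -> cfg -> R) :=
  [/\ uniq s, forall i, i \in s -> pg (X i), forall i, i \in s -> depends (D i) (X i) &
   forall i i', i \in s -> i' \in s -> i != i' -> [disjoint D i & D i']%B].

Lemma indep_family_cons (I : eqType) (i : I) s D X : indep_family (i :: s) D X ->
  [/\ indep_family s D X, pg (X i), depends (D i) (X i),
      pg (fun y => \sum_(j <- s) X j y) &
      exists D', depends D' (fun y => \sum_(j <- s) X j y) /\ [disjoint D i & D']%B].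
Proof.
move=> [/= /andP[si us] hp hd hD].
have hp' j : j \in s -> pg (X j) by move=> js; apply: hp; rewrite inE js orbT.
split.
- split => // j; first by move=> js; apply: hd; rewrite inE js orbT.
  by move=> k js ks; apply: hD; rewrite inE ?js ?ks orbT.
- by apply: hp; rewrite mem_head.
- by apply: hd; rewrite mem_head.
- rewrite (_ : (fun x => _) = fun x => \sum_(j <- s | j \in s) X j x).
    by apply: (pg_sum hW) => j js; exact: hp'.
  by apply/funext => x; rewrite [LHS]big_seq.
exists (~: D i)%SET; split; last by rewrite finset.disjoints_subset finset.setCK.
move=> x y xy; rewrite [LHS]big_seq [RHS]big_seq; apply: eq_bigr => j js.
apply: (hd j); first by rewrite inE js orbT.
move=> k kj; apply: xy; rewrite inE.
apply: contraL kj => ki; apply/negbT.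
have ij : i != j by apply: contraNneq si => ->.
by rewrite (disjointFr (hD i j _ _ ij) ki) ?mem_head// inE js orbT.
Qed.

Section Lindeberg.
Variables (c : R) (G G1 G2 : R -> R).
Hypothesis tG : test_fun c G G1 G2.

(* Lindeberg's replacement: one summand at a time is exchanged for a Gaussian,
   the heat semigroup absorbing the Gaussians already introduced. *)
Lemma lindeberg (I : eqType) (s : seq I) D X a : indep_family s D X ->
  (forall i, i \in s -> E (X i) = 0) ->
  `|E (fun y => G (a + \sum_(i <- s) X i y)) - heat (\sum_(i <- s) E (fun y => X i y ^+ 2)) G a|
  <= \sum_(i <- s) (E (fun y => `|X i y| ^+ 3) + K3 R * Num.sqrt (E (fun y => X i y ^+ 2)) ^+ 3).
Proof.
have [[cG G0 pG pG1 pG2] _] := tG.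
have pGS (b : R) S : pg S -> pg (fun y => G (b + S y)).
  by move=> pS; apply: pg_comp => //; apply: (pgD hW) => //; exact: pg_cst.
elim: s a => [|i s ih] a iF m0.
  rewrite !big_nil /heat; under E_ext do rewrite big_nil addr0.
  rewrite E_cst; under E_ext do rewrite sqrtr0 mul0r addr0.
  by rewrite E_cst subrr normr0.
have [iFs pX dX pS [D' [dS DD']]] := indep_family_cons iF.
have m0s j : j \in s -> E (X j) = 0 by move=> js; apply: m0; rewrite inE js orbT.
rewrite !big_cons; set v := E (fun y => X i y ^+ 2); set V' := \sum_(j <- s) E _.
set eps := \sum_(j <- s) (_ + _).
set S := fun y => \sum_(j <- s) X j y in pS dS.
have v0 : 0 <= v by apply: E_ge0 => y; exact: sqr_ge0.
have V0 : 0 <= V' by apply: sumr_ge0 => j _; apply: E_ge0 => y; exact: sqr_ge0.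
pose Phi y := G (a + (X i y + S y)).
have -> : E (fun y => G (a + \sum_(j <- i :: s) X j y)) = E Phi.
  by apply: E_ext => y; rewrite big_cons.
have pPhi : pg Phi by apply: pGS; apply: (pgD hW).
pose A0 := heat V' G a; pose A1 := heat V' G1 a; pose A2 := heat V' G2 a.
pose L y := A0 + (A1 * X i y + A2 / 2 * X i y ^+ 2).
have pX2 := pgX 2 pX; have pX3 : pg (fun y => `|X i y| ^+ 3) by apply: pgX; exact: pg_norm.
have q1 := pgZ A1 pX; have q2 := pgZ (A2 / 2) pX2.
have q12 : pg (fun y => A1 * X i y + A2 / 2 * X i y ^+ 2) by exact: (pgD hW).
have pL : pg L by apply: (pgD hW) => //; exact: pg_cst.
have EL : E L = A0 + A2 / 2 * v.
  rewrite /L (E_D hW) ?E_cst ?(E_D hW) ?(E_Z hW)//; last exact: pg_cst.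
  by rewrite m0 ?mem_head// mulr0 add0r.
(* Freezing the coordinates of [X i] turns this summand into a shift of the starting point, to which
   the induction hypothesis applies; hence the general [a]. *)
have key x : `|CE mu (D i) Phi x - L x| <= eps + `|X i x| ^+ 3.
  have -> : CE mu (D i) Phi x = E (fun y => G (a + X i x + S y)).
    apply: E_ext => y; rewrite /Phi (mix_in x y dX)// (mix_out x y dS) ?addrA//.
    by rewrite disjoint_sym.
  have h1 : `|heat V' G (a + X i x) - L x| <= `|X i x| ^+ 3.
    by rewrite /L addrA; exact: (heat_taylor tG).
  apply: le_trans (ler_distD (heat V' G (a + X i x)) _ _) _.
  by apply: lerD => //; exact: (ih (a + X i x) iFs m0s).
have pC := pg_CE hgam mu_rect (D i) pPhi.
have h1 : `|E Phi - (A0 + A2 / 2 * v)| <= eps + E (fun y => `|X i y| ^+ 3).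
  rewrite -EL -(E_CE hgam mu_rect (D i) pPhi); apply: le_trans (E_normB hW pC pL) _.
  have pe : pg (fun y => eps + `|X i y| ^+ 3) by apply: (pgD hW) => //; exact: pg_cst.
  rewrite -[X in _ <= X + _](E_cst mu) -(E_D hW)//; last exact: pg_cst.
  by apply: (E_le hW) => //; apply: pg_norm; apply: (pgB hW).
have h2 := heat_incr tG a v0 V0; rewrite -/A0 -/A2 in h2.
apply: le_trans (ler_distD (A0 + A2 / 2 * v) _ _) _.
rewrite [X in _ + X]distrC [leRHS]addrC addrA; apply: lerD => //.
Qed.
End Lindeberg.

Fixpoint momC (q : nat) (C : nat -> R) : R :=
  if q is p.+1 then
    \sum_(k < p.*2.+3) 'C(p.*2.+2, k)%:R * ((1 + momC p C) * C p.+1)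
  else 1.

Lemma momC_ge0 q C : (forall k, 0 <= C k) -> 0 <= momC q C.
Proof.
move=> C0; elim: q => [|q ih] /=; first exact: ler01.
by apply: sumr_ge0 => k _; rewrite !mulr_ge0// addr_ge0.
Qed.

Let norm_exp_le (t : R) k m : (k <= m)%N -> `|t| ^+ k <= 1 + `|t| ^+ m.
Proof.
move=> km; have t0 := normr_ge0 t; case: (leP `|t| 1) => t1.
  by rewrite (le_trans (exprn_ile1 _ _ _))// lerDl exprn_ge0.
by rewrite (le_trans (ler_weXn2l _ km)) ?(ltW t1)// lerDr.
Qed.

Let even_norm (t : R) k : t ^+ k.*2 = `|t| ^+ k.*2.
Proof. by rewrite -!mul2n !exprM real_normK ?num_real. Qed.

(** Induction on [q], then on the number of summands, by expanding the newest one binomially. Its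
    linear term vanishes by centring, and the terms with at least two copies of it leave a power at
    most [q.*2] of the old sum, of order [n ^ q] by induction. Each summand thus adds [O(n ^ q)]. *)
Lemma even_moment_indep_sum (C : nat -> R) q (I : eqType) (s : seq I) D X :
  (forall k, 0 <= C k) ->
  indep_family s D X -> (forall i, i \in s -> E (X i) = 0) ->
  (forall i k, i \in s -> E (fun y => 1 + X i y ^+ k.*2) <= C k) ->
  E (fun y => (\sum_(i <- s) X i y) ^+ q.*2) <= momC q C * (size s)%:R ^+ q.
Proof.
move=> C0 iF m0 hC.
elim: q s iF m0 hC => [|q ihq] s.
  move=> *; rewrite double0 mul1r expr0.
  by under E_ext do rewrite expr0; rewrite E_cst.
elim: s => [|i s ihs] iF m0 hC.
  rewrite expr0n mulr0; under E_ext do rewrite big_nil expr0n doubleS/=.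
  by rewrite E_cst.
have [iFs pX dX pS [D' [dS DD']]] := indep_family_cons iF.
have m0s j : j \in s -> E (X j) = 0 by move=> js; apply: m0; rewrite inE js orbT.
have hCs j k : j \in s -> E (fun y => 1 + X j y ^+ k.*2) <= C k.
  by move=> js; apply: hC; rewrite inE js orbT.
set S := fun y => \sum_(j <- s) X j y in pS dS.
have {ihs} := ihs iFs m0s hCs; rewrite -/S.
have {ihq} := ihq s iFs m0s hCs; rewrite -/S.
set n := size s => ihq ihs.
have -> : E (fun y => (\sum_(j <- i :: s) X j y) ^+ q.+1.*2) =
   \sum_(k < q.*2.+3) 'C(q.*2.+2, k)%:R * (E (fun y => S y ^+ (q.*2.+2 - k)) * E (fun y => X i y ^+ k)).
  transitivity (\sum_(k < q.*2.+3) E (fun y => (S y ^+ (q.*2.+2 - k) * X i y ^+ k) *+ 'C(q.*2.+2, k))).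
    rewrite -(E_sum hW); last first.
      move=> k _; apply: (pg_ext (g := fun y => 'C(q.*2.+2, k)%:R * (S y ^+ (q.*2.+2 - k) * X i y ^+ k))).
        by move=> y; rewrite mulr_natl.
      by apply: pgZ; apply: pgM; apply: pgX.
    by apply: E_ext => y; rewrite big_cons doubleS addrC exprDn.
  apply: eq_bigr => k _; under E_ext do rewrite -mulr_natl.
  rewrite (E_Z hW); last by apply: pgM; apply: pgX.
  congr (_ * _); apply: (E_indep hgam mu_rect (D := D') (D' := D i)); try exact: pgX.
  - by move=> x y xy; rewrite (dS x y xy).
  - by move=> x y xy; rewrite (dX x y xy).
  - by rewrite disjoint_sym.
have mS0 : 0 <= momC q C by exact: momC_ge0.
have eM : momC q.+1 C = (1 + momC q C) * C q.+1 +
    \sum_(k < q.*2.+2) 'C(q.*2.+2, k.+1)%:R * ((1 + momC q C) * C q.+1).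
  by rewrite /= big_ord_recl/= bin0 mul1r.
move: ihs; rewrite eM => ihs {eM}.
rewrite big_ord_recl/= subn0 bin0 mul1r -doubleS.
rewrite [X in _ * X + _](_ : _ = 1); last by under E_ext do rewrite expr0; rewrite E_cst.
rewrite mulr1.
have n0 : 0 <= n%:R :> R by [].
have hk (k : 'I_q.*2.+2) : E (fun y => S y ^+ (q.*2.+2 - k.+1)) * E (fun y => X i y ^+ k.+1) <=
    (1 + momC q C) * C q.+1 * (n.+1%:R) ^+ q.
  have rhs0 : 0 <= (1 + momC q C) * C q.+1 * (n.+1%:R) ^+ q.
    by rewrite !mulr_ge0 ?exprn_ge0// addr_ge0.
  (* The index is shifted by one: [k = 0] is the linear term. *)
  case: (posnP k) => [->|k0].
    rewrite [X in _ * X](_ : _ = E (X i)); last by apply: E_ext => y; rewrite expr1.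
    by rewrite m0 ?mem_head// mulr0.
  apply: le_trans (ler_norm _) _; rewrite normrM [leRHS]mulrAC; apply: ler_pM => //.
    apply: le_trans (E_norm hW (pgX _ pS)) _.
    apply: (@le_trans _ _ (E (fun y => 1 + S y ^+ q.*2))).
      apply: (E_le hW).
      - by apply: pg_norm; apply: pgX.
      - by apply: (pgD hW); [exact: pg_cst|exact: pgX].
      - move=> y; rewrite normrX even_norm; apply: norm_exp_le.
        have h : (2 + q.*2 <= k.+1 + q.*2)%N by rewrite leq_add2r ltnS.
        by rewrite leq_subLR.
    rewrite (E_D hW) ?E_cst; [|exact: pg_cst|exact: pgX].
    rewrite mulrDl mul1r lerD//; first by rewrite exprn_ege1// ler1n.
    apply: le_trans ihq _; rewrite ler_wpM2l// lerXn2r ?nnegrE//.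
    by rewrite ler_nat.
  apply: le_trans (E_norm hW (pgX _ pX)) _; apply: le_trans (hC i q.+1 (mem_head _ _)).
  apply: (E_le hW).
  - by apply: pg_norm; apply: pgX.
  - by apply: (pgD hW); [exact: pg_cst|exact: pgX].
  - move=> y; rewrite normrX even_norm; apply: norm_exp_le.
    by rewrite doubleS; exact: ltn_ord k.
apply: le_trans (lerD ihs (ler_sum _ (fun k _ => ler_wpM2l (ler0n _ _) (hk k)))) _.
set A := (1 + momC q C) * C q.+1; set N1 := n.+1%:R ^+ q.
have A0 : 0 <= A by rewrite mulr_ge0// addr_ge0.
have N10 : 0 <= N1 by rewrite exprn_ge0.
rewrite [X in _ + X <= _](_ : _ = (\sum_(k < q.*2.+2) 'C(q.*2.+2, k.+1)%:R * A) * N1); last first.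
  by rewrite mulr_suml; apply: eq_bigr => k _; rewrite -mulrA.
set B := \sum_(k < q.*2.+2) _; have B0 : 0 <= B by apply: sumr_ge0 => k _; rewrite mulr_ge0.
have hn : n%:R ^+ q.+1 <= n%:R * N1.
  by rewrite exprS ler_wpM2l// lerXn2r ?nnegrE// ler_nat.
rewrite [n.+1%:R ^+ q.+1]exprS -/N1 -natr1 [leRHS](_ : _ = (A + B) * (n%:R * N1) + (A * N1 + B * N1)); last by ring.
apply: lerD; first by rewrite ler_wpM2l// addr_ge0.
by rewrite lerDr mulr_ge0.
Qed.

End IndependentSums.

(** * Computation trees *)

Section Walks.
Context (r : nat) (V E : finType) (vtx : E -> 'I_r -> V) (L : nat).
Hypothesis girth : girth_ge vtx (4 * L + 4).

(** The sequences are total, but only the variables up to [k] and the factors below [k] count. The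
    last two clauses forbid backtracking at factors and at variables. *)
Definition walk (k : nat) (vs : nat -> V) (fs : nat -> E) :=
  forall t, (t < k)%N -> [/\ incident vtx (fs t) (vs t), incident vtx (fs t) (vs t.+1),
    vs t <> vs t.+1 & (t.+1 < k)%N -> fs t <> fs t.+1].

(* A shortest closed non-backtracking walk is a cycle. *)
Lemma no_closed_walk k vs fs : (0 < k)%N -> (k <= 2 * L + 1)%N -> walk k vs fs ->
  vs 0%N <> vs k.
Proof.
elim/ltn_ind: k vs fs => k ih vs fs k0 kL wk e.
have sub p q : (p < q)%N -> (q < k)%N -> vs p <> vs q.
  move=> pq qk; have := ih (q - p)%N ltac:(lia) (fun t => vs (p + t)%N) (fun t => fs (p + t)%N)
    ltac:(lia) ltac:(lia); rewrite addn0 subnKC; last by lia.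
  apply => t tk; have [h1 h2 h3 h4] := wk (p + t)%N ltac:(lia).
  by rewrite addnS; split => // tk'; apply: h4; lia.
have k2 : (2 <= k)%N.
  case: k k0 wk e {ih kL sub} => // -[|//] _ wk e.
  by have [_ _ h _] := wk 0%N ltac:(lia).
(* A closed walk of [k <= 2L + 1] steps has length [2k <= 4L + 2] in the factor graph, below the
   girth. *)
apply: (girth k2); first by lia.
exists vs, fs; split; [|split].
- move=> p q; rewrite !inE => pk qk pq; apply/eqP; rewrite eqn_leq.
  by apply/andP; split; rewrite leqNgt; apply/negP => h; [apply: (sub q p)|apply: (sub p q)].
(* A factor met twice gives a shorter closed walk: from [vs q] the factor [fs q = fs p] leads
   straight back to [vs p.+1]. *)
- have fsub p q : (p < q)%N -> (q < k)%N -> fs p <> fs q.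
    move=> pq qk epq; have [q1|q1] := ltnP p.+1 q; last first.
      have eqp : q = p.+1 by lia.
      by have [_ _ _ h] := wk p ltac:(lia); apply: h; rewrite -?eqp//; lia.
    apply: (ih (q - p)%N ltac:(lia) (fun t => if (t < q - p)%N then vs (p.+1 + t)%N else vs p.+1)
      (fun t => fs (p.+1 + t)%N)).
    + lia.
    + lia.
    + move=> t tk; have [h1 h2 h3 h4] := wk (p.+1 + t)%N ltac:(lia).
      rewrite tk; case: ifP => tk'.
        rewrite addnS; split => //; move=> _; apply: h4; lia.
      have et : (p.+1 + t = q)%N by lia.
      rewrite et in h1 h2 h3 h4 *; split => //.
      * by rewrite -epq; have [_ ? _ _] := wk p ltac:(lia).
      * by move=> /esym; apply: sub => //; lia.
    + by rewrite addn0; case: ifP; case: ifP => //; lia.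
  move=> p q; rewrite !inE => pk qk pq; apply/eqP; rewrite eqn_leq.
  by apply/andP; split; rewrite leqNgt; apply/negP => h; [apply: (fsub q p)|apply: (fsub p q)].
- move=> j jk; have [h1 h2 _ _] := wk j jk; rewrite h1/=.
  have [jk'|jk'] := ltnP j.+1 k; first by rewrite modn_small.
  have ej : j.+1 = k by lia.
  by rewrite ej modnn e -ej.
Qed.

(** Local tree structure. If the first factors differ, one walk reversed and followed by the other
    is a closed walk. If only the next variables differ, the common factor joins them directly and
    the closed walk is one step shorter. Otherwise the first step is removed. *)
Lemma uniq_walk k vs fs k' vs' fs' : walk k vs fs -> walk k' vs' fs' ->
  vs 0%N = vs' 0%N -> vs k = vs' k' -> (k + k' <= 2 * L + 1)%N ->
  [/\ k = k', forall t, (t <= k)%N -> vs t = vs' t & forall t, (t < k)%N -> fs t = fs' t].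
Proof.
elim: k vs fs k' vs' fs' => [|k ih] vs fs [|k'] vs' fs' wk wk' e0 ek kL.
- by split => // t; rewrite leqn0 => /eqP ->.
- by case: (no_closed_walk _ _ wk'); rewrite -?e0 ?ek//; lia.
- by case: (no_closed_walk _ _ wk); rewrite ?e0 ?ek//; lia.
have [ef|nf] := eqVneq (fs 0%N) (fs' 0%N); last first.
  case: (@no_closed_walk (k.+1 + k'.+1)%N
     (fun t => if (t <= k.+1)%N then vs (k.+1 - t)%N else vs' (t - k.+1)%N)
     (fun t => if (t <= k)%N then fs (k - t)%N else fs' (t - k.+1)%N)); [lia|lia| |].
    move=> t tk; case: (ltngtP t k) => tk'.
    - have [h1 h2 h3 h4] := wk (k - t)%N ltac:(lia).
      have [_ _ _ h5] := wk (k - t.+1)%N ltac:(lia).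
      rewrite !ifT; try lia.
      rewrite subSS (_ : (k.+1 - t)%N = (k - t).+1) in h2 *; last by lia.
      split => //; first by move/esym.
      have e1 : (k - t.+1).+1 = (k - t)%N by lia.
      by move=> _; rewrite -e1; apply/nesym/h5; lia.
    - have [h1 h2 h3 h4] := wk' (t - k.+1)%N ltac:(lia).
      have [tk1|tk1] := leqP t k.+1.
        have -> : t = k.+1 by lia.
        have h := wk' 0%N ltac:(lia).
        move: h1 h2 h3 h4; rewrite (_ : t - k.+1 = 0)%N; last by lia.
        move=> h1 h2 h3 h4; rewrite subnn !ifF; try lia.
        rewrite (_ : k.+2 - k.+1 = 1)%N; last by lia.
        by rewrite e0; split => // ?; apply: h4; lia.
      rewrite !ifF; try lia.
      rewrite (_ : (t.+1 - k.+1)%N = (t - k.+1).+1); last by lia.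
      by split => // ?; apply: h4; lia.
    - subst t; have [h1 h2 h3 h4] := wk 0%N ltac:(lia).
      have [h1' h2' h3' h4'] := wk' 0%N ltac:(lia).
      rewrite !ifT; try lia.
      rewrite !subnn subSnn; split => //; first by move/esym.
      by move=> _; apply/eqP.
  by rewrite leq0n subn0 ek ifF; [rewrite (_ : (k.+1 + k'.+1 - k.+1 = k'.+1)%N)//; lia|lia].
have [ev|nv] := eqVneq (vs 1%N) (vs' 1%N); last first.
  case: (@no_closed_walk (k + k'.+1)%N
     (fun t => if (t <= k)%N then vs (k.+1 - t)%N else vs' (t - k)%N)
     (fun t => if (t < k)%N then fs (k - t)%N else fs' (t - k)%N)); [lia|lia| |].
    move=> t tk; case: (ltngtP t k) => tk'.
    - have [h1 h2 h3 h4] := wk (k - t)%N ltac:(lia).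
      have [_ _ _ h5] := wk (k - t.+1)%N ltac:(lia).
      rewrite subSS (_ : (k.+1 - t)%N = (k - t).+1) in h2 *; last by lia.
      split => //; first by move/esym.
      have e1 : (k - t.+1).+1 = (k - t)%N by lia.
      case: ifP => tk2 _; first by rewrite -e1; apply/nesym/h5; lia.
      rewrite (_ : (t.+1 - k = 0)%N) -?ef; last by lia.
      by rewrite -e1 (_ : (k - t.+1 = 0)%N) in h5 *; [apply/nesym/h5; lia|lia].
    - have [h1 h2 h3 h4] := wk' (t - k)%N ltac:(lia).
      rewrite !ifF; try lia.
      rewrite (_ : (t.+1 - k)%N = (t - k).+1); last by lia.
      by split => // ?; apply: h4; lia.
    - subst t; have [h1 h2 h3 h4] := wk 0%N ltac:(lia).
      have [h1' h2' h3' h4'] := wk' 0%N ltac:(lia).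
      rewrite !ifF; try lia.
      rewrite !subnn subSnn; split => //; first by rewrite -ef.
        exact/eqP.
      by move=> ?; apply: h4'; lia.
  by rewrite leq0n subn0 ek ifF; [rewrite (_ : (k + k'.+1 - k = k'.+1)%N)//; lia|lia].
have [|||||eqk hv hf] := ih (vs \o S) (fs \o S) k' (vs' \o S) (fs' \o S).
- move=> t tk; have [h1 h2 h3 h4] := wk t.+1 tk; split => // ?; apply: h4; lia.
- move=> t tk; have [h1 h2 h3 h4] := wk' t.+1 tk; split => // ?; apply: h4; lia.
- exact: ev.
- exact: ek.
- lia.
by split; [rewrite eqk|case|case].
Qed.

Definition walk_from j b k vs fs := [/\ walk k vs fs, vs 0%N = j & (0 < k)%N -> fs 0%N <> b].

(* [tree m j b] and [leaf m j b]: the variables at depth < m, and exactly m, in the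
   computation tree of [j] after the edge to [b] is removed. *)
Definition tree m j b : {set V} :=
  [set x | `[< exists k vs fs, [/\ (k < m)%N, walk_from j b k vs fs & vs k = x] >]].

Definition leaf m j b : {set V} :=
  [set x | `[< exists vs fs, walk_from j b m vs fs /\ vs m = x >]].

Lemma treeP m j b x : reflect (exists k vs fs, [/\ (k < m)%N, walk_from j b k vs fs & vs k = x])
  (x \in tree m j b).
Proof. by rewrite inE; exact: asboolP. Qed.

Lemma leafP m j b x : reflect (exists vs fs, walk_from j b m vs fs /\ vs m = x)
  (x \in leaf m j b).
Proof. by rewrite inE; exact: asboolP. Qed.

Lemma treeS m j b : tree m.+1 j b = (tree m j b :|: leaf m j b)%SET.
Proof.
apply/setP => x; rewrite finset.in_setU; apply/treeP/orP => [[k [vs [fs [km w e]]]]|].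
  have [km'|km'] := ltnP k m; first by left; apply/treeP; exists k, vs, fs.
  by right; apply/leafP; exists vs, fs; rewrite (_ : m = k)//; lia.
case=> [/treeP [k [vs [fs [km w e]]]]|/leafP [vs [fs [w e]]]].
  by exists k, vs, fs; split => //; lia.
by exists m, vs, fs.
Qed.

Lemma leaf0 j b : leaf 0 j b = [set j]%SET.
Proof.
apply/setP => x; rewrite finset.in_set1; apply/leafP/eqP => [[vs [fs [[_ <- _] <-]]]|->] //.
by exists (fun=> j), (fun=> b).
Qed.

Lemma tree_root m j b : j \in tree m.+1 j b.
Proof. by apply/treeP; exists 0%N, (fun=> j), (fun=> b). Qed.

Lemma disjoint_tree_leaf m j b : (m <= L.+1)%N -> [disjoint tree m j b & leaf m j b]%B.
Proof.
move=> mL; apply/pred0P => x /=; apply/negP => /andP[].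
move=> /treeP [k [vs [fs [km [w e0 _] ek]]]] /leafP [vs' [fs' [[w' e0' _] ek']]].
have [] := uniq_walk w w' (etrans e0 (esym e0')) (etrans ek (esym ek')); lia.
Qed.

Section Child.
Variables (j : V) (b c : E) (v : V).
Hypotheses (cj : incident vtx c j) (cb : c != b) (cv : incident vtx c v) (vj : v != j).

Lemma walk_child k vs fs : walk_from v c k vs fs ->
  walk_from j b k.+1 (fun t => if t is t'.+1 then vs t' else j)
                     (fun t => if t is t'.+1 then fs t' else c).
Proof.
move=> [w e0 f0]; split => //; last by move=> _; exact/eqP.
case=> [|t] tk.
  rewrite e0; split => //; first by move/eqP; rewrite eq_sym; exact/negP.
  by move=> k0; apply/nesym/f0; lia.
by have [h1 h2 h3 h4] := w t ltac:(lia); split => // ?; apply: h4; lia.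
Qed.

Lemma leaf_child m x : x \in leaf m v c -> x \in leaf m.+1 j b.
Proof. by move=> /leafP[vs [fs [w e]]]; apply/leafP; do 2 eexists; split; [exact: walk_child w|]. Qed.

Lemma tree_child m : tree m v c \subset tree m.+1 j b.
Proof.
apply/fintype.subsetP => x /treeP[k [vs [fs [km w e]]]]; apply/treeP.
by exists k.+1; do 2 eexists; split; [lia|exact: walk_child w|].
Qed.

(** The walk to [x] through the child must be the walk of length [m.+1], by uniqueness, so it has
    length exactly [m] from the child. *)
Lemma leaf_in_child m x : (m < L)%N -> x \in leaf m.+1 j b -> x \in tree m.+1 v c ->
  x \in leaf m v c.
Proof.
move=> mL /leafP[vs [fs [[w e0 _] em]]] /treeP[k [vs' [fs' [km w' e']]]].
have [wc _ _] := walk_child w'.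
have [|||[ek] _ _] := uniq_walk wc w; [by []|by rewrite em|lia|].
by apply/leafP; exists vs', fs'; rewrite -ek.
Qed.
End Child.

Lemma disjoint_children m j c v c' v' : (m <= L)%N ->
  incident vtx c j -> incident vtx c v -> v != j ->
  incident vtx c' j -> incident vtx c' v' -> v' != j ->
  (c, v) != (c', v') -> [disjoint tree m v c & tree m v' c']%B.
Proof.
move=> mL cj cv vj cj' cv' vj' ne; apply/pred0P => x /=; apply/negP => /andP[].
move=> /treeP [k [vs [fs [km w ek]]]] /treeP [k' [vs' [fs' [km' w' ek']]]].
have wc : walk k.+1 (fun t => if t is t'.+1 then vs t' else j)
   (fun t => if t is t'.+1 then fs t' else c).
  have [w1 e0 f0] := w; case=> [|t] tk.
    rewrite e0; split => //; first by move/eqP; rewrite eq_sym; exact/negP.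
    by move=> k0; apply/nesym/f0; lia.
  by have [h1 h2 h3 h4] := w1 t ltac:(lia); split => // ?; apply: h4; lia.
have wc' : walk k'.+1 (fun t => if t is t'.+1 then vs' t' else j)
   (fun t => if t is t'.+1 then fs' t' else c').
  have [w1 e0 f0] := w'; case=> [|t] tk.
    rewrite e0; split => //; first by move/eqP; rewrite eq_sym; exact/negP.
    by move=> k0; apply/nesym/f0; lia.
  by have [h1 h2 h3 h4] := w1 t ltac:(lia); split => // ?; apply: h4; lia.
have [|||_ hv hf] := uniq_walk wc wc'; [by []|by rewrite ek|lia|].
have := hf 0%N ltac:(lia); have := hv 1%N ltac:(lia) => /=.
have [_ -> _] := w; have [_ -> _] := w' => ev ec.
by move: ne; rewrite ev ec eqxx.
Qed.

(** A ball only provides paths that may backtrack. If the new factor repeats the last one, the last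
    step is redirected to [x], or dropped when [x] is the previous variable. [b0] merely fills the
    empty walk. *)
Lemma vball_walk (b0 : E) m i x : x \in vball vtx m i ->
  exists k vs fs, [/\ (k <= m)%N, walk k vs fs, vs 0%N = i & vs k = x].
Proof.
elim: m x => [|m ih] x /=.
  by rewrite finset.in_set1 => /eqP ->; exists 0%N, (fun=> i), (fun=> b0).
rewrite finset.in_setU => /orP[/ih[k [vs [fs [km w e0 ek]]]]|].
  by exists k, vs, fs; split => //; lia.
rewrite inE => /existsP[y /andP[/ih[k [vs [fs [km w e0 ek]]]] /existsP[b /andP[by_ bx]]]].
have [xy|xy] := eqVneq x y.
  by exists k, vs, fs; split; rewrite ?xy//; lia.
have [kb|kb] := boolP ((0 < k)%N && (fs k.-1 == b)).
  have {kb} [k0 /eqP eb] := andP kb.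
  have [w1 w2 w3 w4] := w k.-1 ltac:(lia).
  have [xu|xu] := eqVneq x (vs k.-1).
    exists k.-1, vs, fs; split; [lia| |by []|by []].
    move=> t tk; have [h1 h2 h3 h4] := w t ltac:(lia); split => // ?; apply: h4; lia.
  exists k, (fun t => if (t < k)%N then vs t else x), fs; split; [lia| |by rewrite k0|by rewrite ltnn].
  move=> t tk; have [h1 h2 h3 h4] := w t ltac:(lia).
  rewrite tk; case: ifP => tk'; first by split => // _; exact: h4.
  have et : t = k.-1 by lia.
  by subst t; split => //; [rewrite eb|apply/nesym/eqP].
exists k.+1, (fun t => if (t <= k)%N then vs t else x), (fun t => if (t < k)%N then fs t else b).
split; [lia| |by rewrite leq0n|by rewrite ltnn].
move=> t tk; case: (ltngtP t k) => tk'; [|lia|].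
  have [h1 h2 h3 h4] := w t ltac:(lia).
  split => // _.
  case: ifP => tk2; first by apply: h4.
  have et : t = k.-1 by lia.
  by move=> fb; case/negP: kb; rewrite -et fb eqxx andbT; lia.
subst t; split => //; first by rewrite ek.
- by rewrite ek; apply/nesym/eqP.
- lia.
Qed.

(** Links the computation tree to the sigma-algebra of the theorem: a walk of length [l + 1] and one
    of length at most [l] with the same ends would contradict uniqueness. *)
Lemma leaf_notin_vball l i b x : (l < L.+1)%N -> x \in leaf l.+1 i b -> x \notin vball vtx l i.
Proof.
move=> lL /leafP[vs [fs [[w e0 _] em]]]; apply/negP => /(vball_walk b)[k [vs' [fs' [km w' e' ek']]]].
have [] := uniq_walk w w' (etrans e0 (esym e')) (etrans em (esym ek')); lia.
Qed.
End Walks.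

(** * The message passing recursion *)

Section Model.
Context (R : realType) (r : nat) (f : {ffun 'I_r -> bool} -> bool) (delta K : R) (L : nat).
Hypothesis f1 : forall S : {set 'I_r}, #|S| = 1%N -> fhat R f S = 0.
Hypothesis delta0 : 0 < delta.
Hypothesis K0 : 0 < K.

(* One hypergraph of the sequence with its nonlinearities; [mmu] is the law of
   the initialization. *)
Record pre_model := PreModel {
  mV : finType; mE : finType; mvtx : mE -> 'I_r -> mV; md : nat;
  mF : nat -> seq R -> R;
  mmu : probability (cfg R mV) R;
  mrect : forall A : mV -> set R, (forall j, measurable (A j)) ->
    mmu (rect A) = (\prod_j gaussP delta (A j))%E;
  mreg : index_regular mvtx md;
  mgirth : girth_ge mvtx (4 * L + 4);
  md2 : (2 <= md)%N;
  mbd : forall m, (m < L)%N -> forall t : m.-tuple R, `|mF m t| <= K;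
  mmeas : forall m, (m < L)%N -> measurable_fun setT (fun t : m.-tuple R => mF m t) }.

Section OneModel.
Variable M : pre_model.
Notation V := (mV M).
Notation Ed := (mE M).
Notation vtx := (@mvtx M).
Notation d := (md M).
Notation Fto := (@mF M).
Notation mu := (mmu M).
Notation cfg := (cfg R V).
Notation E := (EE mu).
Notation pg := (pg (@Wc R V)).
Notation tree := (tree vtx).
Notation leaf := (leaf vtx).

Lemma hgam : admissible_weight (gaussP delta) (fun t => 1 + t ^+ 2).
Proof. exact: gaussP_weight. Qed.

Lemma hW : admissible_weight mu (@Wc R V).
Proof. exact: (cfg_weight hgam (@mrect M)). Qed.

(* [yf] runs through 0, z^0, z^1, ...; its increments are the products [af * vf], where
   [af] is 1, A^0, A^1, ... and [vf] is z^0, u^1, u^2, ... *)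
Definition hist m j b (z : cfg) : seq R := (msgs f vtx d Fto z m).1 j b.

Definition yf m j b (z : cfg) : R := if m is m'.+1 then zof Fto (hist m' j b z) (z j) else 0.

Definition af m j b (z : cfg) : R := if m is m'.+1 then Fto m' (hist m' j b z) else 1.

Definition vf m j b (z : cfg) : R := if m is m'.+1 then umsg f vtx d Fto z m'.+1 j b else z j.

Lemma size_hist m j b z : size (hist m j b z) = m.
Proof. by elim: m => //= m ih; rewrite /hist /= size_rcons; congr S. Qed.

Lemma histS m j b z : hist m.+1 j b z = rcons (hist m j b z) (vf m.+1 j b z).
Proof.
rewrite /vf /umsg /=; have := size_hist m j b z; rewrite /hist /= => hs.
by rewrite nth_rcons hs ltnn eqxx.
Qed.

Lemma hist_mkseq m j b z : hist m j b z = mkseq (fun k => vf k.+1 j b z) m.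
Proof. by elim: m => // m ih; rewrite histS ih mkseqS. Qed.

Lemma yfS m j b z : yf m.+1 j b z = yf m j b z + af m j b z * vf m j b z.
Proof.
case: m => [|m]; first by rewrite /= /zof /hist /= big_ord0 addr0 add0r mul1r.
rewrite /yf histS /zof size_rcons big_ord_recr/= size_hist nth_rcons size_hist ltnn eqxx.
rewrite -cats1 take_size_cat ?size_hist// -addrA; congr (_ + (_ + _)).
apply: eq_bigr => k _; rewrite takel_cat ?size_hist 1?ltnW//.
by rewrite nth_cat size_hist ltn_ord.
Qed.

(** The contribution of the factor [c] to [u^(m+1)], before normalization. *)
Definition Xf m c j (z : cfg) : R :=
  Dfat f vtx c j (fun io => yf m.+1 (vtx c io) c z) -
  Dfat f vtx c j (fun io => yf m (vtx c io) c z).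

Lemma XfE m c j z : Xf m c j z =
  Dfat f vtx c j (fun io => yf m.+1 (vtx c io) c z) -
  Dfat f vtx c j (fun io => yf m (vtx c io) c z).
Proof. by []. Qed.

(** The constant term of a derivative of [f] is a Fourier coefficient of degree one. Its vanishing
    makes [w^0 = 0] the value of the recursion at [yf 0 = 0], so that [u^1] has the same form as the
    later increments. *)
Lemma Dfat0 c j : Dfat f vtx c j (fun=> 0 : R) = 0.
Proof.
rewrite /Dfat big1// => io _; rewrite /fderiv big1// => S Sio.
have [S1|S1] := eqVneq #|S :\ io|%SET 0%N.
  by rewrite f1 ?mul0r// (cardsD1 io) Sio S1.
have /finset.set0Pn [k kS] : (S :\ io)%SET != finset.set0 by rewrite -cards_eq0.
by rewrite (bigD1 k)//= mul0r mulr0.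
Qed.

Lemma vfS m j b z :
  vf m.+1 j b z = (Num.sqrt (d.-1)%:R)^-1 * \sum_(c in (dpart vtx j :\ b)%SET) Xf m c j z.
Proof.
rewrite /vf /umsg /= nth_rcons -/(hist m j b z) size_hist ltnn eqxx.
rewrite /Xf sumrB mulrBr; congr (_ - _).
case: m => [|m] //=; rewrite big1 ?mulr0// => c _; exact: Dfat0.
Qed.

Lemma vtx_inj c : injective (vtx c). Proof. by have [h _] := mreg M; exact: h. Qed.

Lemma DfatE c io (x : 'I_r -> R) : Dfat f vtx c (vtx c io) x = fderiv f io x.
Proof.
rewrite /Dfat (bigD1 io)//= big1 ?addr0// => k /andP[/eqP ek kio].
by move: kio; rewrite (vtx_inj ek) eqxx.
Qed.

Lemma dpartP c j : reflect (exists io, vtx c io = j) (c \in dpart vtx j).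
Proof.
rewrite /dpart inE; apply: (iffP existsP) => -[io] h; exists io; first exact/eqP.
by rewrite h.
Qed.

Lemma incident_vtx c io : incident vtx c (vtx c io).
Proof. by apply/existsP; exists io. Qed.

Lemma tree_sub m j b c k : c \in (dpart vtx j :\ b)%SET -> vtx c k != j ->
  tree m (vtx c k) c \subset tree m.+1 j b.
Proof.
rewrite finset.in_setD1 /dpart inE => /andP[cb cj] kj.
by apply: tree_child => //; exact: incident_vtx.
Qed.

Lemma fderiv_depends io D (x : 'I_r -> cfg -> R) :
  (forall k, k != io -> depends D (x k)) -> depends D (fun z => fderiv f io (fun k => x k z)).
Proof.
move=> dx z z' zz'; apply: eq_bigr => S Sio; congr (_ * _); apply: eq_bigr => k.
by rewrite finset.in_setD1 => /andP[kio _]; exact: dx.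
Qed.

Lemma fderiv_pg io (x : 'I_r -> cfg -> R) :
  (forall k, k != io -> pg (x k)) -> pg (fun z => fderiv f io (fun k => x k z)).
Proof.
move=> px; apply: (pg_sum hW) => S Sio; apply: pgZ; apply: pg_prod => k.
by rewrite finset.in_setD1 => /andP[kio _]; exact: px.
Qed.

Lemma pg_coord j : pg (fun z : cfg => z j).
Proof.
split; first exact: measurable_coord.
exists 1, 1%N; split => // z; rewrite mul1r expr1 /Wc.
have h : `|z j| <= 1 + z j ^+ 2.
  by rewrite -(real_normK (num_real (z j))); have := sqr_ge0 (`|z j| - 1); have := normr_ge0 (z j); nra.
apply: le_trans h _; rewrite lerD2l (bigD1 j)//= lerDl sumr_ge0// => k _; exact: sqr_ge0.
Qed.

(** The point is the gap of one layer: [yf m] and [af m] read depths below [m], while [vf m] also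
    reads depth [m]. This makes [yf] a martingale. Strong induction, as [af] reads the whole
    history. *)
Lemma node_facts m : (m <= L)%N -> forall j b,
  [/\ pg (yf m j b), pg (vf m j b), pg (af m j b), (forall z, `|af m j b z| <= 1 + K) &
   [/\ depends (tree m j b) (yf m j b), depends (tree m.+1 j b) (vf m j b) &
       depends (tree m j b) (af m j b)]].
Proof.
have Kp : 0 <= 1 + K by have := K0; lra.
elim/ltn_ind: m => -[|m] ih mL j b.
  split; [exact: pg_cst|exact: pg_coord|exact: pg_cst| |].
    by move=> z /=; rewrite normr1 lerDl ltW.
  by split => // z z' zz'; apply: zz'; exact: tree_root.
have ihm k : (k <= m)%N -> _ := fun km => ih k km (leq_trans km (ltnW mL)).
have py : forall k, (k <= m.+1)%N -> forall j' b', pg (yf k j' b') /\ depends (tree k j' b') (yf k j' b').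
  case=> [|k] km j' b'; first by split => //; exact: pg_cst.
  have [p1 p2 p3 _ [d1 d2 d3]] := ihm k km j' b'.
  have e : (yf k.+1 j' b') =1 (fun z => yf k j' b' z + af k j' b' z * vf k j' b' z).
    by move=> z; rewrite yfS.
  split; first by apply: pg_ext (pgD hW p1 (pgM p3 p2)) => z; rewrite e.
  move=> z z' zz'; rewrite !e (d2 z z' zz').
  by rewrite (d1 z z') ?(d3 z z')// => i ik; apply: zz'; rewrite treeS finset.in_setU ik.
have Xfact c : c \in (dpart vtx j :\ b)%SET -> pg (Xf m c j) /\ depends (tree m.+2 j b) (Xf m c j).
  move=> cj; have := cj; rewrite finset.in_setD1 => /andP[cb /dpartP[io eio]].
  have ne k : k != io -> vtx c k != j by apply: contraNneq => e; apply/eqP/(@vtx_inj c); rewrite e.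
  have e : Xf m c j =1 (fun z => fderiv f io (fun k => yf m.+1 (vtx c k) c z) -
    fderiv f io (fun k => yf m (vtx c k) c z)) by move=> z; rewrite /Xf -eio !DfatE.
  split.
    rewrite (funext e); apply: (pgB hW); apply: fderiv_pg => k _.
      by have [] := py m.+1 (leqnn _) (vtx c k) c.
    by have [] := py m (leqnSn _) (vtx c k) c.
  rewrite (funext e); apply: (depends2 (fun a b : R => a - b)); apply: fderiv_depends => k kio.
    by apply: (dependsW _ (proj2 (py m.+1 _ _ _))) => //; exact: tree_sub (ne _ kio).
  apply: (dependsW _ (proj2 (py m _ _ _))) => //; apply: fintype.subset_trans (tree_sub _ cj (ne _ kio)).
  by rewrite treeS finset.subsetUl.
have [pym dym] := py m.+1 (leqnn _) j b.
have evf : vf m.+1 j b =1 (fun z => (Num.sqrt (d.-1)%:R)^-1 *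
    \sum_(c in (dpart vtx j :\ b)%SET) Xf m c j z) by move=> z; rewrite vfS.
have hk k : (k < m)%N -> pg (vf k.+1 j b) /\ depends (tree m.+1 j b) (vf k.+1 j b).
  move=> km; have [_ p2 _ _ [_ d2 _]] := ihm k.+1 km j b; split => //.
  apply: dependsW d2; apply/fintype.subsetP => x /treeP[t [vs [fs [tk w e]]]].
  by apply/treeP; exists t, vs, fs; split => //; lia.
have sh z : size (hist m j b z) == m by rewrite size_hist.
pose ht z : m.-tuple R := Tuple (sh z).
have eaf z : af m.+1 j b z = Fto m (ht z) by [].
have baf z : `|af m.+1 j b z| <= K by rewrite eaf; exact: mbd.
split => //.
- rewrite (funext evf); apply: pgZ; apply: (pg_sum hW) => c cj.
  by have [] := Xfact c cj.
- apply: (pg_bounded _ _ baf).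
  have mht : measurable_fun setT ht.
    apply/measurable_fun_tnthP => k.
    have -> : (@tnth m R)^~ k \o ht = vf k.+1 j b.
      by apply/funext => z; rewrite /= (tnth_nth 0) /= hist_mkseq nth_mkseq.
    by have [[]] := hk k (ltn_ord k).
  exact: (measurableT_comp (@mmeas M m mL) mht).
- by move=> z; apply: le_trans (baf z) _; rewrite lerDr.
split => //.
- rewrite (funext evf); apply: (depends1 (fun a : R => _ * a)); apply: depends_big => c cj.
  by case: (Xfact c cj).
- rewrite (_ : af m.+1 j b = fun z => Fto m (mkseq (fun k => vf k.+1 j b z) m)); last first.
    by apply/funext => z /=; rewrite hist_mkseq.
  apply: (depends1 (Fto m)) => z z' zz'; apply/eq_in_map => k; rewrite mem_iota add0n => /andP[_ km].
  by have [_ dk] := hk k km; exact: dk.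
Qed.

End OneModel.
End Model.

(** * Conditional centring and orthogonality of the messages *)

Section IndependentSquares.
Context (R : realType) (V : finType).
Variables (gam : probability R R) (mu : probability (cfg R V) R).
Hypothesis hgam : admissible_weight gam (fun t => 1 + t ^+ 2).
Hypothesis mu_rect : forall A : V -> set R, (forall j, measurable (A j)) ->
  mu (rect A) = (\prod_j gam (A j))%E.
Notation E := (EE mu).
Let hW := cfg_weight hgam mu_rect.

Lemma E_coord j (g : R -> R) : pg (@Wr R) g -> E (fun z => g (z j)) = EE gam g.
Proof.
move=> pgg; have ig : gam.-integrable setT (EFin \o g) by exact: (pg_int hgam).
have mg : measurable_fun setT (EFin \o g) by apply/measurable_EFinP; exact: (proj1 pgg).
have hm : forall A, measurable A -> mu ((fun x : cfg R V => x j) @^-1` A) = gam A.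
  by move=> A mA; exact: (mu_coord mu_rect).
have := integral_image (measurable_coord (V := V) j) hm mg
  ((integrable_image (measurable_coord (V := V) j) hm mg).1 ig).
by rewrite /EE /Rintegral => <-.
Qed.

Lemma E_sqr_indep_sum (I : eqType) (s : seq I) D X : indep_family s D X ->
  (forall i, i \in s -> E (X i) = 0) ->
  E (fun y => (\sum_(i <- s) X i y) ^+ 2) = \sum_(i <- s) E (fun y => X i y ^+ 2).
Proof.
elim: s => [|i s ih] iF m0.
  by rewrite big_nil -[RHS](E_cst mu); apply: E_ext => y; rewrite big_nil expr0n.
have [iFs pX dX pS [D' [dS DD']]] := indep_family_cons hgam mu_rect iF.
have m0s j : j \in s -> E (X j) = 0 by move=> js; apply: m0; rewrite inE js orbT.
rewrite big_cons -ih//; set S := fun y => \sum_(j <- s) X j y.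
have q1 := pgX 2 pX; have q2 := pgX 2 pS; have q3 := pgZ 2 (pgM pX pS).
transitivity (E (fun y => X i y ^+ 2 + (2 * (X i y * S y) + S y ^+ 2))).
  by apply: E_ext => y; rewrite big_cons /S; ring.
rewrite (E_D hW) ?(E_D hW)//; last exact: (pgD hW).
rewrite (E_Z hW); last exact: pgM.
by rewrite (E_indep hgam mu_rect pX pS dX dS DD') m0 ?mem_head// mul0r mulr0 add0r.
Qed.

(** Freezing coordinates does not enlarge supports, so statements about independent families hold
    conditionally without a second proof. *)
Lemma indep_family_mix (I : eqType) (s : seq I) (D : I -> {set V}) (X : I -> cfg R V -> R) B x : indep_family s D X ->
  indep_family s D (fun i y => X i (mix B x y)).
Proof.
move=> [us hp hd hD]; split => // i si; first by apply: pg_mix; exact: hp.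
by move=> y z yz; apply: (hd i si) => k kD; rewrite /mix; case: ifP => // _; exact: yz.
Qed.

Lemma CE_prod_indep (I : finType) (T : {set I}) D (g : I -> cfg R V -> R) B x :
  (forall i, i \in T -> pg (@Wc R V) (g i)) -> (forall i, i \in T -> depends (D i) (g i)) ->
  (forall i i', i \in T -> i' \in T -> i != i' -> [disjoint D i & D i']%B) ->
  CE mu B (fun z => \prod_(i in T) g i z) x = \prod_(i in T) CE mu B (g i) x.
Proof.
move=> hp hd hD; have iF : indep_family (enum T) D g.
  by split; [exact: enum_uniq|move=> i|move=> i|move=> i i']; rewrite !mem_enum; auto.
have [us hp' hd' hD'] := indep_family_mix B x iF.
rewrite /CE -[RHS]big_enum/= -(E_prod_indep hgam mu_rect us hp' hd' hD').
by apply: E_ext => y; rewrite -[LHS]big_enum.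
Qed.

End IndependentSquares.

Section ModelMartingale.
Context (R : realType) (r : nat) (f : {ffun 'I_r -> bool} -> bool) (delta K : R) (L : nat).
Hypothesis f1 : forall S : {set 'I_r}, #|S| = 1%N -> fhat R f S = 0.
Hypothesis delta0 : 0 < delta.
Hypothesis K0 : 0 < K.
Variable M : pre_model r delta K L.
Notation V := (mV M).
Notation Ed := (mE M).
Notation vtx := (@mvtx _ _ _ _ _ M).
Notation d := (md M).
Notation mu := (mmu M).
Notation cfg := (cfg R V).
Notation E := (EE mu).
Notation CE := (CE mu).
Notation pg := (pg (@Wc R V)).
Notation tree := (tree vtx).
Notation leaf := (leaf vtx).
Notation yf := (@yf R r f delta K L M).
Notation vf := (@vf R r f delta K L M).
Notation af := (@af R r f delta K L M).
Notation Xf := (@Xf R r f delta K L M).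

Let hg := hgam delta0.
Let hr := @mrect _ _ _ _ _ M.
Let hW : admissible_weight mu (@Wc R V) := hW delta0 M.
Let girth := @mgirth _ _ _ _ _ M.
Let nf m (mL : (m <= L)%N) := @node_facts _ _ _ _ _ _ f1 delta0 K0 M m mL.

Let pyf m j b : (m <= L)%N -> pg (yf m j b). Proof. by move=> /nf /(_ j b) []. Qed.
Let pvf m j b : (m <= L)%N -> pg (vf m j b). Proof. by move=> /nf /(_ j b) []. Qed.
Let paf m j b : (m <= L)%N -> pg (af m j b). Proof. by move=> /nf /(_ j b) []. Qed.
Let dyf m j b : (m <= L)%N -> depends (tree m j b) (yf m j b).
Proof. by move=> /nf /(_ j b) [_ _ _ _ []]. Qed.
Let daf m j b : (m <= L)%N -> depends (tree m j b) (af m j b).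
Proof. by move=> /nf /(_ j b) [_ _ _ _ []]. Qed.

Lemma tree_nleaf m j b : (m <= L)%N -> tree m j b \subset (~: leaf m j b)%SET.
Proof.
by move=> mL; rewrite -finset.disjoints_subset; apply: disjoint_tree_leaf girth _ _ _ _; lia.
Qed.

Section Factor.
Variables (m : nat) (j : V) (b c : Ed).
Hypotheses (mL : (m < L)%N) (cj : c \in (dpart vtx j :\ b)%SET).

Notation B := (~: leaf m.+1 j b)%SET.

Let incj : incident vtx c j.
Proof. by move: cj; rewrite finset.in_setD1 /dpart inE => /andP[]. Qed.
Let ncb : c != b. Proof. by move: cj; rewrite finset.in_setD1 => /andP[]. Qed.

(** Inside the tree of a child, the deepest layer of the parent is the deepest layer of the
    child. *)
Lemma CE_child k g x : vtx c k != j -> depends (tree m.+1 (vtx c k) c) g ->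
  CE B g x = CE (~: leaf m (vtx c k) c)%SET g x.
Proof.
move=> kj dg; apply: (CE_restrict _ _ dg); apply/setP => i; rewrite !finset.in_setI !finset.in_setC.
case: (boolP (i \in tree m.+1 _ _)) => [it|_]; last by rewrite !andbF.
rewrite !andbT; congr (~~ _); apply/idP/idP => h.
  exact: (leaf_in_child girth incj ncb (incident_vtx c k) kj mL h it).
exact: (leaf_child incj ncb (incident_vtx c k) kj h).
Qed.

Lemma child_disjoint k k' : vtx c k != j -> vtx c k' != j -> k != k' ->
  [disjoint tree m.+1 (vtx c k) c & tree m.+1 (vtx c k') c]%B.
Proof.
move=> kj kj' kk'; apply: (disjoint_children girth mL incj (incident_vtx c k) kj
  incj (incident_vtx c k') kj').
by apply/eqP => -[] /(@vtx_inj _ _ _ _ _ M c) e; rewrite e eqxx in kk'.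
Qed.

Definition Dc : {set V} := (\bigcup_(k | vtx c k != j) tree m.+1 (vtx c k) c)%SET.

Lemma sub_Dc k : vtx c k != j -> tree m.+1 (vtx c k) c \subset Dc.
Proof.
move=> kj; apply/fintype.subsetP => i ik; apply/finset.bigcupP.
by exists k.
Qed.

Lemma Xf_io io z : vtx c io = j -> Xf m c j z =
  fderiv f io (fun k => yf m.+1 (vtx c k) c z) - fderiv f io (fun k => yf m (vtx c k) c z).
Proof. by move=> e; rewrite XfE -e !DfatE. Qed.

Let ne io k : vtx c io = j -> k != io -> vtx c k != j.
Proof. by move=> e; apply: contraNneq => h; apply/eqP/(@vtx_inj _ _ _ _ _ M c); rewrite h. Qed.

Lemma Xf_pg : pg (Xf m c j).
Proof.
have [io e] := dpartP _ _ (proj2 (andP (eq_ind _ is_true cj _ (finset.in_setD1 _ _ _)))).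
rewrite (funext (fun z => Xf_io z e)); apply: (pgB hW); apply: (fderiv_pg f delta0) => k _; apply: pyf; lia.
Qed.

Lemma Xf_depends : depends Dc (Xf m c j).
Proof.
have [io e] := dpartP _ _ (proj2 (andP (eq_ind _ is_true cj _ (finset.in_setD1 _ _ _)))).
rewrite (funext (fun z => Xf_io z e)); apply: (depends2 (fun a b : R => a - b)); apply: (fderiv_depends f) => k kio.
  by apply: dependsW (sub_Dc (ne e kio)) _; exact: dyf.
apply: dependsW (sub_Dc (ne e kio)) _.
by apply: dependsW (dyf (ltnW mL)); rewrite treeS finset.subsetUl.
Qed.

(** The induction hypothesis of [CE_vf], where it is discharged. *)
Hypothesis ih : forall j' b' x, CE (~: leaf m j' b')%SET (vf m j' b') x = 0.

Lemma CE_yf_child k x : vtx c k != j -> CE B (yf m.+1 (vtx c k) c) x = yf m (vtx c k) c x.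
Proof.
move=> kj; have mL' := ltnW mL; rewrite (CE_child x kj); last exact: dyf.
have -> : yf m.+1 (vtx c k) c = fun z => yf m (vtx c k) c z + af m (vtx c k) c z * vf m (vtx c k) c z.
  by apply/funext => z; rewrite yfS.
have p1 := pyf (vtx c k) c mL'; have p2 := pvf (vtx c k) c mL'; have p3 := paf (vtx c k) c mL'.
rewrite (CE_D hg hr)//; last exact: pgM.
rewrite (CE_mull hg hr _ p2); last exact: dependsW (tree_nleaf _ _ mL') (daf mL').
by rewrite ih mulr0 addr0 CE_id//; exact: dependsW (tree_nleaf _ _ mL') (dyf mL').
Qed.

Lemma CE_yf_old k x : vtx c k != j -> CE B (yf m (vtx c k) c) x = yf m (vtx c k) c x.
Proof.
move=> kj; have mL' := ltnW mL; have dy : depends (tree m (vtx c k) c) (yf m (vtx c k) c) := dyf mL'.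
rewrite (CE_child x kj); last by apply: dependsW dy; rewrite treeS finset.subsetUl.
by rewrite CE_id//; exact: dependsW (tree_nleaf _ _ mL') dy.
Qed.

(** The derivative is multilinear and the children have disjoint trees, so conditional means may be
    substituted for its arguments. *)
Lemma CE_fderiv io (g g' : 'I_r -> cfg -> R) x : vtx c io = j ->
  (forall k, k != io -> [/\ pg (g k), depends (tree m.+1 (vtx c k) c) (g k) & CE B (g k) x = g' k x]) ->
  CE B (fun z => fderiv f io (fun k => g k z)) x = fderiv f io (fun k => g' k x).
Proof.
move=> e hgk; rewrite /fderiv (CE_sum hg hr); last first.
  move=> S _; apply: pgZ; apply: pg_prod => k; rewrite finset.in_setD1 => /andP[kio _].
  by have [] := hgk k kio.
apply: eq_bigr => S _; rewrite (CE_Z hg hr); last first.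
  by apply: pg_prod => k; rewrite finset.in_setD1 => /andP[kio _]; have [] := hgk k kio.
congr (_ * _); rewrite (CE_prod_indep hg hr (D := fun k => tree m.+1 (vtx c k) c)).
- by apply: eq_bigr => k; rewrite finset.in_setD1 => /andP[kio _]; have [] := hgk k kio.
- by move=> k; rewrite finset.in_setD1 => /andP[kio _]; have [] := hgk k kio.
- by move=> k; rewrite finset.in_setD1 => /andP[kio _]; have [] := hgk k kio.
- move=> k k'; rewrite !finset.in_setD1 => /andP[kio _] /andP[kio' _] kk'.
  by apply: child_disjoint; [exact: ne e kio|exact: ne e kio'|].
Qed.

Lemma CE_Dnew io x : vtx c io = j -> CE B (fun z => fderiv f io (fun k => yf m.+1 (vtx c k) c z)) x =
  fderiv f io (fun k => yf m (vtx c k) c x).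
Proof.
move=> e; apply: (CE_fderiv (g' := fun k => yf m (vtx c k) c)) => // k kio; split.
- exact: pyf.
- exact: dyf.
- exact: CE_yf_child (ne e kio).
Qed.

Lemma CE_Xf x : CE B (Xf m c j) x = 0.
Proof.
have [io e] := dpartP _ _ (proj2 (andP (eq_ind _ is_true cj _ (finset.in_setD1 _ _ _)))).
have mL' := ltnW mL.
rewrite (funext (fun z => Xf_io z e)) (CE_B hg hr); last 2 first.
- by apply: (fderiv_pg f delta0) => k _; exact: pyf.
- by apply: (fderiv_pg f delta0) => k _; exact: pyf.
rewrite CE_Dnew// (CE_fderiv (g' := fun k => yf m (vtx c k) c)) ?subrr// => k kio; split.
- exact: pyf.
- by apply: dependsW (dyf mL'); rewrite treeS finset.subsetUl.
- exact: CE_yf_old (ne e kio).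
Qed.

(** Pythagoras: the old derivative [Q] is the conditional expectation of the new one [P], hence
    orthogonal to [P - Q]. *)
Lemma E_Xf_sqr io : vtx c io = j -> E (fun z => Xf m c j z ^+ 2) =
  E (fun z => fderiv f io (fun k => yf m.+1 (vtx c k) c z) ^+ 2) -
  E (fun z => fderiv f io (fun k => yf m (vtx c k) c z) ^+ 2).
Proof.
move=> e; have mL' := ltnW mL.
set P := fun z => fderiv f io (fun k => yf m.+1 (vtx c k) c z).
set Q := fun z => fderiv f io (fun k => yf m (vtx c k) c z).
have pP : pg P by apply: (fderiv_pg f delta0) => k _; exact: pyf.
have pQ : pg Q by apply: (fderiv_pg f delta0) => k _; exact: pyf.
have dQ : depends B Q.
  apply: (fderiv_depends f) => k kio x y xy; rewrite -(CE_yf_old x (ne e kio)) -(CE_yf_old y (ne e kio)).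
  have := CE_depends mu (B := B) (dyf mL' : depends _ (yf m (vtx c k) c)).
  by apply => i; rewrite finset.in_setI => /andP[_]; exact: xy.
have pPQ := pgM pQ pP; have pX := Xf_pg.
transitivity (E (fun z => P z ^+ 2 - (2 * (Q z * P z) - Q z ^+ 2))).
  by apply: E_ext => z; rewrite (Xf_io z e); rewrite -/(P z) -/(Q z); ring.
have pP2 := pgX 2 pP; have pQ2 := pgX 2 pQ; have q1 := pgZ 2 pPQ.
rewrite (E_B hW) ?(E_B hW) ?(E_Z hW)//; last exact: (pgB hW).
have -> : E (fun z => Q z * P z) = E (fun z => Q z ^+ 2).
  rewrite -(E_CE hg hr B pPQ); apply: E_ext => x.
  by rewrite (CE_mull hg hr _ pP)// CE_Dnew.
by ring.
Qed.

End Factor.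

Lemma CE_vf m j b x : (m <= L)%N -> CE (~: leaf m j b)%SET (vf m j b) x = 0.
Proof.
elim: m j b x => [|m ih] j b x mL.
  rewrite -[RHS](E_gaussP_id delta0) -(E_coord hg hr j (pg_id R)).
  by apply: E_ext => y; rewrite leaf0 /= /mix !inE eqxx.
rewrite (funext (fun z => vfS f1 m j b z)) (CE_Z hg hr); last first.
  by apply: (pg_sum hW) => c cj; exact: Xf_pg mL cj.
rewrite (CE_sum hg hr); last by move=> c cj; exact: Xf_pg mL cj.
rewrite big1 ?mulr0// => c cj; apply: (CE_Xf mL cj) => j' b' x'.
by apply: ih; exact: ltnW.
Qed.

Lemma E_yfS m j b g : (m <= L)%N -> pg g -> depends (tree m j b) g ->
  E (fun z => g z * vf m j b z) = 0.
Proof.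
move=> mL pgg dg; have pv := pvf j b mL.
rewrite -(E_CE hg hr (~: leaf m j b)%SET (pgM pgg pv)) -[RHS](E_cst mu).
apply: E_ext => x; rewrite (CE_mull hg hr _ pv) ?CE_vf ?mulr0//.
exact: dependsW (tree_nleaf _ _ mL) dg.
Qed.

Lemma E_yf m j b : (m <= L)%N -> E (yf m j b) = 0.
Proof.
elim: m => [|m ih] mL; first by rewrite E_cst.
have mL' := ltnW mL.
rewrite (funext (fun z => yfS f m j b z)) (E_D hW); [|exact: pyf|by apply: pgM; [exact: paf|exact: pvf]].
by rewrite ih// add0r E_yfS//; [exact: paf|exact: daf].
Qed.

Lemma E_yfS_sqr m j b : (m < L)%N -> E (fun z => yf m.+1 j b z ^+ 2) =
  E (fun z => yf m j b z ^+ 2) + E (fun z => af m j b z ^+ 2 * vf m j b z ^+ 2).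
Proof.
move=> mL; have mL' := ltnW mL.
have p1 := pyf j b mL'; have p2 := pvf j b mL'; have p3 := paf j b mL'.
have q := pgM (pgZ 2 (pgM p1 p3)) p2; have q1 := pgX 2 p1; have q2 := pgM (pgX 2 p3) (pgX 2 p2).
transitivity (E (fun z => yf m j b z ^+ 2 + (2 * (yf m j b z * af m j b z) * vf m j b z +
  af m j b z ^+ 2 * vf m j b z ^+ 2))).
  by apply: E_ext => z; rewrite yfS; ring.
rewrite (E_D hW) ?(E_D hW)//; last exact: (pgD hW).
rewrite E_yfS ?add0r//; first by apply: pgZ; exact: pgM.
move=> x y xy; congr (2 * (_ * _)); [exact: (dyf mL')|exact: (daf mL')].
Qed.

Lemma factors_indep m j b : (m < L)%N ->
  indep_family (enum (dpart vtx j :\ b)%SET) (Dc m j) (fun c => Xf m c j).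
Proof.
move=> mL; split; first exact: enum_uniq.
- by move=> c; rewrite mem_enum => cj; exact: Xf_pg mL cj.
- by move=> c; rewrite mem_enum => cj; exact: Xf_depends mL cj.
move=> c c'; rewrite !mem_enum => cj cj' cc'; apply/pred0P => i /=; apply/negP => /andP[].
move=> /finset.bigcupP[k kj ik] /finset.bigcupP[k' kj' ik'].
have ic a : a \in (dpart vtx j :\ b)%SET -> incident vtx a j.
  by rewrite finset.in_setD1 /dpart inE => /andP[].
have := disjoint_children girth mL (ic _ cj) (incident_vtx c k) kj (ic _ cj') (incident_vtx c' k') kj'.
have -> : (c, vtx c k) != (c', vtx c' k') by apply: contraNneq cc' => -[->].
by move=> /(_ isT) dis; move: (disjointFr dis ik); rewrite ik'.
Qed.

End ModelMartingale.

(** * Moment bounds uniform over the hypergraphs *)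

Section PolynomialBounds.
Context (R : realType) (r : nat) (f : {ffun 'I_r -> bool} -> bool).

Definition fnorm : R := \sum_(S : {set 'I_r}) `|fhat R f S|.

Lemma fnorm_ge0 : 0 <= fnorm. Proof. exact: sumr_ge0. Qed.

Lemma fderiv_norm_le (io : 'I_r) (x : 'I_r -> R) :
  `|fderiv f io x| <= fnorm * (1 + \sum_(k | k != io) `|x k|) ^+ r.
Proof.
set s := \sum_(k | _) _; have s0 : 0 <= s by apply: sumr_ge0.
apply: le_trans (ler_norm_sum _ _ _) _.
apply: (@le_trans _ _ (\sum_(S : {set 'I_r} | io \in S) `|fhat R f S| * (1 + s) ^+ r)).
  apply: ler_sum => S Sio; rewrite normrM ler_wpM2l// normr_prod.
  apply: (@le_trans _ _ (\prod_(k in (S :\ io)%SET) (1 + s))).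
    apply: ler_prod => k; rewrite finset.in_setD1 => /andP[kio _]; rewrite normr_ge0/=.
    by rewrite /s (bigD1 k)//= addrCA lerDl addr_ge0// sumr_ge0.
  rewrite prodr_const ler_weXn2l//; first by rewrite lerDl.
  by rewrite -[leqRHS]card_ord; exact: max_card.
rewrite -mulr_suml ler_wpM2r ?exprn_ge0 ?addr_ge0//.
by rewrite /fnorm [leRHS](bigID (fun S : {set 'I_r} => io \in S))/= lerDl sumr_ge0.
Qed.

Lemma sum_exp_le (I : Type) (s : seq I) (p : pred I) (a : I -> R) n : (forall i, 0 <= a i) ->
  (1 + \sum_(i <- s | p i) a i) ^+ n <= (2 ^+ n) ^+ size s * (1 + \sum_(i <- s | p i) a i ^+ n).
Proof.
move=> a0; elim: s => [|i s ih]; first by rewrite !big_nil !addr0 expr1n expr0 mulr1.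
rewrite !big_cons /=; set S := \sum_(j <- s | p j) a j in ih *.
set T := \sum_(j <- s | p j) a j ^+ n in ih *.
have S0 : 0 <= S by apply: sumr_ge0.
have T0 : 0 <= T by apply: sumr_ge0 => j _; rewrite exprn_ge0.
have c1 : 1 <= 2 ^+ n :> R by rewrite exprn_ege1// ler1n.
have cs1 : 1 <= (2 ^+ n) ^+ size s :> R by rewrite exprn_ege1.
case: ifP => _; last first.
  by rewrite exprS; apply: le_trans ih _; rewrite -mulrA ler_peMl// mulr_ge0 ?addr_ge0.
rewrite addrCA; apply: le_trans (exprD_le2 _ (a0 i) (addr_ge0 ler01 S0)) _.
rewrite exprS -mulrA ler_wpM2l ?(le_trans _ c1)//.
rewrite addrCA mulrDr lerD// ler_peMl ?exprn_ge0//.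
Qed.

Lemma exprB_even_le (a b : R) k : (a - b) ^+ k.*2 <= 2 ^+ k.*2 * (a ^+ k.*2 + b ^+ k.*2).
Proof.
have ev (t : R) : t ^+ k.*2 = `|t| ^+ k.*2.
  by rewrite -!mul2n !exprM real_normK ?num_real.
rewrite ev (ev a) (ev b); apply: le_trans (exprD_le2 _ (normr_ge0 a) (normr_ge0 b)).
by rewrite lerXn2r ?nnegrE ?addr_ge0// ler_normB.
Qed.

End PolynomialBounds.

Section ModelMoments.
Context (R : realType) (r : nat) (f : {ffun 'I_r -> bool} -> bool) (delta K : R) (L : nat).
Hypothesis f1 : forall S : {set 'I_r}, #|S| = 1%N -> fhat R f S = 0.
Hypothesis delta0 : 0 < delta.
Hypothesis K0 : 0 < K.
Notation pre_model := (pre_model r delta K L).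
Implicit Type M : pre_model.
Notation E M := (EE (mmu M)).

Let Cx (C : nat -> R) k : R := fnorm R f ^+ k.*2 *
  ((2 ^+ (k * r).*2) ^+ r * (1 + r%:R * C (k * r)%N)).

Let Cx_ge0 C k : (forall k, 0 <= C k) -> 0 <= Cx C k.
Proof.
move=> C0; have := fnorm_ge0 R f.
by move=> ?; rewrite /Cx !mulr_ge0 ?addr_ge0 ?mulr_ge0 ?exprn_ge0.
Qed.

Lemma fderiv_moment M (io : 'I_r) (g : 'I_r -> cfg R (mV M) -> R) (C : nat -> R) k :
  (forall i, i != io -> pg (@Wc R (mV M)) (g i)) ->
  (forall i q, i != io -> E M (fun z => g i z ^+ q.*2) <= C q) -> (forall q, 0 <= C q) ->
  E M (fun z => fderiv f io (fun i => g i z) ^+ k.*2) <= Cx C k.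
Proof.
move=> hp hC C0; have hW := hW delta0 M.
have ev (t : R) q : t ^+ q.*2 = `|t| ^+ q.*2.
  by rewrite -!mul2n !exprM real_normK ?num_real.
pose c : R := (2 ^+ (k * r).*2) ^+ r.
have c0 : 0 <= c by rewrite !exprn_ge0.
have F0 := fnorm_ge0 R f.
have ps : pg (@Wc R (mV M)) (fun z => \sum_(i | i != io) g i z ^+ (k * r).*2).
  by apply: (pg_sum hW) => i iio; apply: pgX; exact: hp.
have ps1 : pg (@Wc R (mV M)) (fun z => 1 + \sum_(i | i != io) g i z ^+ (k * r).*2).
  by apply: (pgD hW) => //; exact: pg_cst.
have ps2 := pgZ (fnorm R f ^+ k.*2 * c) ps1.
apply: le_trans (E_le hW _ ps2 _) _.
- by apply: pgX; exact: (fderiv_pg f delta0).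
- move=> z; rewrite ev; apply: (@le_trans _ _
    ((fnorm R f * (1 + \sum_(i | i != io) `|g i z|) ^+ r) ^+ k.*2)).
    rewrite lerXn2r ?nnegrE ?mulr_ge0 ?exprn_ge0 ?addr_ge0 ?sumr_ge0//.
    exact: fderiv_norm_le.
  rewrite exprMn -exprM -mulrA ler_wpM2l ?exprn_ge0//.
  rewrite (_ : (r * k.*2)%N = (k * r).*2); last by rewrite -!mul2n mulnCA (mulnC r).
  apply: le_trans (sum_exp_le _ _ _ _) _ => //.
  rewrite (_ : size _ = r); last first.
    by rewrite /index_enum; case: index_enum_key; rewrite /= -enumT size_enum_ord.
  rewrite ler_wpM2l//.
  by rewrite lerD2l; apply: ler_sum => i _; rewrite [leRHS]ev.
rewrite (E_Z hW)// -mulrA ler_wpM2l ?exprn_ge0// -/c ler_wpM2l//.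
rewrite (E_D hW) ?E_cst//; last exact: pg_cst.
rewrite lerD2l (E_sum hW); last by move=> i iio; apply: pgX; exact: hp.
apply: (@le_trans _ _ (\sum_(i | i != io) C (k * r)%N)).
  by apply: ler_sum => i iio; exact: hC.
rewrite sumr_const -[leLHS]mulr_natl ler_wpM2r// ler_nat.
by rewrite -[leqRHS]card_ord; exact: max_card.
Qed.

Lemma size_factors M (j : mV M) b : (size (enum (dpart (@mvtx _ _ _ _ _ M) j :\ b)%SET) <= md M)%N.
Proof.
rewrite -cardE; have [_ [h _]] := mreg M; rewrite -(h j).
by apply: subset_leq_card; exact: finset.subsetDl.
Qed.

(** [C] comes before [M]: the bounds hold for all hypergraphs and degrees at once, as the limit
    requires. *)
Definition moment_bound m (C : nat -> R) := (forall k, 0 <= C k) /\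
  forall M j b k, E M (fun z => vf f m j b z ^+ k.*2) <= C k /\
                  E M (fun z => yf f m j b z ^+ k.*2) <= C k.

Lemma yfS_moment m C : (m < L)%N -> moment_bound m C -> exists C', (forall k, 0 <= C' k) /\
  forall M j b k, E M (fun z => yf f m.+1 j b z ^+ k.*2) <= C' k.
Proof.
move=> mL [C0 hC]; exists (fun k => 2 ^+ k.*2 * (C k + (1 + K) ^+ k.*2 * C k)).
have K1 : 0 <= 1 + K by have := K0; lra.
split=> [k|M j b k]; first by rewrite mulr_ge0 ?addr_ge0 ?mulr_ge0 ?exprn_ge0.
have hW := hW delta0 M.
have [p1 p2 p3 ba _] := @node_facts _ _ _ _ _ _ f1 delta0 K0 M m (ltnW mL) j b.
have [hv hy] := hC M j b k.
have py := pgX k.*2 p1; have pv := pgZ ((1 + K) ^+ k.*2) (pgX k.*2 p2).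
apply: (@le_trans _ _ (E M (fun z => 2 ^+ k.*2 * (yf f m j b z ^+ k.*2 + (1 + K) ^+ k.*2 * vf f m j b z ^+ k.*2)))).
  apply: (E_le hW).
  - apply: pgX; rewrite (funext (yfS f m j b)); apply: (pgD hW) => //; exact: pgM.
  - by apply: pgZ; exact: (pgD hW).
  - move=> z; rewrite yfS -[X in _ + X]opprK; apply: le_trans (exprB_even_le _ _ _) _.
    rewrite ler_wpM2l ?exprn_ge0// lerD2l.
    have ev (t : R) : t ^+ k.*2 = `|t| ^+ k.*2 by rewrite -!mul2n !exprM real_normK ?num_real.
    rewrite ev normrN normrM exprMn -(ev (vf _ _ _ _ _)) ler_wpM2r//.
      by rewrite ev exprn_ge0.
    by rewrite lerXn2r ?nnegrE.
rewrite (E_Z hW); last exact: (pgD hW).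
rewrite (E_D hW)// (E_Z hW); last exact: pgX.
by rewrite ler_wpM2l ?exprn_ge0// lerD// ler_wpM2l ?exprn_ge0.
Qed.

Lemma Xf_moment m C : (m < L)%N -> moment_bound m C -> exists C', (forall k, 0 <= C' k) /\
  forall M j b c k, c \in (dpart (@mvtx _ _ _ _ _ M) j :\ b)%SET ->
    E M (fun z => 1 + Xf f m c j z ^+ k.*2) <= C' k.
Proof.
move=> mL hm; have [C1 [C10 hC1]] := yfS_moment mL hm; have [C0 hC] := hm.
exists (fun k => 1 + 2 ^+ k.*2 * (Cx C1 k + Cx C k)); split.
  by move=> k; rewrite addr_ge0// mulr_ge0 ?exprn_ge0// addr_ge0// Cx_ge0.
move=> M j b c k cj; have hW := hW delta0 M.
have := cj; rewrite finset.in_setD1 => /andP[_ /dpartP[io e]].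
have pX := Xf_pg f1 delta0 K0 mL cj.
pose P z := fderiv f io (fun i => yf f m.+1 (mvtx c i) c z).
pose Q z := fderiv f io (fun i => yf f m (mvtx c i) c z).
have pP : pg (@Wc R (mV M)) P.
  apply: (fderiv_pg f delta0) => i _.
  by have [] := @node_facts _ _ _ _ _ _ f1 delta0 K0 M m.+1 mL (mvtx c i) c.
have pQ : pg (@Wc R (mV M)) Q.
  apply: (fderiv_pg f delta0) => i _.
  by have [] := @node_facts _ _ _ _ _ _ f1 delta0 K0 M m (ltnW mL) (mvtx c i) c.
rewrite (E_D hW) ?E_cst; [|exact: pg_cst|exact: pgX].
rewrite lerD2l; have pP2 := pgX k.*2 pP; have pQ2 := pgX k.*2 pQ.
apply: (@le_trans _ _ (E M (fun z => 2 ^+ k.*2 * (P z ^+ k.*2 + Q z ^+ k.*2)))).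
  apply: (E_le hW); [exact: pgX|by apply: pgZ; exact: (pgD hW)|move=> z].
  by rewrite (Xf_io _ _ z e); exact: exprB_even_le.
rewrite (E_Z hW); last exact: (pgD hW).
rewrite (E_D hW)// ler_wpM2l ?exprn_ge0// lerD//.
- apply: (@fderiv_moment M io (fun i => yf f m.+1 (mvtx c i) c)) => // i *.
  by have [] := @node_facts _ _ _ _ _ _ f1 delta0 K0 M m.+1 mL (mvtx c i) c.
- apply: (@fderiv_moment M io (fun i => yf f m (mvtx c i) c)) => // i *.
  + by have [] := @node_facts _ _ _ _ _ _ f1 delta0 K0 M m (ltnW mL) (mvtx c i) c.
  + exact: (proj2 (hC _ _ _ _)).
Qed.

Lemma inv_sqrt_pow (n : nat) k : ((Num.sqrt (n%:R : R))^-1) ^+ k.*2 = (n%:R ^+ k)^-1.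
Proof. by rewrite -mul2n exprM exprVn sqr_sqrtr// exprVn. Qed.

Lemma pred_half M : (md M)%:R <= 2 * (md M).-1%:R :> R.
Proof.
have := md2 M; case: (md M) => [|[|n]] // _ /=.
by rewrite -natrM ler_nat; lia.
Qed.

(** The normalization cancels the growth in [even_moment_indep_sum]. The factor [2 ^+ k] arises
    because [b] need not be incident to [j]: up to [d] factors may then be summed, and
    [d <= 2 (d - 1)]. *)
Lemma node_moments m : (m <= L)%N -> exists C, moment_bound m C.
Proof.
elim: m => [|m ih] mL.
  exists (fun k => 1 + EE (gaussP delta) (fun t => t ^+ k.*2)).
  have g0 k : 0 <= EE (gaussP delta) (fun t => t ^+ k.*2).
    by apply: E_ge0 => t; rewrite -mul2n exprM exprn_ge0// sqr_ge0.
  split=> [k|M j b k]; first by rewrite addr_ge0.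
  split.
    rewrite -(E_coord (hgam delta0) (@mrect _ _ _ _ _ M) j (g := fun t => t ^+ k.*2)) ?lerDr//.
    by apply: pgX; exact: pg_id.
  rewrite /yf (E_cst (mmu M)); apply: le_trans (_ : 1 <= _); last by rewrite lerDl.
  by rewrite expr0n; case: (_ == _).
have [C hm] := ih (ltnW mL); have [C1 [C10 hC1]] := yfS_moment mL hm.
have [C2 [C20 hC2]] := Xf_moment mL hm.
exists (fun k => C1 k + 2 ^+ k * momC k C2); split.
  by move=> k; rewrite addr_ge0// mulr_ge0 ?exprn_ge0// momC_ge0.
move=> M j b k; split; last first.
  by apply: le_trans (hC1 M j b k) _; rewrite lerDl mulr_ge0 ?exprn_ge0// momC_ge0.
have hW := hW delta0 M.
pose s : R := (Num.sqrt (md M).-1%:R)^-1.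
have iF := factors_indep f1 delta0 K0 j b mL.
have pS : pg (@Wc R (mV M)) (fun z => \sum_(c in (dpart (@mvtx _ _ _ _ _ M) j :\ b)%SET) Xf f m c j z).
  by apply: (pg_sum hW) => c cj; exact: (Xf_pg f1 delta0 K0 mL cj).
have -> : E M (fun z => vf f m.+1 j b z ^+ k.*2) = s ^+ k.*2 *
   E M (fun z => (\sum_(c <- enum (dpart (@mvtx _ _ _ _ _ M) j :\ b)%SET) Xf f m c j z) ^+ k.*2).
  rewrite -(E_Z hW); last by apply: pgX; apply: pg_ext pS => z; rewrite big_enum.
  by apply: E_ext => z; rewrite vfS// exprMn big_enum.
have m0 c : c \in enum (dpart (@mvtx _ _ _ _ _ M) j :\ b)%SET -> E M (Xf f m c j) = 0.
  rewrite mem_enum => cj; have pX := Xf_pg f1 delta0 K0 mL cj.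
  rewrite -(E_CE (hgam delta0) (@mrect _ _ _ _ _ M) (~: leaf (@mvtx _ _ _ _ _ M) m.+1 j b)%SET pX).
  rewrite -[RHS](E_cst (mmu M)); apply: E_ext => x; apply: (CE_Xf f1 delta0 K0 mL cj) => j' b' x'.
  by apply: CE_vf => //; exact: ltnW.
have h := @even_moment_indep_sum _ _ _ _ (hgam delta0) (@mrect _ _ _ _ _ M) C2 k _ _ _ _ C20 iF m0.
have {}h := h (fun c q => _); apply: le_trans (ler_wpM2l _ (h _)) _.
- by rewrite -mul2n exprM exprn_ge0// sqr_ge0.
- by move=> c q; rewrite mem_enum; exact: hC2.
rewrite inv_sqrt_pow; set D := size _.
have d1 : 0 < (md M).-1%:R :> R by rewrite ltr0n; have := md2 M; lia.
apply: le_trans (_ : 2 ^+ k * momC k C2 <= _); last by rewrite lerDr.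
rewrite mulrCA mulrC ler_wpM2r ?momC_ge0// ler_pdivrMl ?exprn_gt0// -exprMn.
rewrite lerXn2r ?nnegrE ?mulr_ge0//; rewrite mulrC.
by apply: le_trans (pred_half M); rewrite ler_nat; exact: size_factors.
Qed.

End ModelMoments.

(** * Increments of the derivative of xi *)

Section Xi.
Context (R : realType) (r : nat) (f : {ffun 'I_r -> bool} -> bool).

(** Double counting: the factor [#|S|] produced by the derivative becomes a sum over the elements of
    [S]. *)
Lemma xi_derivE (x : R) : (xi_poly R f)^`().[x] =
  \sum_(io < r) \sum_(S : {set 'I_r} | io \in S) fhat R f S ^+ 2 * x ^+ #|S|.-1.
Proof.
rewrite (@horner_coef_wide _ r); last first.
  have h : (size (xi_poly R f) <= r.+1)%N by exact: size_poly.
  by rewrite /deriv; apply: leq_trans (size_poly _ _) _; lia.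
transitivity (\sum_(S : {set 'I_r}) \sum_(i < r | #|S| == i.+1) (fhat R f S ^+ 2 * x ^+ i) *+ i.+1).
  rewrite [RHS](exchange_big_dep predT)//=; apply: eq_bigr => i _.
  rewrite coef_deriv coef_poly ltnS ltn_ord /= mulrnAl mulr_suml sumrMnl.
  by [].
rewrite [RHS](exchange_big_dep predT)//=; apply: eq_bigr => S _.
rewrite sumr_const.
case: (posnP #|S|) => [S0|Sp].
  by rewrite big1 => [|i]; rewrite S0 ?mulr0n.
have hr : (#|S|.-1 < r)%N.
  by rewrite prednK// -[leqRHS]card_ord; exact: max_card.
rewrite (bigD1 (Ordinal hr)) ?prednK//= big1 ?addr0// => i /andP[/eqP e].
by move=> /negP[]; apply/eqP/val_inj; rewrite /= e.
Qed.

(** The limiting second moment of [Xf m c j] when [j] is the entry [io] of [c]; the index-regularity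
    averages it over [io] into [nu]. *)
Definition nuG (delta : R) m (io : 'I_r) : R :=
  \sum_(S : {set 'I_r} | io \in S) fhat R f S ^+ 2 *
    ((m.+1%:R * delta) ^+ #|(S :\ io)%SET| - (m%:R * delta) ^+ #|(S :\ io)%SET|).

Lemma nuE delta m : nu f delta m.+1 = r%:R^-1 * \sum_io nuG delta m io.
Proof.
rewrite /nu mulrC !xi_derivE -sumrB; congr (_ * _); apply: eq_bigr => io _.
rewrite -sumrB; apply: eq_bigr => S Sio; rewrite -mulrBr.
by rewrite (cardsD1 io S) Sio.
Qed.

Lemma nuG_ge0 delta m io : 0 <= delta -> 0 <= nuG delta m io.
Proof.
move=> d0; apply: sumr_ge0 => S _; rewrite mulr_ge0 ?sqr_ge0// subr_ge0.
by rewrite lerXn2r ?nnegrE ?mulr_ge0// ler_wpM2r// ler_nat.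
Qed.

(** A nonzero coefficient at a nonempty set has degree at least 2, and its monomial in the
    derivative of xi is then strictly increasing. Positivity is needed to divide by [nu] in (P2) and
    to have a Gaussian density. *)
Lemma nu_gt0_or_const (delta : R) : 0 < delta -> (forall S : {set 'I_r}, #|S| = 1%N -> fhat R f S = 0) ->
  (forall S : {set 'I_r}, S != finset.set0 -> fhat R f S = 0) \/ (forall m, 0 < nu f delta m.+1).
Proof.
move=> d0 f1; case: (pselect (exists S : {set 'I_r}, S != finset.set0 /\ fhat R f S != 0)) => [[S [S0 fS]]|h]; last first.
  left => S S0; apply/eqP; apply: contra_notT h => fS; by exists S.
right => m; have /finset.set0Pn [io Sio] := S0.
have r0 : (0 < r)%N by apply: leq_ltn_trans (ltn_ord io).
rewrite nuE mulr_gt0 ?invr_gt0 ?ltr0n//.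
rewrite (bigD1 io)//= ltr_pwDl//; last by apply: sumr_ge0 => k _; apply: nuG_ge0; exact: ltW.
rewrite /nuG (bigD1 S)//= ltr_pwDl//; last first.
  apply: sumr_ge0 => T _; rewrite mulr_ge0 ?sqr_ge0// subr_ge0.
  by rewrite lerXn2r ?nnegrE ?mulr_ge0 ?(ltW d0)// ler_wpM2r ?(ltW d0)// ler_nat.
rewrite mulr_gt0//; first by rewrite lt_neqAle sqr_ge0 eq_sym sqrf_eq0 fS.
rewrite subr_gt0 ltrXn2r ?nnegrE ?mulr_ge0 ?(ltW d0)//.
  rewrite cards_eq0; apply: contraNneq fS => e; apply/eqP/f1.
  by rewrite (cardsD1 io S) Sio e cards0.
by rewrite ltr_pM2r// ltr_nat.
Qed.

Lemma prod_close (I : Type) (s : seq I) (p : pred I) (e : I -> R) (t eps : R) :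
  0 <= t -> 0 <= eps -> (forall i, p i -> `|e i - t| <= eps) ->
  `|\prod_(i <- s | p i) e i - t ^+ count p s| <= (count p s)%:R * eps * (1 + t + eps) ^+ count p s.
Proof.
move=> t0 eps0 he; elim: s => [|i s ih]; first by rewrite big_nil subrr normr0 !mul0r.
rewrite big_cons /=; case: ifP => pi; last by rewrite add0n.
rewrite add1n; set n := count p s in ih *; set P := \prod_(j <- s | p j) e j in ih *.
set B := 1 + t + eps in ih *.
have B1 : 1 <= B by rewrite /B -addrA lerDl addr_ge0.
have B0 : 0 <= B by apply: le_trans B1.
have tB : t ^+ n <= B ^+ n by rewrite lerXn2r ?nnegrE// /B; lra.
have Bn0 : 0 <= B ^+ n by rewrite exprn_ge0.
have ei : `|e i| <= t + eps.
  by have := ler_normD (e i - t) t; rewrite subrK (ger0_norm t0); have := he i pi; lra.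
have -> : e i * P - t ^+ n.+1 = e i * (P - t ^+ n) + (e i - t) * t ^+ n by rewrite exprS; ring.
apply: le_trans (ler_normD _ _) _; rewrite !normrM (ger0_norm (exprn_ge0 n t0)).
apply: (@le_trans _ _ ((t + eps) * (n%:R * eps * B ^+ n) + eps * B ^+ n)).
  apply: lerD; first by rewrite ler_pM.
  by rewrite ler_pM ?exprn_ge0//; exact: he.
rewrite -natr1 exprS; have n0 : 0 <= n%:R * eps * B ^+ n by rewrite !mulr_ge0.
have e0 : 0 <= eps * B ^+ n by rewrite mulr_ge0.
rewrite [leRHS](_ : _ = B * (n%:R * eps * B ^+ n) + B * (eps * B ^+ n)); last by ring.
apply: lerD; first by rewrite ler_wpM2r// /B -addrA lerDr.
by rewrite ler_peMl.
Qed.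

End Xi.

Section SquareOfDerivative.
Context (R : realType) (r : nat) (f : {ffun 'I_r -> bool} -> bool) (V : finType).
Variables (gam : probability R R) (mu : probability (cfg R V) R).
Hypothesis hgam : admissible_weight gam (fun t => 1 + t ^+ 2).
Hypothesis mu_rect : forall A : V -> set R, (forall j, measurable (A j)) ->
  mu (rect A) = (\prod_j gam (A j))%E.
Notation E := (EE mu).
Notation pg := (pg (@Wc R V)).
Let hW := cfg_weight hgam mu_rect.

(** Parseval's identity with general variances. In a cross term, an index of the symmetric
    difference of [S] and [S'] occurs exactly once, and its mean is 0. *)
Lemma E_fderiv_sqr (io : 'I_r) (g : 'I_r -> cfg R V -> R) D :
  (forall k, k != io -> [/\ pg (g k), depends (D k) (g k) & E (g k) = 0]) ->
  (forall k k', k != io -> k' != io -> k != k' -> [disjoint D k & D k']%B) ->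
  E (fun z => fderiv f io (fun k => g k z) ^+ 2) =
  \sum_(S : {set 'I_r} | io \in S) fhat R f S ^+ 2 *
     \prod_(k in (S :\ io)%SET) E (fun z => g k z ^+ 2).
Proof.
move=> hg hD.
pose P (S : {set 'I_r}) z := \prod_(k in (S :\ io)%SET) g k z.
have pP S : pg (P S).
  by apply: pg_prod => k; rewrite finset.in_setD1 => /andP[kio _]; have [] := hg k kio.
have EPP (S S' : {set 'I_r}) : E (fun z => P S z * P S' z) =
    \prod_(k <- enum (~: [set io])%SET) E (fun z => g k z ^+ ((k \in S) + (k \in S'))).
  rewrite -(E_prod_indep hgam mu_rect (D := D)).
  - apply: E_ext => z; rewrite big_enum/= /P.
    rewrite [in LHS]big_mkcond [X in _ * X]big_mkcond -big_split [RHS]big_mkcond/=.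
    apply: eq_bigr => k _; rewrite !finset.in_setD1 finset.in_setC finset.in_set1.
    by case: eqP => _ /=; case: (k \in S); case: (k \in S'); rewrite ?mulr1 ?mul1r.
  - exact: enum_uniq.
  - by move=> k; rewrite mem_enum finset.in_setC finset.in_set1 => /hg[pk _ _]; exact: pgX.
  - move=> k; rewrite mem_enum finset.in_setC finset.in_set1 => /hg[_ dk _].
    by move=> x y xy; rewrite (dk x y xy).
  - by move=> k k'; rewrite !mem_enum !finset.in_setC !finset.in_set1 => *; exact: hD.
transitivity (E (fun z => \sum_(S : {set 'I_r} | io \in S) \sum_(S' : {set 'I_r} | io \in S')
   fhat R f S * fhat R f S' * (P S z * P S' z))).
  apply: E_ext => z; rewrite expr2 {1}/fderiv mulr_suml; apply: eq_bigr => S _.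
  rewrite /fderiv mulr_sumr; apply: eq_bigr => S' _; rewrite /P; ring.
rewrite (E_sum hW); last by move=> S _; apply: (pg_sum hW) => S' _; apply: pgZ; exact: pgM.
apply: eq_bigr => S Sio.
rewrite (E_sum hW); last by move=> S' _; apply: pgZ; exact: pgM.
rewrite (bigD1 S)//= big1 ?addr0; last first.
  move=> S' /andP[S'io SS']; rewrite (E_Z hW); last exact: pgM.
  have [k] : exists k, (k \in S) != (k \in S').
    apply/existsP; move: SS'; apply: contraNT; rewrite negb_exists => /forallP h.
    by apply/eqP/setP => k; apply/eqP; rewrite eq_sym -[_ == _]negbK h.
  move=> kSS'; have kio : k != io by apply: contraNneq kSS' => ->; rewrite Sio S'io.
  rewrite EPP (bigD1_seq k)/= ?enum_uniq//; last by rewrite mem_enum finset.in_setC finset.in_set1.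
  rewrite [X in _ * (X * _)](_ : _ = 0) ?mul0r ?mulr0//.
  have [_ _ <-] := hg k kio; apply: E_ext => z.
  by move: kSS'; case: (k \in S); case: (k \in S').
rewrite (E_Z hW); last exact: pgM.
rewrite -expr2; congr (_ * _); rewrite EPP big_enum/=.
rewrite big_mkcond [RHS]big_mkcond/=; apply: eq_bigr => k _.
rewrite finset.in_setC !finset.in_setD1 finset.in_set1; case: eqP => _ //=.
by case: (k \in S) => //=; under E_ext do rewrite expr0; rewrite E_cst.
Qed.

End SquareOfDerivative.

(** * Concentration of the conditional variance *)

Section ConditionalVariance.
Context (R : realType) (r : nat) (f : {ffun 'I_r -> bool} -> bool) (delta K : R) (L : nat).
Hypothesis f1 : forall S : {set 'I_r}, #|S| = 1%N -> fhat R f S = 0.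
Hypothesis delta0 : 0 < delta.
Hypothesis K0 : 0 < K.
Notation pre_model := (pre_model r delta K L).
Implicit Type M : pre_model.
Notation E M := (EE (mmu M)).
Notation vtx M := (@mvtx _ _ _ _ _ M).
Notation pg M := (pg (@Wc R (mV M))).
Notation edges M j b := (dpart (vtx M) j :\ b)%SET.

Let hg := hgam delta0.
Let hr M := @mrect _ _ _ _ _ M.
Let nf M := @node_facts _ _ _ _ _ _ f1 delta0 K0 M.

Definition P2_holds M := forall m, (m < L)%N -> forall j b, b \in dpart (vtx M) j ->
  E M (fun z => af f m.+1 j b z ^+ 2) = delta / nu f delta m.+1.

(* The conditional variance of [u^(m+1)_{j->b}]. *)
Definition Vf M m j b : cfg R (mV M) -> R :=
  CE (mmu M) (~: leaf (vtx M) m.+1 j b)%SET (fun z => vf f m.+1 j b z ^+ 2).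

Definition rate M : R := (Num.sqrt (md M)%:R)^-1.

Let d0 M : 0 < (md M)%:R :> R.
Proof. by rewrite ltr0n; apply: leq_trans (md2 M). Qed.

Let d1 M : 0 < (md M).-1%:R :> R.
Proof. by rewrite ltr0n; have := md2 M; lia. Qed.

Lemma rate_gt0 M : 0 < rate M. Proof. by rewrite invr_gt0 sqrtr_gt0. Qed.

Lemma rate_sqr M : rate M ^+ 2 = (md M)%:R^-1.
Proof. by rewrite /rate exprVn sqr_sqrtr// ltW. Qed.

Lemma rate_le1 M : rate M <= 1.
Proof.
rewrite invf_le1 ?sqrtr_gt0// -[leLHS]sqrtr1 ler_sqrt// ler1n.
by apply: leq_trans (md2 M).
Qed.

Lemma inv_pred_le M : ((md M).-1%:R)^-1 <= 2 * rate M ^+ 2.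
Proof.
rewrite rate_sqr -[leLHS]mul1r ler_pdivrMr// mulrAC -[leLHS](mulfV (lt0r_neq0 (d0 M))).
by rewrite ler_wpM2r ?invr_ge0// pred_half.
Qed.

Lemma rate_sqr_le M : rate M ^+ 2 <= rate M.
Proof. by rewrite expr2 ler_piMr ?rate_le1// ltW// rate_gt0. Qed.

Lemma CE_Xf0 M m (j : mV M) b c x : (m < L)%N -> c \in edges M j b ->
  CE (mmu M) (~: leaf (vtx M) m.+1 j b)%SET (Xf f m c j) x = 0.
Proof.
move=> mL cj; apply: (CE_Xf f1 delta0 K0 mL cj) => j' b' x'.
by apply: (CE_vf f1 delta0 K0); exact: ltnW.
Qed.

Lemma VfE M m (j : mV M) b x : (m < L)%N -> Vf m j b x = ((md M).-1%:R)^-1 *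
  \sum_(c in edges M j b) CE (mmu M) (~: leaf (vtx M) m.+1 j b)%SET (fun z => Xf f m c j z ^+ 2) x.
Proof.
move=> mL; set B := (~: _)%SET.
have iF := indep_family_mix B x (factors_indep f1 delta0 K0 j b mL).
have c0 c : c \in enum (edges M j b) -> E M (fun y => Xf f m c j (mix B x y)) = 0.
  by rewrite mem_enum => cj; exact: (CE_Xf0 x mL cj).
have h := E_sqr_indep_sum hg (@hr M) iF c0; rewrite big_enum/= in h.
rewrite -h; have [us hp _ _] := iF.
have pS : pg M (fun y => \sum_(c <- enum (edges M j b)) Xf f m c j (mix B x y)).
  apply: (pg_ext (g := fun y => \sum_(c <- enum (edges M j b) | c \in enum (edges M j b)) Xf f m c j (mix B x y))).
    by move=> y; rewrite -big_seq.
  exact: (pg_sum (hW delta0 M)).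
rewrite -(E_Z (hW delta0 M)); last exact: pgX.
rewrite /Vf /CE; apply: E_ext => y; rewrite vfS// big_enum exprMn/=; congr (_ * _).
by rewrite exprVn sqr_sqrtr.
Qed.

Lemma card_edges M (j : mV M) b : b \in dpart (vtx M) j -> #|edges M j b| = (md M).-1.
Proof. by move=> bj; have [_ [h _]] := mreg M; rewrite -(h j) [in RHS](cardsD1 b) bj. Qed.

Let XfM M m j b c (mL : (m < L)%N) (cj : c \in edges M j b) : pg M (Xf f m c j) :=
  Xf_pg f1 delta0 K0 mL cj.

Lemma pg_Vf M m (j : mV M) b : (m < L)%N -> pg M (Vf m j b).
Proof.
by move=> mL; apply: (pg_CE hg (@hr M)); apply: pgX; have [] := nf mL j b.
Qed.

(** [Vf] is an average of [d - 1] terms, one per factor, that read disjoint subtrees and are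
    therefore independent. By Jensen a fourth moment of [Xf] bounds the variance of each. *)
Lemma Vf_var m : (m < L)%N -> exists2 C, 0 <= C & forall M (j : mV M) b, b \in dpart (vtx M) j ->
  E M (fun x => (Vf m j b x - E M (Vf m j b)) ^+ 2) <= C * rate M ^+ 2.
Proof.
move=> mL; have [C hm] := node_moments f1 delta0 K0 (ltnW mL).
have [C2 [C20 hC2]] := Xf_moment f1 delta0 K0 mL hm.
exists (2 * C2 2%N); first by rewrite mulr_ge0.
move=> M j b bj; have hW := hW delta0 M; set B := (~: leaf (vtx M) m.+1 j b)%SET.
pose q c := CE (mmu M) B (fun z => Xf f m c j z ^+ 2).
pose Y c x := q c x - E M (q c).
have pq c : c \in edges M j b -> pg M (q c).
  by move=> cj; apply: (pg_CE hg (@hr M)); apply: pgX; exact: XfM cj.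
have pY c : c \in edges M j b -> pg M (Y c).
  by move=> cj; apply: (pgB hW); [exact: pq|exact: pg_cst].
have iF : indep_family (enum (edges M j b)) (Dc m j) Y.
  have [us hp hd hD] := factors_indep f1 delta0 K0 j b mL.
  split => // c cj; first by apply: pY; rewrite mem_enum in cj.
  have dX := hd c cj; apply: (depends1 (fun a => a - E M (q c))).
  apply: (dependsW (D := (Dc m j c :&: B)%SET)); first exact: finset.subsetIl.
  by apply: CE_depends => x y xy; rewrite (dX x y xy).
have EY c : c \in enum (edges M j b) -> E M (Y c) = 0.
  rewrite mem_enum => cj; rewrite /Y (E_B hW) ?E_cst ?subrr//; [exact: pq|exact: pg_cst].
have hY c : c \in edges M j b -> E M (fun x => Y c x ^+ 2) <= C2 2%N.
  move=> cj; have p := pq c cj; have p2 := pgX 2 p; have pX := XfM mL cj.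
  have -> : E M (fun x => Y c x ^+ 2) = E M (fun x => q c x ^+ 2) - E M (q c) ^+ 2.
    have p1 := pgZ (2 * E M (q c)) p.
    transitivity (E M (fun x => q c x ^+ 2 - (2 * E M (q c) * q c x - E M (q c) ^+ 2))).
      by apply: E_ext => x; rewrite /Y; ring.
    have pc : pg M (fun=> E M (q c) ^+ 2) by exact: pg_cst.
    have pd := pgB hW p1 pc.
    by rewrite (E_B hW p2 pd) (E_B hW p1 pc) (E_Z hW)// E_cst; ring.
  apply: (@le_trans _ _ (E M (fun x => q c x ^+ 2))); first by rewrite gerBl sqr_ge0.
  have pX4 : pg M (fun z => (Xf f m c j z ^+ 2) ^+ 2) by apply: pgX; exact: pgX.
  apply: (@le_trans _ _ (E M (CE (mmu M) B (fun z => (Xf f m c j z ^+ 2) ^+ 2)))).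
    apply: (E_le hW) => //; first exact: (pg_CE hg (@hr M)).
    by move=> x; apply: (CE_sqr_le hg (@hr M)); exact: pgX.
  rewrite (E_CE hg (@hr M))//; apply: le_trans (hC2 M j b c 2%N cj).
  apply: (E_le hW) => //; first by apply: (pgD hW); [exact: pg_cst|exact: pgX].
  by move=> z; rewrite -exprM lerDr.
have h := E_sqr_indep_sum hg (@hr M) iF EY.
pose D := (md M).-1%:R : R.
have -> : E M (fun x => (Vf m j b x - E M (Vf m j b)) ^+ 2) =
    E M (fun x => D^-1 ^+ 2 * (\sum_(c <- enum (edges M j b)) Y c x) ^+ 2).
  have eV : E M (Vf m j b) = D^-1 * \sum_(c in edges M j b) E M (q c).
    rewrite -(E_sum hW) -?(E_Z hW)//; last exact: (pg_sum hW).
    by apply: E_ext => x; rewrite VfE.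
  by apply: E_ext => x; rewrite eV VfE// big_enum/= sumrB -exprMn mulrBr.
rewrite (E_Z hW); last first.
  by apply: pgX; apply: (pg_ext (g := fun x => \sum_(c in edges M j b) Y c x));
    [move=> x; rewrite big_enum|apply: (pg_sum hW)].
rewrite h big_enum/=; apply: (@le_trans _ _ (D^-1 ^+ 2 * (D * C2 2%N))).
  rewrite ler_wpM2l ?sqr_ge0//; apply: le_trans (ler_sum _ hY) _.
  by rewrite sumr_const card_edges// mulr_natl.
rewrite expr2 -mulrA [D^-1 * (D * _)]mulrA mulVf ?gt_eqF ?d1// mul1r [2 * _]mulrC -mulrA mulrC.
by rewrite ler_wpM2l// inv_pred_le.
Qed.

Lemma E_Vf M m (j : mV M) b : (m < L)%N -> E M (Vf m j b) = ((md M).-1%:R)^-1 *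
  \sum_(c in edges M j b) E M (fun z => Xf f m c j z ^+ 2).
Proof.
move=> mL; have hW := hW delta0 M.
have pX c : c \in edges M j b -> pg M (fun z => Xf f m c j z ^+ 2).
  by move=> cj; apply: pgX; exact: XfM cj.
rewrite (E_ext (mmu M) (fun x => VfE j b x mL)) (E_Z hW); last first.
  by apply: (pg_sum hW) => c cj; apply: (pg_CE hg (@hr M)); exact: pX.
rewrite (E_sum hW); last by move=> c cj; apply: (pg_CE hg (@hr M)); exact: pX.
by congr (_ * _); apply: eq_bigr => c cj; rewrite (E_CE hg (@hr M))//; exact: pX.
Qed.

(* Every coordinate is used by exactly [d/r] of the factors of [j]. *)
Lemma index_average M (j : mV M) b (G : 'I_r -> R) (cG : R) : (0 < r)%N ->
  b \in dpart (vtx M) j -> (forall io, `|G io| <= cG) ->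
  `|((md M).-1%:R)^-1 * (\sum_(c in edges M j b) \sum_(io | vtx M c io == j) G io) -
    r%:R^-1 * \sum_io G io| <= 2 * cG * ((md M).-1%:R)^-1.
Proof.
move=> r0 bj hG; have [inj [_ reg]] := mreg M.
have r0' : 0 < r%:R :> R by rewrite ltr0n.
have [iob eb] := dpartP _ _ bj.
have one c io : vtx M c io = j -> \sum_(k | vtx M c k == j) G k = G io.
  move=> e; rewrite (bigD1 io) ?e//= big1 ?addr0// => k /andP[/eqP ek].
  by rewrite (inj c k io) ?eqxx// ek e.
have tot : \sum_(c in dpart (vtx M) j) \sum_(io | vtx M c io == j) G io =
    (md M)%:R * (r%:R^-1 * \sum_io G io).
  rewrite (exchange_big_dep predT)//= !mulr_sumr; apply: eq_bigr => io _.
  rewrite (eq_bigl (fun c => c \in [set a | vtx M a io == j]%SET)); last first.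
    move=> c; rewrite !inE; case: eqP => [e|]; last by rewrite andbF.
    by rewrite andbT; apply/existsP; exists io; rewrite e.
  rewrite sumr_const -[LHS]mulr_natl mulrA; congr (_ * _).
  rewrite -(reg j io) natrM mulfK ?gt_eqF//; congr (_%:R); apply: eq_card => c.
  by rewrite inE; apply/idP/idP => [h|/set_mem]; [exact: mem_set|].
have := tot; rewrite (bigD1 b)//= (one b iob eb).
rewrite (eq_bigl (fun c => c \in edges M j b)); last first.
  by move=> c; rewrite finset.in_setD1 andbC.
set T := \sum_(c in _) _; set A := r%:R^-1 * _ => e.
have eD : (md M)%:R = (md M).-1%:R + 1 :> R.
  by rewrite natr1 prednK//; apply: leq_trans (md2 M).
have cG0 : 0 <= cG by apply: le_trans (hG iob).
have hA : `|A| <= cG.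
  rewrite /A normrM gtr0_norm ?invr_gt0// ler_pdivrMl//.
  apply: le_trans (ler_norm_sum _ _ _) _; apply: le_trans (ler_sum _ (fun io _ => hG io)) _.
  by rewrite sumr_const card_ord mulr_natl.
have D0 := d1 M; rewrite (_ : _ * T - A = ((md M).-1%:R)^-1 * (A - G iob)); last first.
  have -> : T = (md M)%:R * A - G iob by rewrite -e; ring.
  by rewrite eD; field; rewrite gt_eqF.
rewrite normrM gtr0_norm ?invr_gt0// mulrC ler_wpM2r ?invr_ge0 ?(ltW D0)//.
by apply: le_trans (ler_normB _ _) _; have := hG iob; lra.
Qed.

(** This and [Hv] are proved alternately: second moments of [yf] at two consecutive steps determine
    the variance of the next message, which with (P2) determines the next second moment. *)
Definition Hy m := exists2 C, 0 <= C & forall M, P2_holds M -> forall j b, b \in dpart (vtx M) j ->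
  `|E M (fun z => yf f m j b z ^+ 2) - m%:R * delta| <= C * rate M.

Definition Hv m := exists2 C, 0 <= C & forall M, P2_holds M -> forall j b, b \in dpart (vtx M) j ->
  E M (fun x => (Vf m j b x - nu f delta m.+1) ^+ 2) <= C * rate M ^+ 2.

Let self_edge M (c : mE M) k : c \in dpart (vtx M) (vtx M c k).
Proof. by apply/dpartP; exists k. Qed.

(** The bounds on [n] say that it is [m] or [m.+1], the two terms of [E_Xf_sqr]. Since [rate] is at
    most 1, [B] bounds all factors of the product uniformly. *)
Lemma E_deriv_close n m C : (m < L)%N -> (n <= m.+1)%N -> (m <= n)%N -> 0 <= C ->
  exists2 C', 0 <= C' & forall M (j : mV M) b c io, c \in edges M j b -> vtx M c io = j ->
  (forall k, `|E M (fun z => yf f n (vtx M c k) c z ^+ 2) - n%:R * delta| <= C * rate M) ->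
  `|E M (fun z => fderiv f io (fun k => yf f n (vtx M c k) c z) ^+ 2) -
    \sum_(S : {set 'I_r} | io \in S) fhat R f S ^+ 2 * (n%:R * delta) ^+ #|(S :\ io)%SET| | <= C' * rate M.
Proof.
move=> mL nm mn C0.
pose B := 1 + n%:R * delta + C; pose F := \sum_(S : {set 'I_r}) fhat R f S ^+ 2.
have nd0 : 0 <= n%:R * delta by rewrite mulr_ge0// ltW.
have B1 : 1 <= B by rewrite /B -addrA lerDl addr_ge0.
have F0 : 0 <= F by apply: sumr_ge0 => S _; exact: sqr_ge0.
exists (F * (r%:R * C * B ^+ r)).
  by rewrite !mulr_ge0// exprn_ge0// (le_trans _ B1).
move=> M j b c io cj e hk.
have rt := ltW (rate_gt0 M); have rt1 := rate_le1 M.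
have nj k : k != io -> vtx M c k != j.
  by apply: contraNneq => h; apply/eqP/(@vtx_inj _ _ _ _ _ M c); rewrite h.
have nL : (n <= L)%N by apply: leq_trans nm mL.
rewrite (E_fderiv_sqr f hg (@hr M) (D := fun k => tree (vtx M) m.+1 (vtx M c k) c)); last 2 first.
- move=> k kio; have [p _ _ _ [dy _ _]] := nf nL (vtx M c k) c; split => //.
    apply: dependsW dy; have [->|] := eqVneq n m.+1; first exact: fintype.subxx.
    by move=> /eqP nm1; rewrite (_ : n = m); [rewrite treeS finset.subsetUl|lia].
  exact: (E_yf f1 delta0 K0).
- by move=> k k' kio kio' kk'; apply: (child_disjoint mL cj) => //; exact: nj.
rewrite -sumrB; apply: le_trans (ler_norm_sum _ _ _) _.
rewrite /F !mulr_suml [leRHS](bigID (fun S : {set 'I_r} => io \in S))/=.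
rewrite -[leLHS]addr0; apply: lerD; last first.
  have BB : 0 <= B ^+ r by rewrite exprn_ge0// (le_trans _ B1).
  by apply: sumr_ge0 => S _; rewrite mulr_ge0// mulr_ge0 ?sqr_ge0// mulr_ge0// mulr_ge0.
apply: ler_sum => S Sio; rewrite -mulrBr normrM (ger0_norm (sqr_ge0 _)) -[leRHS]mulrA ler_wpM2l ?sqr_ge0//.
have := @prod_close R _ (index_enum 'I_r) (fun k => k \in (S :\ io)%SET)
  (fun k => E M (fun z => yf f n (vtx M c k) c z ^+ 2)) _ (C * rate M) nd0 (mulr_ge0 C0 rt) (fun k _ => hk k).
have -> : count (fun k => k \in (S :\ io)%SET) (index_enum 'I_r) = #|(S :\ io)%SET|.
  by rewrite -sum1_count sum1_card.
move=> h; apply: le_trans h _; set u := #|_|.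
have ur : (u <= r)%N by rewrite /u -[leqRHS]card_ord; exact: max_card.
have Bu : (1 + n%:R * delta + C * rate M) ^+ u <= B ^+ r.
  apply: (@le_trans _ _ (B ^+ u)); last by rewrite ler_weXn2l.
  have hB : 0 <= 1 + n%:R * delta + C * rate M by rewrite !addr_ge0// mulr_ge0.
  rewrite lerXn2r ?nnegrE//; first by rewrite (le_trans _ B1).
  by rewrite /B lerD2l ler_piMr.
rewrite [leRHS]mulrAC; apply: ler_pM => //.
- by rewrite !mulr_ge0.
- by rewrite exprn_ge0// !addr_ge0// mulr_ge0.
- by rewrite mulrA ler_wpM2r// ler_wpM2r// ler_nat.
Qed.

(** Variance plus squared bias. [Vf_var] bounds the variance; the bias comes from [E_deriv_close]
    for each factor and from [index_average] over the factors. *)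
Lemma Hv_step m : (m < L)%N -> (0 < r)%N -> Hy m -> Hy m.+1 -> Hv m.
Proof.
move=> mL r0 [C0 C00 h0] [C1 C10 h1].
have [D0 D00 e0] := @E_deriv_close m m C0 mL (leqnSn _) (leqnn _) C00.
have [D1 D10 e1] := @E_deriv_close m.+1 m C1 mL (leqnn _) (leqnSn _) C10.
have [Cv Cv0 hv] := Vf_var mL.
pose cG := \sum_io `|nuG f delta m io|.
have cG0 : 0 <= cG by apply: sumr_ge0.
pose Q := D0 + D1 + 4 * cG; have Q0 : 0 <= Q by rewrite !addr_ge0// mulr_ge0.
exists (Cv + Q ^+ 2); first by rewrite addr_ge0// sqr_ge0.
move=> M hP j b bj; have hW := hW delta0 M; have rt := rate_gt0 M.
have pV := pg_Vf j b mL; set EV := E M (Vf m j b).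
have hEV : `|EV - nu f delta m.+1| <= Q * rate M.
  rewrite /EV E_Vf//; set D := ((md M).-1%:R)^-1.
  have D'0 : 0 <= D by rewrite invr_ge0.
  pose T := \sum_(c in edges M j b) \sum_(io | vtx M c io == j) nuG f delta m io.
  have i1 : `|D * T - nu f delta m.+1| <= 2 * cG * D.
    rewrite nuE; apply: index_average => // io.
    by rewrite /cG (bigD1 io)//= lerDl sumr_ge0.
  have i2 : `|D * \sum_(c in edges M j b) E M (fun z => Xf f m c j z ^+ 2) - D * T| <= (D0 + D1) * rate M.
    rewrite -mulrBr normrM (ger0_norm D'0) ler_pdivrMl ?d1// -sumrB.
    apply: le_trans (ler_norm_sum _ _ _) _.
    apply: (@le_trans _ _ (\sum_(c in edges M j b) (D0 + D1) * rate M)); last first.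
      by rewrite sumr_const card_edges// mulr_natl.
    apply: ler_sum => c cj; have := cj; rewrite finset.in_setD1 => /andP[_ /dpartP[io e]].
    have -> : \sum_(k | vtx M c k == j) nuG f delta m k = nuG f delta m io.
      rewrite (bigD1 io) ?e//= big1 ?addr0// => k /andP[/eqP ek].
      by rewrite (@vtx_inj _ _ _ _ _ M c k io) ?eqxx// ek e.
    rewrite (E_Xf_sqr f1 delta0 K0 mL cj _ e); last first.
      by move=> j' b' x'; apply: (CE_vf f1 delta0 K0); exact: ltnW.
    have a0 := e0 M j b c io cj e (fun k => h0 M hP _ _ (self_edge c k)).
    have a1 := e1 M j b c io cj e (fun k => h1 M hP _ _ (self_edge c k)).
    rewrite /nuG (eq_bigr _ (fun S _ => mulrBr _ _ _)) sumrB.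
    move: a0 a1; set x0 := E M _; set x1 := E M _; set y0 := \sum_(S | _) _; set y1 := \sum_(S | _) _.
    move=> a0 a1; rewrite (_ : x1 - x0 - _ = (x1 - y1) - (x0 - y0)); last by ring.
    by apply: le_trans (ler_normB _ _) _; rewrite mulrDl addrC lerD.
  apply: le_trans (ler_distD (D * T) _ _) _; rewrite /Q mulrDl lerD//.
  apply: le_trans i1 _; have := inv_pred_le M; rewrite -/D; have := rate_sqr_le M.
  move=> a b'; have : D <= 2 * rate M by lra.
  by move=> /(ler_wpM2l cG0); lra.
have pc : pg M (fun=> EV) by exact: pg_cst.
have p1 : pg M (fun x => Vf m j b x - EV) by exact: (pgB hW).
have p2 := pgX 2 p1; have p3 := pgZ (2 * (EV - nu f delta m.+1)) p1.
have pc2 : pg M (fun=> (EV - nu f delta m.+1) ^+ 2) by exact: pg_cst.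
have p23 := pgD hW p3 pc2.
rewrite (E_ext (mmu M) (h := fun x => (Vf m j b x - EV) ^+ 2 +
  (2 * (EV - nu f delta m.+1) * (Vf m j b x - EV) + (EV - nu f delta m.+1) ^+ 2))); last first.
  by move=> x; ring.
rewrite (E_D hW p2 p23) (E_D hW p3 pc2) (E_Z hW)// (E_B hW pV pc) !E_cst subrr mulr0 add0r.
rewrite mulrDl; apply: lerD; first exact: hv.
rewrite -exprMn -real_normK ?num_real// lerXn2r ?nnegrE//.
by rewrite mulr_ge0 ?(ltW rt).
Qed.

Hypothesis nu0 : forall m, 0 < nu f delta m.+1.

(** In the increment, conditioning off the leaves replaces the squared message by [Vf], hence nearly
    by [nu], and (P2) makes the second moment of [af] times [nu] equal to [delta]. For [m = 0] the
    increment is the variance of [z^0], exactly. *)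
Lemma Hy_step m : (m < L)%N -> Hy m -> (forall m', m = m'.+1 -> Hv m') -> Hy m.+1.
Proof.
move=> mL [C C0 hC] hV; have mL' := ltnW mL.
have [C1 C10 hC1] : exists2 C1, 0 <= C1 & forall M, P2_holds M -> forall j b, b \in dpart (vtx M) j ->
    `|E M (fun z => af f m j b z ^+ 2 * vf f m j b z ^+ 2) - delta| <= C1 * rate M.
  case: m mL {hC} mL' hV => [|m] mL mL' hV.
    exists 0 => // M hP j b bj; rewrite mul0r normr_le0 subr_eq0 -[X in _ == X](E_gaussP_sqr delta0).
    rewrite -(E_coord hg (@hr M) j (pgX 2 (pg_id R))); apply/eqP/E_ext => z /=.
    by rewrite expr1n mul1r.
  have [C1 C10 h1] := hV m erefl.
  exists ((1 + K) ^+ 2 * ((1 + C1) / 2)).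
    by rewrite mulr_ge0 ?sqr_ge0// divr_ge0// addr_ge0.
  move=> M hP j b bj; have hW := hW delta0 M; have rt := rate_gt0 M.
  have [_ pv pa ba [_ _ da]] := nf mL' j b.
  set nu1 := nu f delta m.+1.
  have pa2 := pgX 2 pa; have pV := pg_Vf j b mL'; have pv2 := pgX 2 pv.
  have pc : pg M (fun=> nu1) by exact: pg_cst.
  have pVn := pgB hW pV pc.
  have -> : E M (fun z => af f m.+1 j b z ^+ 2 * vf f m.+1 j b z ^+ 2) - delta =
      E M (fun z => af f m.+1 j b z ^+ 2 * (Vf m j b z - nu1)).
    have -> : E M (fun z => af f m.+1 j b z ^+ 2 * vf f m.+1 j b z ^+ 2) =
        E M (fun z => af f m.+1 j b z ^+ 2 * Vf m j b z).
      rewrite -(E_CE hg (@hr M) (~: leaf (vtx M) m.+1 j b)%SET (pgM pa2 pv2)); apply: E_ext => x.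
      rewrite (CE_mull hg (@hr M) _ pv2)//.
      apply: dependsW (tree_nleaf j b (ltnW mL)) _ => z z' zz'; by rewrite (da z z' zz').
    rewrite [X in _ - X](_ : _ = E M (fun z => af f m.+1 j b z ^+ 2 * nu1)); last first.
      by rewrite (E_Zr hW)// hP// mulfVK// gt_eqF.
    rewrite -(E_B hW); [|exact: pgM|exact: pgZr].
    by apply: E_ext => z; ring.
  apply: le_trans (E_norm hW (pgM pa2 pVn)) _.
  apply: (@le_trans _ _ (E M (fun z => (1 + K) ^+ 2 * `|Vf m j b z - nu1|))).
    apply: (E_le hW); [by apply: pg_norm; exact: pgM|by apply: pgZ; exact: pg_norm|move=> z].
    rewrite normrM ler_wpM2r// normrX lerXn2r ?nnegrE//.
    by rewrite addr_ge0// ltW.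
  rewrite (E_Z hW); last exact: pg_norm.
  rewrite -[leRHS]mulrA ler_wpM2l ?sqr_ge0//.
  apply: le_trans (E_norm_le hW pVn rt) _.
  rewrite mulrAC ler_wpM2r// mulrDl mul1r lerD2l ler_pdivrMr// -mulrA -expr2.
  exact: h1.
exists (C + C1); first exact: addr_ge0.
move=> M hP j b bj; rewrite (E_yfS_sqr f1 delta0 K0 j b mL).
rewrite -natr1 mulrDl mul1r mulrDl opprD addrACA.
by apply: le_trans (ler_normD _ _) _; rewrite lerD ?hC ?hC1.
Qed.

Lemma Hy_Hv m : (0 < r)%N -> (m <= L)%N -> Hy m /\ (forall m', m = m'.+1 -> Hv m').
Proof.
move=> r0; elim: m => [|m ih] mL.
  split=> //; exists 0 => // M _ j b _.
  by rewrite mul0r subr0 mul0r /= expr0n/= E_cst normr0.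
have [h1 h2] := ih (ltnW mL); have h3 := Hy_step mL h1 h2.
by split=> // m' [<-]; exact: Hv_step.
Qed.

Lemma Vf_converges m : (0 < r)%N -> (m < L)%N -> Hv m.
Proof. by move=> r0 mL; have [_ h] := Hy_Hv r0 mL; exact: h. Qed.

End ConditionalVariance.

(** * The conditional central limit theorem *)

Section CentralLimit.
Context (R : realType) (r : nat) (f : {ffun 'I_r -> bool} -> bool) (delta K : R) (L : nat).
Hypothesis f1 : forall S : {set 'I_r}, #|S| = 1%N -> fhat R f S = 0.
Hypothesis delta0 : 0 < delta.
Hypothesis K0 : 0 < K.
Hypothesis r0 : (0 < r)%N.
Hypothesis nu0 : forall m, 0 < nu f delta m.+1.
Notation pre_model := (pre_model r delta K L).
Implicit Type M : pre_model.
Notation E M := (EE (mmu M)).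
Notation vtx M := (@mvtx _ _ _ _ _ M).
Notation pgR := (pg (@Wr R)).
Notation pg M := (pg (@Wc R (mV M))).
Notation edges M j b := (dpart (vtx M) j :\ b)%SET.
Notation CEu M m j b phi := (CE (mmu M) (~: leaf (vtx M) m.+1 j b)%SET (fun z => phi (vf f m.+1 j b z))).

Let hg := hgam delta0.
Let hr M := @mrect _ _ _ _ _ M.
Let nf M := @node_facts _ _ _ _ _ _ f1 delta0 K0 M.
Let hW1 := gaussP_weight (@ltr01 R).

(** A class closed under linear combinations: the cells are signed combinations of truncated cubes,
    and Lindeberg's method is run on the truncated cubes only. *)
Definition clt_fun m (phi : R -> R) := pgR phi /\
  exists2 C, 0 <= C & forall M, P2_holds f M -> forall j b, b \in dpart (vtx M) j ->
    E M (fun x => `|CEu M m j b phi x - heat (nu f delta m.+1) phi 0|) <= C * rate M.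

Let pgu M m j b phi : (m < L)%N -> pgR phi -> pg M (fun z => phi (vf f m.+1 j b z)).
Proof.
move=> mL pp; apply: (pg_comp hg (@hr M)) => //.
by have [] := nf mL j b.
Qed.

Lemma clt_fun_lin m a phi psi : (m < L)%N -> clt_fun m phi -> clt_fun m psi ->
  clt_fun m (fun x => a * phi x + psi x).
Proof.
move=> mL [p1 [C1 C10 h1]] [p2 [C2 C20 h2]]; have pa := pgZ a p1.
split; first exact: (pgD hW1).
exists (`|a| * C1 + C2); first by rewrite addr_ge0// mulr_ge0.
move=> M hP j b bj; have hW := hW delta0 M.
have q1 := pgu j b mL p1; have q2 := pgu j b mL p2; have qa := pgZ a q1.
set n := nu f delta m.+1.
have e1 : pg M (fun x => CEu M m j b phi x - heat n phi 0).
  by apply: (pgB hW); [exact: (pg_CE hg (@hr M))|exact: pg_cst].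
have e2 : pg M (fun x => CEu M m j b psi x - heat n psi 0).
  by apply: (pgB hW); [exact: (pg_CE hg (@hr M))|exact: pg_cst].
have n1 := pgZ `|a| (pg_norm e1); have n2 := pg_norm e2.
apply: (@le_trans _ _ (E M (fun x => `|a| * `|CEu M m j b phi x - heat n phi 0| +
   `|CEu M m j b psi x - heat n psi 0|))).
  apply: (E_le hW); [|exact: (pgD hW)|move=> x].
    apply: pg_norm; apply: (pgB hW); last exact: pg_cst.
    by apply: (pg_CE hg (@hr M)); exact: (pgD hW).
  have -> : CEu M m j b (fun x => a * phi x + psi x) x = a * CEu M m j b phi x + CEu M m j b psi x.
    by rewrite (CE_D hg (@hr M))// (CE_Z hg (@hr M)).
  have -> : heat n (fun x => a * phi x + psi x) 0 = a * heat n phi 0 + heat n psi 0.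
    rewrite /heat (E_D hW1) ?(E_Z hW1)//; [exact: ge0_pg_affine| |exact: ge0_pg_affine].
    by apply: pgZ; exact: ge0_pg_affine.
  rewrite (_ : _ - _ = a * (CEu M m j b phi x - heat n phi 0) + (CEu M m j b psi x - heat n psi 0)); last by ring.
  by apply: le_trans (ler_normD _ _) _; rewrite normrM.
rewrite (E_D hW)// (E_Z hW); last exact: pg_norm.
rewrite mulrDl -mulrA; apply: lerD; last exact: h2.
by rewrite ler_wpM2l//; exact: h1.
Qed.

Lemma clt_fun_cst m c : clt_fun m (fun=> c).
Proof.
split; first exact: pg_cst.
exists 0 => // M hP j b bj; rewrite mul0r le_eqVlt; apply/orP; left; apply/eqP.
rewrite -[RHS](E_cst (mmu M)); apply: E_ext => x.
by rewrite /CE /heat !E_cst subrr normr0.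
Qed.

(** Two errors of order [d^(-1/2)]: Lindeberg's, made of [d - 1] third moments of size [d^(-3/2)],
    and the replacement of the random variance [Vf] by [nu], through [heat_close] and
    [Vf_converges]. *)
Lemma clt_test_fun m c G G1 G2 : (m < L)%N -> 0 <= c -> test_fun c G G1 G2 -> clt_fun m G.
Proof.
move=> mL c0 tG; have [[cG G0 pG pG1 pG2] _] := tG; split => //.
have [C hm] := node_moments f1 delta0 K0 (ltnW mL).
have [C2 [C20 hC2]] := Xf_moment f1 delta0 K0 mL hm.
have [Cv Cv0 hv] := Vf_converges f1 delta0 K0 nu0 r0 mL.
set n := nu f delta m.+1; have n0 : 0 <= n by rewrite ltW// nu0.
have k30 : 0 <= K3 R by exact: K3_ge0.
pose Hc := c * (2 + n) + K3 R.
have Hc0 : 0 <= Hc by rewrite addr_ge0// mulr_ge0// addr_ge0.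
exists (2 * ((1 + K3 R) * C2 2%N) + Hc * ((1 + Cv) / 2 + Cv)).
  have a1 : 0 <= 1 + K3 R by rewrite addr_ge0.
  have a2 : 0 <= (1 + Cv) / 2 by rewrite divr_ge0 ?addr_ge0.
  by apply: addr_ge0; [rewrite mulr_ge0// mulr_ge0|rewrite mulr_ge0// addr_ge0].
move=> M hP j b bj; have hW := hW delta0 M; have rt := rate_gt0 M.
have {}hv := hv M hP j b bj.
set B := (~: leaf (vtx M) m.+1 j b)%SET.
pose sg : R := (Num.sqrt (md M).-1%:R)^-1.
have D0 : 0 < (md M).-1%:R :> R by rewrite ltr0n; have := md2 M; lia.
have sg0 : 0 <= sg by rewrite invr_ge0.
have sg2 : sg ^+ 2 = (md M).-1%:R^-1 by rewrite exprVn sqr_sqrtr// ltW.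
have sgr : sg <= 2 * rate M.
  have h : sg ^+ 2 <= (2 * rate M) ^+ 2.
    rewrite sg2 exprMn. apply: le_trans (inv_pred_le delta0 K0 M) _.
    by rewrite ler_wpM2r ?sqr_ge0// expr2 ler_peMr// ler1n.
  by rewrite -(@ler_pXn2r _ 2) ?nnegrE ?mulr_ge0// ltW.
have pX c' : c' \in edges M j b -> pg M (Xf f m c' j).
  by move=> cj; exact: (Xf_pg f1 delta0 K0 mL cj).
have p4 c' : c' \in edges M j b -> pg M (fun z => 1 + Xf f m c' j z ^+ 4).
  by move=> cj; apply: (pgD hW); [exact: pg_cst|apply: pgX; exact: pX].
(* Both parts of Lindeberg's error are brought to even moments by the bound of a cube by
   [1 + t ^+ 4]. *)
pose err x := sg ^+ 3 * ((1 + K3 R) * \sum_(c' in edges M j b) CE (mmu M) B (fun z => 1 + Xf f m c' j z ^+ 4) x).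
have perr : pg M err.
  apply: pgZ; apply: pgZ; apply: (pg_sum hW) => c' cj.
  by apply: (pg_CE hg (@hr M)); exact: p4.
have Eerr : E M err <= 2 * ((1 + K3 R) * C2 2%N) * rate M.
  have ps : pg M (fun x => \sum_(c' in edges M j b) CE (mmu M) B (fun z => 1 + Xf f m c' j z ^+ 4) x).
    by apply: (pg_sum hW) => c' cj; apply: (pg_CE hg (@hr M)); exact: p4.
  rewrite /err (E_Z hW); last exact: pgZ.
  rewrite (E_Z hW)// (E_sum hW); last by move=> c' cj; apply: (pg_CE hg (@hr M)); exact: p4.
  apply: (@le_trans _ _ (sg ^+ 3 * ((1 + K3 R) * ((md M).-1%:R * C2 2%N)))).
    rewrite ler_wpM2l ?exprn_ge0// ler_wpM2l ?addr_ge0//.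
    apply: (@le_trans _ _ (\sum_(c' in edges M j b) C2 2%N)); last first.
      by rewrite sumr_const card_edges// mulr_natl.
    by apply: ler_sum => c' cj; rewrite (E_CE hg (@hr M)); [exact: (hC2 M j b c' 2%N cj)|exact: p4].
  rewrite (_ : sg ^+ 3 * _ = sg * (sg ^+ 2 * (md M).-1%:R) * ((1 + K3 R) * C2 2%N)); last by ring.
  rewrite sg2 mulVf ?gt_eqF// mulr1 [leRHS]mulrAC ler_wpM2r ?mulr_ge0 ?addr_ge0//.
have pV := pg_Vf f1 delta0 K0 j b mL.
have key x : `|CEu M m j b G x - heat n G 0| <=
    err x + Hc * (`|Vf f m j b x - n| + `|Vf f m j b x - n| ^+ 2).
  pose X c' y := sg * Xf f m c' j (mix B x y).
  have iF : indep_family (enum (edges M j b)) (Dc m j) X.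
    have [us hp hd hD] := indep_family_mix B x (factors_indep f1 delta0 K0 j b mL).
    split => // c' cj; first by apply: pgZ; exact: hp.
    by have dX := hd c' cj => y z yz; rewrite /X (dX y z yz).
  have pXm c' : c' \in edges M j b -> pg M (fun y => Xf f m c' j (mix B x y)).
    by move=> cj; apply: pg_mix; exact: pX.
  have m0 c' : c' \in enum (edges M j b) -> E M (X c') = 0.
    rewrite mem_enum => cj; rewrite /X (E_Z hW); last exact: pXm.
    by rewrite [X in _ * X](CE_Xf0 f1 delta0 K0 x mL cj) mulr0.
  have := lindeberg hg (@hr M) tG 0 iF m0.
  have -> : E M (fun y => G (0 + \sum_(c' <- enum (edges M j b)) X c' y)) = CEu M m j b G x.
    rewrite /CE; apply: E_ext => y; rewrite add0r vfS// -mulr_sumr big_enum.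
    by [].
  have EX2 c' : c' \in edges M j b -> E M (fun y => X c' y ^+ 2) =
      sg ^+ 2 * CE (mmu M) B (fun z => Xf f m c' j z ^+ 2) x.
    move=> cj; rewrite /CE -(E_Z hW); last by apply: pgX; exact: pXm.
    by apply: E_ext => y; rewrite exprMn.
  have -> : \sum_(c' <- enum (edges M j b)) E M (fun y => X c' y ^+ 2) = Vf f m j b x.
    rewrite big_enum/= (VfE f1 delta0 K0)// mulr_sumr; apply: eq_bigr => c' cj.
    by rewrite EX2// sg2.
  move=> hl; apply: le_trans (ler_distD (heat (Vf f m j b x) G 0) _ _) _.
  apply: lerD; last first.
    apply: (heat_close tG) => //.
    by rewrite /Vf /CE; apply: E_ge0 => y; exact: sqr_ge0.
  apply: le_trans hl _; rewrite big_enum/= /err mulr_sumr mulr_sumr.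
  apply: ler_sum => c' cj.
  have pc := pXm c' cj; have pc4 := pgX 4 pc; have pc2 := pgX 2 pc.
  have p14 : pg M (fun y => 1 + Xf f m c' j (mix B x y) ^+ 4).
    by apply: (pgD hW) => //; exact: pg_cst.
  set q4 := CE (mmu M) B (fun z => 1 + Xf f m c' j z ^+ 4) x.
  have abs3 (t : R) : `|t| ^+ 3 <= 1 + t ^+ 4.
    have t0 := normr_ge0 t; rewrite (_ : t ^+ 4 = `|t| ^+ 4); last first.
      by rewrite -[4%N]/(2 * 2)%N !exprM real_normK ?num_real.
    case: (leP `|t| 1) => t1.
      by rewrite (le_trans (exprn_ile1 _ _ _))// lerDl exprn_ge0.
    by rewrite (le_trans (ler_weXn2l (ltW t1) (_ : (3 <= 4)%N)))// lerDr.
  have i1 : E M (fun y => `|X c' y| ^+ 3) <= sg ^+ 3 * q4.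
    rewrite /q4 /CE -(E_Z hW)//; apply: (E_le hW).
    - by apply: pgX; apply: pg_norm; exact: pgZ.
    - exact: pgZ.
    - by move=> y; rewrite /X normrM exprMn (ger0_norm sg0) ler_wpM2l ?exprn_ge0.
  have i2 : Num.sqrt (E M (fun y => X c' y ^+ 2)) ^+ 3 <= sg ^+ 3 * q4.
    rewrite EX2// sqrtrM ?sqr_ge0// sqrtr_sqr (ger0_norm sg0) exprMn ler_wpM2l ?exprn_ge0//.
    set V2 := CE _ _ _ x; have V20 : 0 <= V2 by apply: E_ge0 => y; exact: sqr_ge0.
    rewrite -[Num.sqrt V2]ger0_norm ?sqrtr_ge0//; apply: le_trans (abs3 _) _.
    rewrite -[4%N]/(2 * 2)%N exprM sqr_sqrtr// /q4 /CE (E_D hW) ?E_cst//; last exact: pg_cst.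
    rewrite lerD2l; apply: le_trans (CE_sqr_le hg (@hr M) B x (pgX 2 (pX c' cj))) _.
    by rewrite /CE le_eqVlt; apply/orP; left; apply/eqP/E_ext => y; rewrite -exprM.
  apply: le_trans (lerD i1 (ler_wpM2l k30 i2)) _.
  by rewrite le_eqVlt; apply/orP; left; apply/eqP; ring.
have pn : pg M (fun x => Vf f m j b x - n) by apply: (pgB hW) => //; exact: pg_cst.
have pn1 := pg_norm pn; have pn2 := pgX 2 pn1.
have pn12 := pgZ Hc (pgD hW pn1 pn2).
apply: le_trans (E_le hW _ (pgD hW perr pn12) key) _.
  apply: pg_norm; apply: (pgB hW); last exact: pg_cst.
  by apply: (pg_CE hg (@hr M)); exact: pgu.
rewrite (E_D hW)// (E_Z hW); last exact: (pgD hW).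
rewrite [leRHS]mulrDl; apply: lerD => //; rewrite (E_D hW)// -[leRHS]mulrA ler_wpM2l// [leRHS]mulrDl.
apply: lerD.
  apply: le_trans (E_norm_le hW pn rt) _.
  rewrite mulrAC ler_wpM2r// mulrDl mul1r lerD2l ler_pdivrMr// -mulrA -expr2.
  exact: hv.
under E_ext do rewrite real_normK ?num_real//.
by apply: le_trans hv _; rewrite ler_wpM2l// rate_sqr_le.
Qed.

End CentralLimit.

(** * The coupling *)

Section Transport.
Context (R : realType) (N : nat).
Implicit Types p q : 'I_N -> R.

Definition overlap p q k : R := Num.min (p k) (q k).
Definition excess p q : R := \sum_k (p k - overlap p q k).
(** With no excess there is nothing to redistribute; the default [p k] keeps this a probability
    vector that vanishes wherever [p] does. *)
Definition refill p q k : R :=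
  if excess p q == 0 then p k else (p k - overlap p q k) / excess p q.

(* The transition matrix of the maximal coupling of [q] with [p]: the common mass
   stays in place, the rest of [q] is redistributed on the deficit of [p]. At
   [q k = 0] the quotient is [0]. *)
Definition crow p q k k' : R :=
  (k == k')%:R * (overlap p q k / q k) + (1 - overlap p q k / q k) * refill p q k'.

Variables p q : 'I_N -> R.
Hypotheses (p0 : forall k, 0 <= p k) (q0 : forall k, 0 <= q k).
Hypotheses (p1 : \sum_k p k = 1) (q1 : \sum_k q k = 1).

Let ov0 k : 0 <= overlap p q k. Proof. by rewrite /overlap le_min p0 q0. Qed.
Let ovp k : overlap p q k <= p k. Proof. by rewrite /overlap ge_min lexx. Qed.
Let ovq k : overlap p q k <= q k. Proof. by rewrite /overlap ge_min lexx orbT. Qed.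

Let ratio01 k : 0 <= overlap p q k / q k <= 1.
Proof.
rewrite divr_ge0//=; have [->|qk] := eqVneq (q k) 0; first by rewrite invr0 mulr0.
by rewrite ler_pdivrMr ?mul1r// lt_neqAle eq_sym qk q0.
Qed.

Let excess0 : 0 <= excess p q. Proof. by apply: sumr_ge0 => k _; rewrite subr_ge0. Qed.

Let refill0 k : 0 <= refill p q k.
Proof. by rewrite /refill; case: ifP => // _; rewrite divr_ge0// subr_ge0. Qed.

Let refill1 : \sum_k refill p q k = 1.
Proof. by rewrite /refill; case: eqP => // /eqP e; rewrite -mulr_suml divff. Qed.

Lemma crow_ge0 k k' : 0 <= crow p q k k'.
Proof.
have /andP[a b] := ratio01 k.
by rewrite addr_ge0// mulr_ge0// ?ler0n// subr_ge0.
Qed.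

Lemma crow_sum k : \sum_k' crow p q k k' = 1.
Proof.
rewrite /crow big_split/= -mulr_sumr refill1 mulr1 (bigD1 k)//= eqxx mul1r big1.
  by rewrite addr0 addrC subrK.
by move=> k' /negbTE; rewrite eq_sym => ->; rewrite mul0r.
Qed.

Lemma crow_le1 k k' : crow p q k k' <= 1.
Proof.
rewrite -(crow_sum k) (bigD1 k')//= lerDl sumr_ge0// => i _; exact: crow_ge0.
Qed.

(** Cells of zero Gaussian mass are never entered, so the division by the mass in the density of the
    coupling is harmless. *)
Lemma crow_null k k' : p k' = 0 -> crow p q k k' = 0.
Proof.
move=> pk; have o : overlap p q k' = 0 by apply/eqP; rewrite eq_le ov0 andbT -pk.
have rf : refill p q k' = 0 by rewrite /refill o pk subrr mul0r if_same.
by rewrite /crow rf mulr0 addr0; case: eqP => [->|]; rewrite ?o ?mul0r ?mulr0 ?mul0r.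
Qed.

Let mul_ratio k : q k * (overlap p q k / q k) = overlap p q k.
Proof.
have [e|qk] := eqVneq (q k) 0; last by rewrite mulrC divfK.
by rewrite e mul0r; apply/esym/eqP; rewrite eq_le ov0 andbT -e ovq.
Qed.

Lemma crow_push k' : \sum_k q k * crow p q k k' = p k'.
Proof.
have -> : \sum_k q k * crow p q k k' = overlap p q k' + excess p q * refill p q k'.
  (* As [p] and [q] have equal total mass, the surplus of [q] is exactly the deficit of [p]. *)
  have eq_excess : \sum_k (q k - overlap p q k) = excess p q by rewrite /excess !sumrB p1 q1.
  rewrite -eq_excess mulr_suml [overlap p q k'](_ : _ = \sum_k (k == k')%:R * overlap p q k).
    rewrite -big_split/=; apply: eq_bigr => k _; rewrite /crow mulrDr mulrCA mul_ratio.
    by rewrite mulrA mulrBr mulr1 mul_ratio.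
  rewrite (bigD1 k')//= eqxx mul1r big1 ?addr0// => k /negbTE ->; exact: mul0r.
rewrite /refill; case: eqP => [e|/eqP e]; last by rewrite mulrC divfK// addrC subrK.
rewrite e mul0r addr0; apply/eqP; rewrite eq_le ovp/= -subr_le0 -e /excess (bigD1 k')//= lerDl.
by apply: sumr_ge0 => k _; rewrite subr_ge0.
Qed.

Lemma crow_diag k : q k * (1 - crow p q k k) <= `|q k - p k|.
Proof.
have /andP[a b] := ratio01 k.
apply: (@le_trans _ _ (q k - overlap p q k)).
  rewrite mulrBr mulr1 lerD2l lerN2 /crow eqxx mul1r mulrDr mul_ratio lerDl.
  by rewrite !mulr_ge0// subr_ge0.
rewrite /overlap; case: (leP (p k) (q k)) => h; first by rewrite ler_norm.
by rewrite subrr normr_ge0.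
Qed.

Lemma measurable_crow d (T : measurableType d) (Q : T -> 'I_N -> R) k k' :
  (forall t i, 0 <= Q t i) -> (forall i, measurable_fun setT (fun t => Q t i)) ->
  measurable_fun setT (fun t => crow p (Q t) k k').
Proof.
move=> Q0 mQ; have mo i : measurable_fun setT (fun t => overlap p (Q t) i).
  by apply: measurable_minr => //; exact: measurable_cst.
have mV (g : T -> R) : (forall t, 0 <= g t) -> measurable_fun setT g -> measurable_fun setT (fun t => (g t)^-1).
  move=> g0 mg; rewrite (_ : (fun t => _) = fun t => g t `^ (-1)).
    exact: measurableT_comp (measurable_powR _) mg.
  by apply/funext => t; rewrite powR_inv1.
have me : measurable_fun setT (fun t => excess p (Q t)).
  by apply: measurable_sum => i; apply: measurable_funB.
have mr : measurable_fun setT (fun t => overlap p (Q t) k / Q t k).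
  by apply: measurable_funM => //; apply: mV.
apply: measurable_funD; first exact: measurable_funM.
apply: measurable_funM; first exact: measurable_funB.
apply: measurable_fun_ifT => //; first exact: measurable_fun_eqr.
apply: measurable_funM; first exact: measurable_funB.
apply: mV => // t; apply: sumr_ge0 => i _; rewrite subr_ge0 /overlap ge_min lexx//.
Qed.

End Transport.

Section DensityProbability.
Context d (T : measurableType d) (R : realType).
Variables (m : {measure set T -> \bar R}) (rho : T -> R).
Hypotheses (mrho : measurable_fun setT rho) (rho0 : forall x, 0 <= rho x).
Hypothesis rho1 : (\int[m]_x (rho x)%:E = 1)%E.

Definition density_set (A : set T) : \bar R := (\int[m]_(x in A) (rho x)%:E)%E.

Let density0 : density_set set0 = 0%E. Proof. by rewrite /density_set integral_set0. Qed.

Let density_ge0 A : (0 <= density_set A)%E.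
Proof. by apply: integral_ge0 => x _; rewrite lee_fin. Qed.

Let irho : m.-integrable setT (EFin \o rho).
Proof.
apply/integrableP; split; first exact/measurable_EFinP.
by under eq_integral do rewrite /= ger0_norm//; rewrite rho1 ltry.
Qed.

Let density_sigma_additive : semi_sigma_additive density_set.
Proof.
move=> /= A mA tA mUA.
rewrite /density_set/= integral_bigcup//=; last exact: integrableS irho.
apply: is_cvg_ereal_nneg_natsum_cond => n _ _.
by apply: integral_ge0 => /= x ?; rewrite lee_fin.
Qed.

Let density_setT : density_set setT = 1%E. Proof. exact: rho1. Qed.

Let density_measure : {measure set T -> \bar R} :=
  HB.pack density_set (isMeasure.Build _ _ _ density_set density0 density_ge0 density_sigma_additive).

Lemma density_probability : exists Q : probability T R, forall A, Q A = density_set A.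
Proof.
pose Q : probability T R :=
  HB.pack density_set (Measure.class density_measure)
   (Measure_isProbability.Build _ _ _ density_measure density_setT).
by exists Q.
Qed.

End DensityProbability.

Section Coupling.
Context (R : realType) d (Om : measurableType d) (P : probability Om R) (gam : probability R R).
Variables (N : nat) (u : Om -> R) (phi : 'I_N -> R -> R) (q : Om -> 'I_N -> R).
Hypothesis mu_ : measurable_fun setT u.
Hypothesis mphi : forall k, measurable_fun setT (phi k).
Hypothesis phi0 : forall k x, 0 <= phi k x.
Hypothesis phi1 : forall x, \sum_k phi k x = 1.
Hypothesis mq : forall k, measurable_fun setT (fun w => q w k).
Hypothesis q0 : forall w k, 0 <= q w k.
Hypothesis q1 : forall w, \sum_k q w k = 1.

Notation EP := (EE P).
Notation EG := (EE gam).
Notation pgP := (pg (fun _ : Om => 1 : R)).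
Notation pgG := (pg (fun _ : R => 1 : R)).

(** Everything in the coupling is bounded; for the weight 1 the class [pg] consists of the bounded
    measurable functions. *)
Lemma unit_weight d' (T : measurableType d') (m : probability T R) :
  admissible_weight m (fun=> 1).
Proof.
split => // k; under eq_fun do rewrite expr1n.
exact: finite_measure_integrable_cst.
Qed.

Let hP := unit_weight P.
Let hG := unit_weight gam.

Definition pmass k : R := EG (phi k).

Let phi_le1 k x : phi k x <= 1.
Proof. by rewrite -(phi1 x) (bigD1 k)//= lerDl sumr_ge0. Qed.

Let pg_phi k : pgG (phi k).
Proof. by apply: (pg_bounded _ (C := 1)) => // x; rewrite ger0_norm. Qed.

Let p0 k : 0 <= pmass k. Proof. exact: E_ge0. Qed.

Let p1 : \sum_k pmass k = 1.
Proof. by rewrite -(E_sum hG)// -[RHS](E_cst gam); apply: E_ext => x; exact: phi1. Qed.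

Let s w k k' := crow pmass (q w) k k'.

Let ms k k' : measurable_fun setT (fun w => s w k k').
Proof. exact: measurable_crow. Qed.

(* The randomization event of mass [q k] is sent to [k'] with probability [s k k'];
   the new variable then has the density [phi k' / pmass k'] with respect to [gam]. *)
Let t (i : 'I_N * 'I_N) w := phi i.1 (u w) * s w i.1 i.2.
Let psi (i : 'I_N * 'I_N) x := phi i.2 x / pmass i.2.

Let mt i : measurable_fun setT (t i).
Proof. by apply: measurable_funM; [exact: measurableT_comp|exact: ms]. Qed.

Let s0 w k k' : 0 <= s w k k'. Proof. exact: crow_ge0. Qed.

Let t0 i w : 0 <= t i w. Proof. by rewrite mulr_ge0// s0. Qed.

Let pg_t i : pgP (t i).
Proof.
apply: (pg_bounded _ (C := 1)) => // w; rewrite ger0_norm//.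
by rewrite mulr_ile1// ?s0//; exact: crow_le1.
Qed.

Let psi0 i x : 0 <= psi i x. Proof. by rewrite divr_ge0. Qed.

Let pg_psi i : pgG (psi i). Proof. exact: pgZr. Qed.

Let rho (z : Om * R) := \sum_i t i z.1 * psi i z.2.

Let PG : probability (Om * R)%type R := (P \x gam)%E.

Lemma integral_sum_prod (a : 'I_N * 'I_N -> Om -> R) (b : 'I_N * 'I_N -> R -> R) :
  (forall i, pgP (a i)) -> (forall i, pgG (b i)) ->
  (forall i w, 0 <= a i w) -> (forall i x, 0 <= b i x) ->
  (\int[PG]_z (\sum_i a i z.1 * b i z.2)%:E = (\sum_i EP (a i) * EG (b i))%:E)%E.
Proof.
move=> pa pb a0 b0.
rewrite (fubini_tonelli1 (m1 := P) (m2 := gam) (fun z : Om * R => (\sum_i a i z.1 * b i z.2)%:E)); last 2 first.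
- apply/measurable_EFinP; apply: measurable_sum => i; apply: measurable_funM.
    exact: measurableT_comp (pg_meas (pa i)) measurable_fst.
  exact: measurableT_comp (pg_meas (pb i)) measurable_snd.
- by move=> z; rewrite lee_fin sumr_ge0// => i _; rewrite mulr_ge0.
transitivity (\int[P]_w (\sum_i a i w * EG (b i))%:E)%E.
  apply: eq_integral => w _; rewrite /fubini_F /=.
  have pab i : pgG (fun x => a i w * b i x) by exact: pgZ.
  rewrite (E_fin hG); last exact: (pg_sum hG).
  by rewrite (E_sum hG)//; congr (_%:E); apply: eq_bigr => i _; rewrite (E_Z hG).
have pab i : pgP (fun w => a i w * EG (b i)) by exact: pgZr.
rewrite (E_fin hP); last exact: (pg_sum hP).
by rewrite (E_sum hP)//; congr (_%:E); apply: eq_bigr => i _; rewrite (E_Zr hP).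
Qed.

Let mrho : measurable_fun setT rho.
Proof.
apply: measurable_sum => i; apply: measurable_funM.
  exact: measurableT_comp (mt i) measurable_fst.
exact: measurableT_comp (pg_meas (pg_psi i)) measurable_snd.
Qed.

Let rho0 z : 0 <= rho z.
Proof. by apply: sumr_ge0 => i _; rewrite mulr_ge0. Qed.

Let pg_indic d' (T : measurableType d') (A : set T) : measurable A -> pg (fun=> 1 : R) (\1_A : T -> R).
Proof.
move=> mA; apply: (pg_bounded _ (C := 1)); first exact: measurable_indic.
by move=> x; rewrite indicE normr_nat lern1 leq_b1.
Qed.

Let E_indic d' (T : measurableType d') (m : probability T R) A : measurable A ->
  m A = (EE m (\1_A))%:E.
Proof.
move=> mA; rewrite -(E_fin (unit_weight m)); last exact: pg_indic.
by rewrite integral_indic// setIT.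
Qed.

(** At zero mass the quotient in [psi] is 0, so this conditional density has mass 0 instead of 1;
    [crow_null] compensates for it in [sum_t]. *)
Let EG_psi i : EG (psi i) = (pmass i.2 != 0)%:R.
Proof. by rewrite (E_Zr hG)// -/(pmass i.2); case: eqP => [->|/eqP h]; rewrite ?mul0r ?divff. Qed.

Let sum_t w : \sum_i t i w * (pmass i.2 != 0)%:R = 1.
Proof.
rewrite -(pair_bigA _ (fun k k' => t (k, k') w * (pmass k' != 0)%:R))/=.
rewrite -[RHS](phi1 (u w)); apply: eq_bigr => k _.
rewrite -[RHS]mulr1 -[X in _ = _ * X](crow_sum (q w) p1 k) mulr_sumr; apply: eq_bigr => k' _.
rewrite /t /s /=; have [e|h] := eqVneq (pmass k') 0; last by rewrite mulr1.
by rewrite mulr0 crow_null// mulr0.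
Qed.

Let rect_mass S A : measurable S -> measurable A ->
  (\int[PG]_(z in S `*` A) (rho z)%:E =
   (\sum_i EP (fun w => \1_S w * t i w) * EG (fun x => \1_A x * psi i x))%:E)%E.
Proof.
move=> mS mA; rewrite -integral_sum_prod; first last.
- by move=> i x; rewrite mulr_ge0.
- by move=> i x; rewrite mulr_ge0.
- by move=> i; apply: pgM => //; exact: pg_indic.
- by move=> i; apply: pgM => //; exact: pg_indic.
rewrite integral_mkcond; apply: eq_integral => -[w x] _; rewrite patchE/= /rho/= !indicE.
case: ifPn => [/set_mem[wS xA]|/negP nSA].
  congr EFin; apply: eq_bigr => i _.
  by rewrite (mem_set wS) (mem_set xA) !mul1r.
rewrite big1// => i _; case: (boolP (w \in S)) => [wS|_]; last by rewrite mul0r mul0r.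
case: (boolP (x \in A)) => [xA|_]; last by rewrite mul0r mulr0.
by case: nSA; apply/mem_set; split; exact: set_mem.
Qed.

Let rho1 : (\int[PG]_z (rho z)%:E = 1)%E.
Proof.
have := rect_mass (@measurableT _ Om) (@measurableT _ R); rewrite setXTT => ->; congr EFin.
transitivity (EP (fun w => \sum_i t i w * (pmass i.2 != 0)%:R)); last first.
  by rewrite -[RHS](E_cst P); apply: E_ext => w; exact: sum_t.
rewrite (E_sum hP); last by move=> i _; exact: pgZr.
apply: eq_bigr => i _; rewrite (E_Zr hP)// -EG_psi; congr (_ * _); apply: E_ext => w;
  by rewrite indicT mul1r.
Qed.

(* [G] plays the role of the conditioning sigma-algebra, [q] of the conditional
   expectation of the [phi k (u)]. *)
Variable G : set (set Om).
Hypothesis GT : G setT.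
Hypothesis G_cond : forall S, G S -> measurable S /\
  forall k k', EP (fun w => \1_S w * (phi k (u w) * crow pmass (q w) k k')) =
    EP (fun w => \1_S w * (q w k * crow pmass (q w) k k')).

Let pg_q k : pgP (fun w => q w k).
Proof.
apply: (pg_bounded _ (C := 1)) => // w; rewrite ger0_norm//.
by rewrite -(q1 w) (bigD1 k)//= lerDl sumr_ge0.
Qed.

Let pg_s k k' : pgP (fun w => s w k k').
Proof.
apply: (pg_bounded _ (C := 1)) => // w; rewrite ger0_norm; last exact: s0.
exact: crow_le1.
Qed.

(** The exact independence. On [S] the conditional expectation turns [phi k (u)] into [q k];
    [crow_push] then sends mass [pmass k'] to each cell [k'] whatever [q] is, this cancels the
    denominator of [psi], and the [phi k'] sum to 1. *)
Let G_mass S A : G S -> measurable A ->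
  (\int[PG]_(z in S `*` A) (rho z)%:E = gam A * P S)%E.
Proof.
move=> GS mA; have [mS hS] := G_cond GS; rewrite rect_mass//.
have pS := pg_indic mS; have pA := pg_indic mA.
rewrite (E_indic gam mA) (E_indic P mS) -EFinM; congr EFin.
have key k' : \sum_k EP (fun w => \1_S w * t (k, k') w) = pmass k' * EP (\1_S).
  rewrite (eq_bigr _ (fun k _ => hS k k')) -(E_sum hP); last first.
    by move=> k _; apply: pgM => //; apply: pgM => //; exact: pg_s.
  rewrite -(E_Z hP)//; apply: E_ext => w; rewrite -mulr_sumr mulrC; congr (_ * _).
  exact: crow_push.
rewrite -(pair_bigA _ (fun k k' => EP (fun w => \1_S w * t (k, k') w) * EG (fun x => \1_A x * psi (k, k') x)))/=.
rewrite exchange_big/=.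
transitivity (\sum_k' EP (\1_S) * EG (fun x => \1_A x * phi k' x)).
  apply: eq_bigr => k' _; rewrite /psi/= -mulr_suml key mulrAC mulrC; congr (_ * _).
  have pAp : pgG (fun x => \1_A x * phi k' x) by exact: pgM.
  transitivity (pmass k' * EG (fun x => (\1_A x * phi k' x) / pmass k')).
    by congr (_ * _); apply: E_ext => x; rewrite mulrA.
  rewrite (E_Zr hG)//; have [e|h] := eqVneq (pmass k') 0; last by rewrite mulrC divfK.
  rewrite e mul0r; apply/esym/eqP; rewrite eq_le; apply/andP; split; last first.
    by apply: E_ge0 => x; rewrite mulr_ge0.
  rewrite -e; apply: (E_le hG) => // x.
  have i1 : \1_A x <= 1 :> R by rewrite indicE lern1 leq_b1.
  by rewrite ler_piMl.
rewrite -mulr_sumr mulrC; congr (_ * _).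
rewrite -(E_sum hG); last by move=> k _; exact: pgM.
by apply: E_ext => x; rewrite -mulr_sumr phi1 mulr1.
Qed.

Variable tail : pred 'I_N.

(** One deviation pays for the mass that changes cell, the other for comparing the mean of [q] with
    [pmass] on the tail cells. *)
Definition mismatch : R := \sum_(k | tail k) pmass k + 2 * \sum_k EP (fun w => `|q w k - pmass k|).

Lemma coupling_exists : exists Q : probability (Om * R)%type R,
  [/\ forall S, measurable S -> Q (fst @^-1` S) = P S,
      forall A, measurable A -> Q (snd @^-1` A) = gam A,
      forall S A, G S -> measurable A -> Q (snd @^-1` A `&` fst @^-1` S) = (gam A * P S)%E &
      forall h : R, (forall k x y, ~~ tail k -> phi k x != 0 -> phi k y != 0 -> `|x - y| <= h) ->
        (Q [set z : Om * R | (h < `|u z.1 - z.2|)%R] <= mismatch%:E)%E].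
Proof.
have [Q hQ] := density_probability mrho rho0 rho1.
have QG S A : G S -> measurable A -> Q (snd @^-1` A `&` fst @^-1` S) = (gam A * P S)%E.
  move=> GS mA; rewrite hQ /density_set -G_mass//; congr (integral _ _ _).
  by apply/seteqP; split => -[w x] [].
exists Q; split => //.
- move=> S mS; rewrite hQ /density_set (_ : _ @^-1` S = S `*` setT); last first.
    by apply/seteqP; split => -[w x] //= [].
  rewrite rect_mass// (E_indic P mS); congr EFin.
  have pS := pg_indic mS.
  transitivity (EP (fun w => \1_S w * \sum_i t i w * (pmass i.2 != 0)%:R)); last first.
    by apply: E_ext => w; rewrite sum_t mulr1.
  transitivity (EP (fun w => \sum_i \1_S w * (t i w * (pmass i.2 != 0)%:R))); last first.
    by apply: E_ext => w; rewrite mulr_sumr.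
  rewrite (E_sum hP); last by move=> i _; apply: pgM => //; exact: pgZr.
  apply: eq_bigr => i _; rewrite -EG_psi.
  rewrite [X in _ * X = _](_ : _ = EG (psi i)); last by apply: E_ext => x; rewrite indicT mul1r.
  have pSt : pgP (fun w => \1_S w * t i w) by exact: pgM.
  rewrite -(E_Zr hP _ pSt); apply: E_ext => w; exact/esym/mulrA.
- move=> A mA; rewrite -(setIT (snd @^-1` A)) -(preimage_setT (fst : Om * R -> Om)) QG//.
  by rewrite [X in (_ * X)%E](@probability_setT _ _ _ P) mule1.
move=> h hh; rewrite hQ /density_set.
(* Off the bad pairs, [u] and the new variable lie in the support of one and the same bounded
   cell. *)
pose bad i : bool := tail i.1 || (i.1 != i.2).
have mfar : measurable [set z : Om * R | h < `|u z.1 - z.2|].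
  have : measurable_fun setT (fun z : Om * R => h < `|u z.1 - z.2|).
    apply: measurable_fun_ltr => //; apply: measurableT_comp => //; apply: measurable_funB.
      exact: measurableT_comp measurable_fst.
    exact: measurable_snd.
  have mt1 : measurable [set true] by [].
  by move=> /(_ measurableT _ mt1); rewrite setTI preimage_true.
apply: (@le_trans _ _ (\int[PG]_z (\sum_i ((bad i)%:R * t i z.1) * psi i z.2)%:E)%E).
  rewrite integral_mkcond; apply: ge0_le_integral => //.
  - by move=> z _; rewrite patchE; case: ifP => // _; rewrite lee_fin.
  - apply/(measurable_restrictT _ mfar)/measurable_funTS; exact/measurable_EFinP.
  - apply/measurable_EFinP; apply: measurable_sum => i; apply: measurable_funM.
      apply: measurable_funM => //; exact: measurableT_comp (mt i) measurable_fst.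
    exact: measurableT_comp (pg_meas (pg_psi i)) measurable_snd.
  - move=> [w x] _; rewrite patchE; case: ifPn => [/set_mem /= hz|_]; last first.
      by rewrite lee_fin; apply: sumr_ge0 => i _; rewrite mulr_ge0// mulr_ge0.
    rewrite lee_fin; apply: ler_sum => i _ /=; rewrite -mulrA.
    case bi : (bad i); first by rewrite mul1r.
    move: bi => /negbT; rewrite /bad negb_or negbK => /andP[nt /eqP e].
    rewrite mul0r /t /psi -e.
    have [->|h1] := eqVneq (phi i.1 (u w)) 0; first by rewrite !mul0r.
    have [->|h2] := eqVneq (phi i.1 x) 0; first by rewrite mul0r mulr0.
    by move: hz; rewrite ltNge (hh _ _ _ nt h1 h2).
have pbt i : pgP (fun w => (bad i)%:R * t i w) by exact: pgZ.
rewrite (integral_sum_prod pbt pg_psi); last 2 first.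
- by move=> i w; rewrite mulr_ge0.
- exact: psi0.
rewrite lee_fin; apply: (@le_trans _ _ (\sum_i (bad i)%:R * EP (t i))).
  apply: ler_sum => i _; rewrite (E_Z hP)// EG_psi ler_piMr//.
    by rewrite mulr_ge0// E_ge0.
  by rewrite lern1 leq_b1.
have pts k k' : pgP (fun w => q w k * s w k k') by apply: pgM => //; exact: pg_s.
have Et k k' : EP (t (k, k')) = EP (fun w => q w k * s w k k').
  have [_ hT] := G_cond GT; have := hT k k'.
  under E_ext do rewrite indicT mul1r.
  by under [in X in _ = X -> _]E_ext do rewrite indicT mul1r.
rewrite -(pair_bigA _ (fun k k' => (bad (k, k'))%:R * EP (t (k, k'))))/=.
have row k : \sum_k' (bad (k, k'))%:R * EP (t (k, k')) <=
    (tail k)%:R * EP (fun w => q w k) + EP (fun w => `|q w k - pmass k|).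
  have -> : \sum_k' (bad (k, k'))%:R * EP (t (k, k')) =
      EP (fun w => q w k * \sum_k' (bad (k, k'))%:R * s w k k').
    transitivity (EP (fun w => \sum_k' (bad (k, k'))%:R * (q w k * s w k k'))).
      rewrite (E_sum hP); last by move=> k' _; exact: pgZ.
      by apply: eq_bigr => k' _; rewrite Et (E_Z hP).
    by apply: E_ext => w; rewrite mulr_sumr; apply: eq_bigr => k' _; rewrite mulrCA.
  have pd : pgP (fun w => `|q w k - pmass k|).
    by apply: pg_norm; apply: (pgB hP) => //; exact: pg_cst.
  have pb : pgP (fun w => \sum_k' (bad (k, k'))%:R * s w k k').
    by apply: (pg_sum hP) => k' _; apply: pgZ; exact: pg_s.
  rewrite -(E_Z hP)// -(E_D hP)//; last exact: pgZ.
  apply: (E_le hP); [exact: pgM|by apply: (pgD hP) => //; exact: pgZ|move=> w].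
  have sk : \sum_k' s w k k' = 1 by exact: crow_sum.
  case tk : (tail k).
    rewrite mul1r; apply: (@le_trans _ _ (q w k)); last by rewrite lerDl.
    rewrite ler_piMr// -[leRHS]sk; apply: ler_sum => k' _.
    by rewrite ler_piMl ?s0// lern1 leq_b1.
  rewrite mul0r add0r; apply: le_trans (crow_diag p0 (q0 w) k).
  rewrite ler_wpM2l// [leRHS](_ : _ = \sum_(k' | k' != k) s w k k'); last first.
    by rewrite -[X in X - _]sk (bigD1 k)//= addrAC subrr add0r.
  rewrite (bigD1 k)//= /bad /= tk eqxx /= mul0r add0r; apply: ler_sum => k' kk'.
  by rewrite eq_sym kk' mul1r.
apply: le_trans (ler_sum _ (fun k _ => row k)) _; rewrite big_split/= /mismatch.
set D := \sum_k EP (fun w => `|q w k - pmass k|).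
suff : \sum_k (tail k)%:R * EP (fun w => q w k) <= \sum_(k | tail k) pmass k + D by lra.
rewrite [X in _ <= X + _]big_mkcond -big_split/=; apply: ler_sum => k _.
have pd : pgP (fun w => q w k - pmass k) by apply: (pgB hP) => //; exact: pg_cst.
case: (tail k); last by rewrite mul0r add0r E_ge0.
rewrite mul1r -lerBlDl.
have -> : EP (fun w => q w k) - pmass k = EP (fun w => q w k - pmass k).
  by rewrite (E_B hP) ?E_cst//; exact: pg_cst.
by apply: le_trans (E_norm hP pd); exact: ler_norm.
Qed.

End Coupling.

(** * Partitions of unity by cubic splines *)

Section Splines.
Context (R : realType).
Implicit Types (x y z t h : R).

Definition pos_part x : R := Num.max x 0.

Lemma pos_partE x : pos_part x = if 0 <= x then x else 0.
Proof. by rewrite /pos_part; case: (leP 0 x). Qed.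

Definition cubic t x : R := pos_part (x - t) ^+ 3.

Lemma continuous_pos_part t : continuous (fun x => pos_part (x - t)).
Proof.
rewrite (_ : (fun x => _) = fun x => (x - t + 0 + `|x - t - 0|) / 2); last first.
  by apply/funext => x; rewrite /pos_part maxr_absE.
move=> x; have c : (fun x => x - t) x @[x --> x] --> x - t.
  by apply: cvgB; [exact: cvg_id|exact: cvg_cst].
apply: cvgMr_tmp; apply: cvgD; first by apply: cvgD; [exact: c|exact: cvg_cst].
by apply: cvg_norm; apply: cvgB; [exact: c|exact: cvg_cst].
Qed.

Let ppow t n : pg (@Wr R) (fun x => pos_part (x - t) ^+ n).
Proof.
apply: pgX; have p : pg (@Wr R) (fun x => x - t).
  apply: (pgB (gaussP_weight (@ltr01 R))); [exact: pg_id|exact: pg_cst].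
apply: (pg_le _ _ p); first by apply: continuous_measurable_fun; exact: continuous_pos_part.
by move=> x; rewrite pos_partE; case: ifP => // _; rewrite normr0.
Qed.

(** The third derivative is 0 or 6, so the Taylor remainder has constant [6 / 6 = 1], the
    normalization in [test_fun]. Only the sign changes of [x - t] and [x + y - t] need
    inspection. *)
Lemma test_fun_cubic t : test_fun (6 * (1 + `|t|)) (cubic t)
  (fun x => 3 * pos_part (x - t) ^+ 2) (fun x => 6 * pos_part (x - t)).
Proof.
have pp x : 0 <= pos_part x by rewrite /pos_part le_max lexx orbT.
split; [split|split].
- move=> x; rewrite /cubic.
  apply: (@continuous_comp _ _ _ (fun x => pos_part (x - t)) (fun y => y ^+ 3)).
    exact: continuous_pos_part.
  exact: exprn_continuous.
- by move=> x; rewrite exprn_ge0.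
- exact: ppow.
- by apply: pgZ; exact: ppow.
- apply: pgZ; exact: (ppow t 1).
- move=> x y; rewrite /cubic (_ : x + y - t = (x - t) + y); last by ring.
  move: (x - t) => p; rewrite !pos_partE.
  have e : `|y| ^+ 3 = `|y ^+ 3| by rewrite normrX.
  rewrite e; case: (leP 0 p) => p0; case: (leP 0 (p + y)) => q0.
  + by rewrite (_ : _ - _ = y ^+ 3)//; field.
  + have y0 : y < 0 by lra.
    rewrite (_ : _ - _ = y ^+ 3 - (p + y) ^+ 3); last by field.
    have s3 : y ^+ 3 <= (p + y) ^+ 3.
      by rewrite -subr_ge0 (_ : _ - _ = p * ((p + y) ^+ 2 + (p + y) * y + y ^+ 2)); [apply: mulr_ge0 => //; nra|ring].
    have s4 : (p + y) ^+ 3 <= 0 by rewrite exprS mulr_le0_ge0 ?sqr_ge0// ltW.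
    by rewrite !ler0_norm; lra.
  + have y0 : 0 < y by lra.
    have s3 : (p + y) ^+ 3 <= y ^+ 3 by rewrite lerXn2r ?nnegrE ?(ltW y0)//; lra.
    have s4 : 0 <= (p + y) ^+ 3 by rewrite exprn_ge0.
    by rewrite (_ : _ - _ = (p + y) ^+ 3); [rewrite !ger0_norm; lra|field].
  + by rewrite (_ : _ - _ = 0) ?normr0//; field.
- move=> x; rewrite ger0_norm ?mulr_ge0// -mulrA ler_wpM2l// pos_partE.
  have a := normr_ge0 x; have b := normr_ge0 t; have ab := mulr_ge0 a b.
  have h1 := ler_norm x; have h2 := ler_norm (- t); rewrite normrN in h2.
  by case: ifP => _; nra.
Qed.

Let g y : R := pos_part y ^+ 3.
Let S y : R := (g y - 3 * g (y - 1) + 3 * g (y - 2) - g (y - 3)) / 6.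

Let gP y : 0 <= y -> g y = y ^+ 3. Proof. by move=> y0; rewrite /g pos_partE y0. Qed.
Let gN y : y <= 0 -> g y = 0.
Proof. by move=> y0; rewrite /g /pos_part max_r// expr0n. Qed.

Let S0 y : y <= 0 -> S y = 0.
Proof. by move=> y0; rewrite /S !gN; [lra|lra..]. Qed.

Let S1 y : 0 <= y <= 1 -> S y = y ^+ 3 / 6.
Proof. by move=> y0; rewrite /S (@gP y) ?(@gN (y - 1)) ?(@gN (y - 2)) ?(@gN (y - 3)); [ring|lra..]. Qed.

Let S2 y : 1 <= y <= 2 -> S y = (y ^+ 3 - 3 * (y - 1) ^+ 3) / 6.
Proof. by move=> y0; rewrite /S (@gP y) ?(@gP (y - 1)) ?(@gN (y - 2)) ?(@gN (y - 3)); [ring|lra..]. Qed.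

Let S3 y : 2 <= y <= 3 -> S y = 1 - (3 - y) ^+ 3 / 6.
Proof. by move=> y0; rewrite /S (@gP y) ?(@gP (y - 1)) ?(@gP (y - 2)) ?(@gN (y - 3)); [field|lra..]. Qed.

Let S4 y : 3 <= y -> S y = 1.
Proof. by move=> y0; rewrite /S (@gP y) ?(@gP (y - 1)) ?(@gP (y - 2)) ?(@gP (y - 3)); [field|lra..]. Qed.

Let cube_le y z : 0 <= y -> y <= z -> y ^+ 3 <= z ^+ 3.
Proof. by move=> y0 yz; rewrite lerXn2r ?nnegrE//; lra. Qed.

(** Monotonicity is checked on each polynomial piece and glued at the knots by [ext]. Only the piece
    on [[1, 2]] is not a monotone cube; there [z - y] is factored out. *)
Let S_homo y z : y <= z -> S y <= S z.
Proof.
have ext b b' : b <= b' -> (forall y z, y <= z -> z <= b -> S y <= S z) ->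
    (forall y z, b <= y -> y <= z -> z <= b' -> S y <= S z) ->
    forall y z, y <= z -> z <= b' -> S y <= S z.
  move=> bb' h1 h2 {}y {}z yz zb'; case: (leP z b) => zb; first exact: h1.
  case: (leP b y) => by_; first exact: h2.
  by apply: le_trans (h1 y b (ltW by_) (lexx _)) (h2 b z (lexx _) (ltW zb) zb').
have m0 : forall y z, y <= z -> z <= 0 -> S y <= S z by move=> *; rewrite !S0//; lra.
have m1 := ext 0 1 ltac:(lra) m0.
have {}m1 : forall y z, y <= z -> z <= 1 -> S y <= S z.
  by apply: m1 => {}y {}z *; rewrite !S1; [rewrite ler_wpM2r//; apply: cube_le|lra..].
have {}m2 : forall y z, y <= z -> z <= 2 -> S y <= S z.
  apply: (ext 1 2 ltac:(lra) m1) => {}y {}z y1 yz z2; rewrite !S2; [|lra..].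
  rewrite ler_wpM2r// -subr_ge0 (_ : _ - _ = (z - y) * (3 + 3 * ((y - 1) + (z - 1)) -
     2 * ((y - 1) ^+ 2 + (y - 1) * (z - 1) + (z - 1) ^+ 2))); last by ring.
  by rewrite mulr_ge0//; [lra|nra].
have {}m3 : forall y z, y <= z -> z <= 3 -> S y <= S z.
  apply: (ext 2 3 ltac:(lra) m2) => {}y {}z y1 yz z2; rewrite !S3; [|lra..].
  by rewrite lerD2l lerN2 ler_wpM2r//; apply: cube_le; lra.
move=> yz; apply: (ext 3 (3 + `|z|)) => //; first by rewrite lerDl.
  by move=> a b ha hab _; rewrite !S4//; lra.
by apply: le_trans (ler_norm z) _; rewrite lerDr.
Qed.

(* The integral of a quadratic B-spline, as a third difference of truncated cubes. *)
Definition smooth_step h t x : R := (6 * h ^+ 3)^-1 *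
  (cubic t x + (- 3 * cubic (t + h) x + (3 * cubic (t + 2 * h) x + - 1 * cubic (t + 3 * h) x))).

Let smooth_stepE h t x : 0 < h -> smooth_step h t x = S ((x - t) / h).
Proof.
move=> h0; set y := (x - t) / h; have hn : h != 0 by rewrite gt_eqF.
have e a : cubic (t + a * h) x = h ^+ 3 * g (y - a).
  have eh : x - (t + a * h) = h * (y - a) by rewrite /y; field.
  rewrite /cubic /g eh !pos_partE pmulr_rge0//; case: ifP => _; first by rewrite exprMn.
  by rewrite expr0n /= mulr0.
have e0 := e 0; rewrite mul0r addr0 subr0 in e0.
have e1 := e 1; rewrite mul1r in e1.
by rewrite /smooth_step e0 e1 !e /S; field.
Qed.

Lemma smooth_step_homo h t x x' : 0 < h -> x <= x' -> smooth_step h t x <= smooth_step h t x'.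
Proof.
move=> h0 xx'; rewrite !smooth_stepE//; apply: S_homo.
by rewrite ler_wpM2r ?invr_ge0 ?(ltW h0)// lerD2r.
Qed.

Lemma smooth_step_le h t t' x : 0 < h -> t <= t' -> smooth_step h t' x <= smooth_step h t x.
Proof.
move=> h0 tt'; rewrite !smooth_stepE//; apply: S_homo.
by rewrite ler_wpM2r ?invr_ge0 ?(ltW h0)// lerD2l lerN2.
Qed.

Lemma smooth_step0 h t x : 0 < h -> x <= t -> smooth_step h t x = 0.
Proof.
move=> h0 xt; rewrite smooth_stepE// S0// mulr_le0_ge0 ?invr_ge0 ?(ltW h0)//.
by rewrite subr_le0.
Qed.

Lemma smooth_step1 h t x : 0 < h -> t + 3 * h <= x -> smooth_step h t x = 1.
Proof. by move=> h0 xt; rewrite smooth_stepE// S4// ler_pdivlMr//; lra. Qed.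

Lemma smooth_step_01 h t x : 0 < h -> 0 <= smooth_step h t x <= 1.
Proof.
move=> h0; apply/andP; split.
  case: (leP x t) => xt; first by rewrite smooth_step0.
  by rewrite -(smooth_step0 h0 (lexx t)); apply: smooth_step_homo => //; exact: ltW.
case: (leP (t + 3 * h) x) => xt; first by rewrite smooth_step1.
by rewrite -(smooth_step1 h0 (lexx (t + 3 * h))); apply: smooth_step_homo => //; exact: ltW.
Qed.

Section Partition.
Variables (h T : R) (n : nat).
Hypothesis h0 : 0 < h.

Let node i : R := - T + i%:R * h.

(** A decreasing sequence from 1 to 0 with steps at the nodes in between. The cells are its
    consecutive differences, so they are nonnegative, telescope to 1, and include the two unbounded
    tails. *)
Definition stair (k : nat) x : R :=
  if k is i.+1 then (if (i <= n)%N then smooth_step h (node i) x else 0) else 1.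

Definition hat (k : 'I_n.+2) x : R := stair k x - stair k.+1 x.

Definition is_tail (k : 'I_n.+2) : bool := (k == ord0) || (k == ord_max).

Lemma hat_ge0 k x : 0 <= hat k x.
Proof.
rewrite /hat subr_ge0; case: k => -[|k] kn /=.
  by have /andP[] := smooth_step_01 (node 0) x h0.
rewrite !ltnS in kn; rewrite kn.
case: ifP => _; last by have /andP[] := smooth_step_01 (node k) x h0.
by apply: smooth_step_le => //; rewrite lerD2l ler_wpM2r ?(ltW h0)// ler_nat.
Qed.

Lemma hat_sum x : \sum_k hat k x = 1.
Proof.
rewrite (eq_bigr (fun k : 'I_n.+2 => - (stair k.+1 x - stair k x))); last first.
  by move=> k _; rewrite opprB.
rewrite sumrN -(big_mkord xpredT (fun k => stair k.+1 x - stair k x)) telescope_sumr//=.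
by rewrite ltnn sub0r opprK.
Qed.

(** The first step of the difference starts at [node k.-1], and the second is complete at
    [node k + 3 * h], which is [node k.-1 + 4 * h]. *)
Lemma hat_close k x y : ~~ is_tail k -> hat k x != 0 -> hat k y != 0 -> `|x - y| <= 4 * h.
Proof.
rewrite /is_tail negb_or => /andP[k0 kn].
have inside z : hat k z != 0 -> node k.-1 <= z <= node k.-1 + 4 * h.
  move=> hz; have kp : (0 < k)%N by rewrite lt0n.
  have kn' : (k <= n)%N.
    have := ltn_ord k; rewrite ltnS leq_eqVlt => /predU1P[e|//].
    by case/negP: kn; apply/eqP/val_inj; rewrite /= e.
  have nodeS : node k = node k.-1 + h.
    by rewrite /node -[in LHS](prednK kp) -natr1 mulrDl mul1r addrA.
  have e1 : stair k z = smooth_step h (node k.-1) z.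
    by rewrite -{1}(prednK kp) /= (leq_trans (leq_pred k) kn').
  have e2 : stair k.+1 z = smooth_step h (node k) z by rewrite /= kn'.
  rewrite leNgt [X in _ && X]leNgt; apply/andP; split; apply: contraNN hz => hz;
    rewrite /hat e1 e2.
    have z1 := ltW hz; have z2 : z <= node k by rewrite nodeS; move: (node k.-1) z1 h0 => ? ? ?; lra.
    by rewrite !smooth_step0 ?subrr ?eqxx.
  have z1 := ltW hz; have z2 : node k.-1 + 3 * h <= z by move: (node k.-1) z1 h0 => ? ? ?; lra.
  by rewrite !smooth_step1 ?subrr ?eqxx ?nodeS; move: (node k.-1) z1 z2 h0 => ? ? ? ? //; lra.
move=> /inside hx /inside hy; rewrite ler_norml; lra.
Qed.

(** Chebyshev's bound for the tails. The choice of [T] completes the first step at [- A], and [n] is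
    large enough for the last one to start beyond [A]. *)
Lemma hat_tail x A : 0 < A -> T = A + 3 * h -> 2 * A + 3 * h <= n%:R * h ->
  \sum_(k | is_tail k) hat k x <= x ^+ 2 / A ^+ 2.
Proof.
move=> A0 eT hn; have A20 : 0 < A ^+ 2 by rewrite exprn_gt0.
have -> : \sum_(k | is_tail k) hat k x = hat ord0 x + hat ord_max x.
  rewrite (bigD1 ord0)//= (bigD1 ord_max)//= ?big1 ?addr0//.
    by move=> k /andP[/andP[]]; rewrite /is_tail => /orP[/eqP ->|/eqP ->]; rewrite eqxx.
  by rewrite /is_tail eqxx orbT.
have -> : hat ord0 x = 1 - smooth_step h (node 0) x by [].
have -> : hat ord_max x = smooth_step h (node n) x by rewrite /hat /= leqnn ltnn subr0.
have -> : node 0 = - T by rewrite /node mul0r addr0.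
have /andP[a1 a2] := smooth_step_01 (- T) x h0.
have /andP[b1 b2] := smooth_step_01 (node n) x h0.
have x20 := sqr_ge0 x.
case: (leP x (- A)) => xA.
  rewrite [X in _ + X]smooth_step0//; last by rewrite /node; lra.
  rewrite addr0 (@le_trans _ _ 1)//; first by lra.
  by rewrite ler_pdivlMr// mul1r -[leLHS]sqrrN -[leRHS]sqrrN sqrrN lerXn2r ?nnegrE; lra.
rewrite [X in 1 - X]smooth_step1//; last by lra.
rewrite subrr add0r; case: (leP x A) => xA'.
  by rewrite smooth_step0 ?divr_ge0 ?(ltW A20)// /node; lra.
by rewrite (@le_trans _ _ 1)// ler_pdivlMr// mul1r lerXn2r ?nnegrE; lra.
Qed.

End Partition.
End Splines.

(** * Couplings of a message close to a Gaussian variable *)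

Section VanishingMismatch.
Context (R : realType) (r : nat) (f : {ffun 'I_r -> bool} -> bool) (delta K : R) (L : nat).
Hypothesis f1 : forall S : {set 'I_r}, #|S| = 1%N -> fhat R f S = 0.
Hypothesis delta0 : 0 < delta.
Hypothesis K0 : 0 < K.
Hypothesis r0 : (0 < r)%N.
Hypothesis nu0 : forall m, 0 < nu f delta m.+1.
Notation pre_model := (pre_model r delta K L).
Implicit Type M : pre_model.
Notation clt m := (@clt_fun _ _ f delta K L m).
Variable m : nat.
Hypothesis mL : (m < L)%N.
Notation gam := (gaussP (nu f delta m.+1)).

Let clt_lin a phi psi : clt m phi -> clt m psi -> clt m (fun x => a * phi x + psi x).
Proof. exact: clt_fun_lin. Qed.

Let cltZ a phi : clt m phi -> clt m (fun x => a * phi x).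
Proof.
move=> hp; rewrite (_ : (fun x => _) = fun x => a * phi x + 0); last first.
  by apply/funext => x; rewrite addr0.
by apply: (clt_lin a hp); exact: clt_fun_cst.
Qed.

Let clt_cubic t : clt m (cubic t).
Proof. by apply: clt_test_fun (test_fun_cubic t) => //; rewrite mulr_ge0// addr_ge0. Qed.

Let clt_smooth_step h t : clt m (smooth_step h t).
Proof.
rewrite /smooth_step; apply: cltZ.
rewrite (_ : (fun x => _) = fun x => 1 * cubic t x + (- 3 * cubic (t + h) x +
  (3 * cubic (t + 2 * h) x + - 1 * cubic (t + 3 * h) x))); last first.
  by apply/funext => x; rewrite mul1r.
by do 3 (apply: clt_lin; first exact: clt_cubic); apply: cltZ; exact: clt_cubic.
Qed.

Let clt_stair h T n k : clt m (stair h T n k).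
Proof.
rewrite /stair; case: k => [|k]; first exact: clt_fun_cst.
by case: (k <= n)%N; [exact: clt_smooth_step|exact: clt_fun_cst].
Qed.

Let clt_hat h T n k : clt m (@hat R h T n k).
Proof.
rewrite (_ : @hat R h T n k = fun x => - 1 * stair h T n k.+1 x + stair h T n k x).
  by apply: clt_lin.
by apply/funext => x; rewrite /hat mulN1r addrC.
Qed.

Let continuous_smooth_step h t : continuous (@smooth_step R h t).
Proof.
have c s : continuous (@cubic R s) by have [[]] := test_fun_cubic s.
move=> x; apply: cvgMl_tmp; apply: cvgD; first exact: c.
apply: cvgD; first by apply: cvgMl_tmp; exact: c.
by apply: cvgD; apply: cvgMl_tmp; exact: c.
Qed.

Let continuous_hat h T n k : continuous (@hat R h T n k).
Proof.
have c i : continuous (stair h T n i).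
  rewrite /stair; case: i => [|i]; first by move=> x; exact: cvg_cst.
  by case: (i <= n)%N => x; [exact: continuous_smooth_step|exact: cvg_cst].
by move=> x; apply: cvgB; exact: c.
Qed.

Lemma vanishing_mismatch (e : R) : 0 < e ->
  exists N (phi : 'I_N -> R -> R) (tail : pred 'I_N),
  [/\ forall k, measurable_fun setT (phi k), forall k x, 0 <= phi k x,
      forall x, \sum_k phi k x = 1,
      forall k x y, ~~ tail k -> phi k x != 0 -> phi k y != 0 -> `|x - y| <= e &
  exists2 eta, 0 < eta & forall M, P2_holds f M -> rate M <= eta ->
    forall j b, b \in dpart (@mvtx _ _ _ _ _ M) j ->
    mismatch (mmu M) gam phi (fun x k => CE (mmu M)
      (~: leaf (@mvtx _ _ _ _ _ M) m.+1 j b)%SET (fun z => phi k (vf f m.+1 j b z)) x) tail <= e].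
Proof.
move=> e0; have n0 := nu0 m; set v := nu f delta m.+1 in n0 *.
pose h := e / 4; have h0 : 0 < h by rewrite divr_gt0.
(* Makes the tail bound [v / A ^+ 2] at most [e / 2], since [A] is at least 1 and at least
   [2 * v / e]. *)
pose A := 1 + 2 * v / e.
have v2 : 0 <= 2 * v by rewrite mulr_ge0// ltW.
have A1 : 1 <= A by rewrite lerDl divr_ge0// ltW.
have A0 : 0 < A := lt_le_trans ltr01 A1.
pose T := A + 3 * h.
pose n := (Num.truncn ((2 * A + 3 * h) / h)).+1.
have hn : 2 * A + 3 * h <= n%:R * h.
  by rewrite -ler_pdivrMr// ltW// real_truncnS_gt// num_real.
have hv : v / A ^+ 2 <= e / 2.
  rewrite ler_pdivrMr ?exprn_gt0// (@le_trans _ _ (e / 2 * A))//.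
    by rewrite /A mulrDr mulr1 -lerBlDl (_ : e / 2 * (2 * v / e) = v) ?lerBlDl ?lerDr ?divr_ge0 ?ltW//; field; rewrite gt_eqF.
  by rewrite ler_wpM2l ?divr_ge0 ?(ltW e0)// expr2 ler_peMr// ltW.
have hk (k : 'I_n.+2) := clt_hat h T k.
have hp (k : 'I_n.+2) : pg (@Wr R) (hat h T k) by have [] := hk k.
have hC (k : 'I_n.+2) : {C | 0 <= C & forall M, P2_holds f M -> forall j b, b \in dpart (@mvtx _ _ _ _ _ M) j ->
    EE (mmu M) (fun x => `|CE (mmu M) (~: leaf (@mvtx _ _ _ _ _ M) m.+1 j b)%SET
      (fun z => hat h T k (vf f m.+1 j b z)) x - heat v (hat h T k) 0|) <= C * rate M}.
  by apply: cid2; have [] := hk k.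
pose Ck k := s2val (hC k).
have Ck0 k : 0 <= Ck k by rewrite /Ck; case: (hC k).
pose C := \sum_k Ck k.
have C0 : 0 <= C by exact: sumr_ge0.
exists n.+2, (fun k : 'I_n.+2 => hat h T k), (@is_tail n); split.
- by move=> k; have [] := hp k.
- by move=> k x; exact: hat_ge0.
- by move=> x; exact: hat_sum.
- move=> k x y nt px py; have := hat_close h0 nt px py; rewrite /h mulrC divfK//.
have hW := gaussP_weight n0.
(* [C] sums the constants of the finitely many cells; their total deviation is then at most [e / 4],
   and it counts twice in [mismatch]. *)
exists (e / (4 * (1 + C))); first by rewrite divr_gt0// mulr_gt0// ltr_pwDl.
move=> M hP rM j b bj; rewrite /mismatch.
have tl : \sum_(k : 'I_n.+2 | is_tail k) pmass gam (fun k : 'I_n.+2 => hat h T k) k <= e / 2.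
  apply: (le_trans _ hv); rewrite /pmass -(E_sum hW); last by move=> k _; exact: hp.
  rewrite -[X in X / _](E_gaussP_sqr n0) -(E_Zr hW); last by apply: pgX; exact: pg_id.
  apply: (E_le hW); first by apply: (pg_sum hW) => k _; exact: hp.
    by apply: pgZr; apply: pgX; exact: pg_id.
  by move=> x; exact: hat_tail.
have pm (k : 'I_n.+2) : pmass gam (fun k : 'I_n.+2 => hat h T k) k = heat v (hat h T k) 0.
  rewrite /pmass E_gaussP_scale//; first by apply: E_ext => t; rewrite add0r.
  by move=> x; exact: hat_ge0.
have bd : \sum_k EE (mmu M) (fun w => `|CE (mmu M) (~: leaf (@mvtx _ _ _ _ _ M) m.+1 j b)%SET
   (fun z => hat h T k (vf f m.+1 j b z)) w - pmass gam (fun k : 'I_n.+2 => hat h T k) k|) <= C * rate M.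
  rewrite /C mulr_suml; apply: ler_sum => k _.
  rewrite pm /Ck; case: (hC k) => Ck' _ /= hCk; exact: hCk.
have cr : C * rate M <= e / 4.
  apply: (@le_trans _ _ ((1 + C) * (e / (4 * (1 + C))))).
    by apply: ler_pM => //; [rewrite ltW// rate_gt0|rewrite lerDr].
  have C1 : 1 + C != 0 by rewrite gt_eqF// ltr_pwDl.
  rewrite [leLHS](_ : _ = e / 4)//; move: (1 + C) C1 => c c0; by field.
lra.
Qed.

End VanishingMismatch.

Section MessageCoupling.
Context (R : realType) d (Om : measurableType d) (P : probability Om R) (gam : probability R R).

Definition is_coupling (G : set (set Om)) (Q : probability (Om * R)%type R) :=
  [/\ forall S, measurable S -> Q (fst @^-1` S) = P S,
      forall A, measurable A -> Q (snd @^-1` A) = gam A &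
      forall S A, G S -> measurable A -> Q (snd @^-1` A `&` fst @^-1` S) = (gam A * P S)%E].

(** The independent coupling is close to nothing, but guarantees an admissible choice for every
    hypergraph, whatever its degree. *)
Lemma product_is_coupling (G : set (set Om)) : (forall S, G S -> measurable S) ->
  exists Q, is_coupling G Q.
Proof.
move=> mG; exists (P \x gam)%E.
have rect S A : measurable S -> measurable A -> (P \x gam)%E (S `*` A) = (P S * gam A)%E.
  by move=> mS mA; rewrite product_measure1E.
split => [S mS|A mA|S A GS mA].
- rewrite (_ : _ @^-1` _ = S `*` setT); last by apply/seteqP; split => -[w x] //= [].
  apply: etrans (rect _ _ mS measurableT) _; by rewrite [X in (_ * X)%E](@probability_setT _ _ _ gam) mule1.
- rewrite (_ : _ @^-1` _ = setT `*` A); last by apply/seteqP; split => -[w x] //= [].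
  apply: etrans (rect _ _ measurableT mA) _; by rewrite [X in (X * _)%E](@probability_setT _ _ _ P) mul1e.
- rewrite (_ : _ `&` _ = S `*` A); last by apply/seteqP; split => -[w x] //= [].
  by apply: etrans (rect _ _ (mG _ GS) mA) _; rewrite muleC.
Qed.

Variables (V : finType) (mu : probability (cfg R V) R) (Zc : Om -> cfg R V).
Hypothesis mZ : measurable_fun setT Zc.
Hypothesis lawZ : forall A, measurable A -> P (Zc @^-1` A) = mu A.

Lemma EE_image (g : cfg R V -> R) : measurable_fun setT g -> (forall z, 0 <= g z) ->
  EE P (fun w => g (Zc w)) = EE mu g.
Proof.
move=> mg g0; rewrite /EE /Rintegral; congr fine.
rewrite (ge0_integral_image (m1 := P) mZ (m2 := mu) (g := fun z => (g z)%:E))//.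
exact/measurable_EFinP.
Qed.

Definition pulled_events (B : {set V}) : set (set Om) := [set S |
  exists2 S' : set (cfg R V), measurable S' /\ depends B (fun z : cfg R V => S' z) & S = Zc @^-1` S'].

Lemma gen_sigma_pulled (O : Type) (Z : V -> O -> R) (g : O -> Om) B S :
  (forall k w, Z k w = Zc (g w) k) -> gen_sigma Z B S ->
  exists2 S0, pulled_events B S0 & S = g @^-1` S0.
Proof.
move=> eZ; pose H : set (set O) := [set S | exists2 S0, pulled_events B S0 & S = g @^-1` S0].
suff : gen_sigma Z B `<=` H by move=> /[apply].
apply: smallest_sub.
  split.
  - exists set0; last by rewrite preimage_set0.
    by exists set0; [split|rewrite preimage_set0].
  - move=> A [S0 [S' [mS' dS'] ->] ->]; exists (Zc @^-1` (~` S')); last by rewrite setTD.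
    exists (~` S'); last by []. split; first exact: measurableC.
    by move=> z z' zz'; rewrite /setC /= (dS' _ _ zz').
  - move=> A hA; pose A0 n := s2val (cid2 (hA n)).
    have hA0 n : pulled_events B (A0 n) by rewrite /A0; case: cid2.
    have eA n : A n = g @^-1` A0 n by rewrite /A0; case: cid2.
    pose A1 n := s2val (cid2 (hA0 n)).
    have hA1 n : measurable (A1 n) /\ depends B (fun z => A1 n z) by rewrite /A1; case: cid2.
    have eA1 n : A0 n = Zc @^-1` A1 n by rewrite /A1; case: cid2.
    exists (Zc @^-1` \bigcup_n A1 n).
      exists (\bigcup_n A1 n) => //; split; first by apply: bigcup_measurable => n _; case: (hA1 n).
      move=> z z' zz'; apply/propext; split => -[n _ h]; exists n => //.
        by have [_ /(_ _ _ zz') <-] := hA1 n.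
      by have [_ /(_ _ _ zz') ->] := hA1 n.
    rewrite !preimage_bigcup; apply: eq_bigcupr => n _; by rewrite eA eA1.
move=> S' hS'; have : exists2 j, j \in B & preimage_set_system setT (Z j) measurable S'.
  move: S' hS'; elim/big_rec: _ => // j X jB ih S' [h|/ih//]; by exists j.
move=> [j jB [A mA <-]]; exists (Zc @^-1` [set z | A (z j)]); last first.
  by rewrite setTI; apply/seteqP; split => w /=; rewrite eZ.
exists [set z | A (z j)] => //; split; last by move=> z z' zz'; rewrite /= zz'.
by have := @measurable_coord R V j measurableT A mA; rewrite setTI.
Qed.

Lemma pulled_eventsW (B B' : {set V}) : B \subset B' -> pulled_events B `<=` pulled_events B'.
Proof. by move=> BB' S [S' [mS' dS'] eS]; exists S' => //; split => //; exact: dependsW dS'. Qed.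

Lemma measurable_pulled_events B S : pulled_events B S -> measurable S.
Proof. by move=> [S' [mS' _] ->]; rewrite -[X in measurable X]setTI; exact: mZ. Qed.

End MessageCoupling.

Section CloseCoupling.
Context (R : realType) (r : nat) (f : {ffun 'I_r -> bool} -> bool) (delta K : R) (L : nat).
Hypothesis f1 : forall S : {set 'I_r}, #|S| = 1%N -> fhat R f S = 0.
Hypothesis delta0 : 0 < delta.
Hypothesis K0 : 0 < K.
Hypothesis r0 : (0 < r)%N.
Hypothesis nu0 : forall m, 0 < nu f delta m.+1.
Notation pre_model := (pre_model r delta K L).
Implicit Type M : pre_model.
Notation vtx M := (@mvtx _ _ _ _ _ M).
Notation gam m := (gaussP (nu f delta m.+1)).
Notation outer M m j b := (~: leaf (vtx M) m.+1 j b)%SET.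

Lemma close_coupling m (e : R) : (m < L)%N -> 0 < e ->
  exists2 eta, 0 < eta & forall M, P2_holds f M -> rate M <= eta ->
  forall j b, b \in dpart (vtx M) j ->
  forall d (Om : measurableType d) (P : probability Om R) (Zc : Om -> cfg R (mV M)),
  measurable_fun setT Zc -> (forall A, measurable A -> P (Zc @^-1` A) = mmu M A) ->
  exists2 Q, is_coupling P (gam m) (pulled_events Zc (outer M m j b)) Q &
    (Q [set z : Om * R | (e < `|vf f m.+1 j b (Zc z.1) - z.2|)%R] <= e%:E)%E.
Proof.
move=> mL e0; have [N [phi [tail [mphi phi0 phi1 phic [eta eta0 h]]]]] :=
  vanishing_mismatch f1 delta0 K0 r0 nu0 mL e0.
exists eta => // M hP rM j b bj d Om P Zc mZ lawZ.
have {h} := h M hP rM j b bj; set B := outer M m j b.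
have hg := hgam delta0; have hW := hW delta0 M; have hr := @mrect _ _ _ _ _ M.
have [_ pu _ _ [_ du _]] := @node_facts _ _ _ _ _ _ f1 delta0 K0 M m.+1 mL j b.
have phi_le1 k x : phi k x <= 1 by rewrite -(phi1 x) (bigD1 k)//= lerDl sumr_ge0.
have pphi k : pg (@Wr R) (phi k) by apply: (pg_bounded _ (C := 1)) => // x; rewrite ger0_norm.
have pphiu k : pg (@Wc R (mV M)) (fun z => phi k (vf f m.+1 j b z)) by exact: (pg_comp hg hr).
pose qz (z : cfg R (mV M)) k := CE (mmu M) B (fun z => phi k (vf f m.+1 j b z)) z.
have pqz k : pg (@Wc R (mV M)) (fun z => qz z k) by exact: (pg_CE hg hr).
have qz0 z k : 0 <= qz z k by exact: CE_ge0.
have qz1 z : \sum_k qz z k = 1.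
  rewrite /qz -(CE_sum hg hr)//; rewrite (_ : (fun x => _) = fun=> 1); last by apply/funext => x; exact: phi1.
  by rewrite /CE E_cst.
pose p := pmass (gam m) phi.
have hg1 := gaussP_weight (nu0 m).
have p0 k : 0 <= p k by exact: E_ge0.
have p1 : \sum_k p k = 1.
  by rewrite -(E_sum hg1)// -[RHS](E_cst (gam m)); apply: E_ext => x; exact: phi1.
pose cz k k' (z : cfg R (mV M)) := crow p (qz z) k k'.
have mcz k k' : measurable_fun setT (cz k k') by apply: measurable_crow => // i; case: (pqz i).
have cz0 k k' z : 0 <= cz k k' z by exact: crow_ge0.
have pcz k k' : pg (@Wc R (mV M)) (cz k k').
  by apply: (pg_bounded _ (C := 1)) => // z; rewrite ger0_norm//; exact: crow_le1.
have dqz k : depends B (fun z => qz z k).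
  have dp : depends (tree (vtx M) m.+2 j b) (fun z => phi k (vf f m.+1 j b z)).
    exact: (depends1 (phi k) du).
  by apply: dependsW (CE_depends (mmu M) dp); exact: finset.subsetIr.
have dcz k k' : depends B (cz k k').
  move=> z z' zz'; have eqz : qz z = qz z' by apply/funext => i; exact: dqz.
  exact: (congr1 (fun q => crow p q k k') eqz).
(* The indicator of [S] and the transition matrix read only [B], so both leave the conditional
   expectation, which acts on [phi k] of the message alone. *)
have G_cond S : pulled_events Zc B S -> measurable S /\ forall k k',
    EE P (fun w => \1_S w * (phi k (vf f m.+1 j b (Zc w)) * crow p (qz (Zc w)) k k')) =
    EE P (fun w => \1_S w * (qz (Zc w) k * crow p (qz (Zc w)) k k')).
  move=> GS; split; first exact: measurable_pulled_events mZ _ _ GS.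
  case: GS => S' [mS' dSP] -> k k'.
  have dS' : depends B (\1_S' : cfg R (mV M) -> R).
    move=> z z' /dSP ezz; rewrite !indicE; congr (_%:R : R); congr nat_of_bool.
    by apply/idP/idP => /set_mem h; apply/mem_set; [rewrite -ezz|rewrite ezz].
  have mi : measurable_fun setT (\1_S' : cfg R (mV M) -> R) by exact: measurable_indic.
  rewrite (EE_image mZ lawZ (g := fun z => \1_S' z * (phi k (vf f m.+1 j b z) * cz k k' z)))//; last 2 first.
  - by apply: measurable_funM => //; apply: measurable_funM => //; case: (pphiu k).
  - by move=> z; rewrite !mulr_ge0.
  rewrite (EE_image mZ lawZ (g := fun z => \1_S' z * (qz z k * cz k k' z)))//; last 2 first.
  - by apply: measurable_funM => //; apply: measurable_funM => //; case: (pqz k).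
  - by move=> z; rewrite !mulr_ge0.
  have pS : pg (@Wc R (mV M)) (\1_S' : cfg R (mV M) -> R).
    by apply: (pg_bounded _ (C := 1)) => // z; rewrite indicE normr_nat lern1 leq_b1.
  rewrite -(E_CE hg hr B (pgM pS (pgM (pphiu k) (pcz k k')))); apply: E_ext => z.
  transitivity (CE (mmu M) B (fun z => (\1_S' z * cz k k' z) * phi k (vf f m.+1 j b z)) z).
    by congr CE; apply/funext => y; rewrite [X in _ * X]mulrC mulrA.
  have dS : depends B (fun z => \1_S' z * cz k k' z : R).
    exact: (depends2 (fun a b : R => a * b)) dS' (dcz k k').
  apply: etrans (CE_mull hg hr z (pphiu k) dS) _.
  by rewrite -/(qz z k) -mulrA [X in _ * X]mulrC.
have mu_ : measurable_fun setT (fun w => vf f m.+1 j b (Zc w)).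
  by apply: measurableT_comp mZ; case: pu.
have mq k : measurable_fun setT (fun w => qz (Zc w) k).
  by apply: (measurableT_comp (f := fun z => qz z k)) mZ; case: (pqz k).
have GT : pulled_events Zc B setT.
  by exists setT.
have [Q [h1 h2 h3 h4]] := coupling_exists mu_ mphi phi0 phi1 mq (fun w k => qz0 (Zc w) k)
  (fun w => qz1 (Zc w)) GT G_cond tail.
move=> hm; exists Q => //; apply: le_trans (h4 e phic) _; rewrite lee_fin.
apply: le_trans hm; rewrite /mismatch lerD2l ler_wpM2l//; apply: ler_sum => k _.
rewrite (EE_image mZ lawZ (g := fun z => `|qz z k - p k|))//.
by apply: measurableT_comp => //; apply: measurable_funB => //; case: (pqz k).
Qed.

End CloseCoupling.

(** * The limit *)

(* If for every [j] some valid coupling is [1/(j+1)]-good, one coupling achieves this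
   for the largest attainable [j] below any bound, hence for all smaller ones. *)
Lemma best_coupling (R : realType) (T : Type) (valid : T -> Prop) (far : T -> R -> \bar R) :
  (forall Q e e', e <= e' -> (far Q e' <= far Q e)%E) -> (exists Q, valid Q) ->
  forall k, exists2 Q, valid Q & forall j, (j < k)%N ->
    (exists2 Q', valid Q' & (far Q' (j.+1%:R^-1)%R <= (j.+1%:R^-1)%:E)%E) ->
    (far Q (j.+1%:R^-1)%R <= (j.+1%:R^-1)%:E)%E.
Proof.
move=> fh [Q0 v0]; elim => [|k [Q vQ ih]]; first by exists Q0.
have [[Q' v' h']|ng] := pselect (exists2 Q', valid Q' & (far Q' (k.+1%:R^-1)%R <= (k.+1%:R^-1)%:E)%E).
  exists Q' => // j jk _.
  have le : (k.+1%:R^-1 : R) <= j.+1%:R^-1 by rewrite lef_pV2 ?posrE// ler_nat.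
  by apply: le_trans (fh _ _ _ le) _; apply: le_trans h' _; rewrite lee_fin.
exists Q => // j; rewrite ltnS leq_eqVlt => /predU1P[->|jk] h; first by case: ng.
exact: ih.
Qed.

Section ConditionalLimit.
Context (R : realType) (dO : nat -> measure_display) (O : forall n, measurableType (dO n)).
Variables (Q : forall n, probability (O n) R) (D : forall n, O n -> R).
Hypothesis mD : forall n, measurable_fun setT (@D n).
Hypothesis moments : forall k, exists C, forall n,
  (\int[Q n]_w (D w ^+ k.*2)%:E <= C%:E)%E.
Hypothesis close : forall j, exists N, forall n, (N <= n)%N ->
  (Q n [set w | (j.+1%:R^-1 < `|D w|)%R] <= (j.+1%:R^-1)%:E)%E.

(** Below [t] the power is small; between [t] and [T] it is bounded on a rare event; beyond [T] it
    is dominated by a high even moment, with the spare factor [x / T >= 1]. *)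
Lemma powR_three_terms (p t T x : R) : 0 < p -> 0 < t -> 1 <= T -> 0 <= x ->
  x `^ p <= t `^ p + T `^ p * (t < x)%R%:R + T^-1 * x ^+ (Num.truncn p).+1.*2.
Proof.
move=> p0 t0 T1 x0; have T0 : 0 < T by apply: lt_le_trans T1.
have a0 := powR_ge0 t p; have b0 := powR_ge0 T p.
have c0 : 0 <= T^-1 * x ^+ (Num.truncn p).+1.*2 by rewrite mulr_ge0 ?invr_ge0 ?(ltW T0) ?exprn_ge0.
case: (leP x t) => xt.
  have : x `^ p <= t `^ p by apply: ge0_ler_powR => //; rewrite ?nnegrE ?(ltW t0) ?(ltW p0).
  by move=> /le_trans; apply; rewrite mulr0 addr0 lerDl.
rewrite mulr1; case: (leP x T) => xT.
  have : x `^ p <= T `^ p by apply: ge0_ler_powR => //; rewrite ?nnegrE ?(ltW T0) ?(ltW p0).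
  by move=> /le_trans; apply; rewrite -[leLHS]addr0 lerD// lerDr.
rewrite -[leLHS]add0r; apply: lerD; first exact: addr_ge0.
have x1 : 1 <= x by apply: le_trans T1 (ltW xT).
apply: (@le_trans _ _ (x ^+ (Num.truncn p).*2.+1)).
  rewrite -powR_mulrn//; apply: ler_powR => //.
  apply: (@le_trans _ _ (Num.truncn p).+1%:R); first by rewrite ltW// real_truncnS_gt// num_real.
  by rewrite ler_nat ltnS -addnn leq_addr.
rewrite doubleS [in leRHS]exprS mulrA ler_peMl ?exprn_ge0//.
by rewrite mulrC ler_pdivlMr// mul1r ltW.
Qed.

Lemma moment_vanishes (p eta : R) : 0 < p -> 0 < eta -> exists N, forall n, (N <= n)%N ->
  (\int[Q n]_w (`|D w| `^ p)%:E <= eta%:E)%E.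
Proof.
move=> p0 eta0; set q := (Num.truncn p).+1.
have [C0 hC0] := moments q; pose C := `|C0|.
(* [T] is fixed first, from the moment bound, so that the last term is at most [eta / 3]. *)
pose T := 1 + 3 * C / eta.
have T1 : 1 <= T by rewrite lerDl divr_ge0 ?mulr_ge0 ?(ltW eta0)// /C.
have T0 : 0 < T by apply: lt_le_trans T1.
have CT : C / T <= eta / 3.
  rewrite ler_pdivrMr// /T mulrDr mulr1 (_ : eta / 3 * (3 * C / eta) = C).
    by rewrite lerDr divr_ge0// ltW.
  by field; rewrite gt_eqF.
have Tp0 : 0 <= T `^ p by exact: powR_ge0.
pose s := (eta / 3) `^ p^-1; have s0 : 0 < s by rewrite powR_gt0// divr_gt0.
have sp : s `^ p = eta / 3 by rewrite /s -powRrM mulVf ?gt_eqF// powRr1// divr_ge0// ltW.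
(* With [T] known, [t = 1 / (j + 1)] is small enough for the first two terms to be at most [eta / 3]
   each. *)
pose j := Num.truncn (s^-1 + 3 * T `^ p / eta).
have jb : s^-1 + 3 * T `^ p / eta <= j.+1%:R by rewrite ltW// real_truncnS_gt// num_real.
have c0 : 0 <= 3 * T `^ p / eta by rewrite divr_ge0 ?mulr_ge0// ltW.
have si0 : 0 < s^-1 by rewrite invr_gt0.
set t : R := j.+1%:R^-1; have t0 : 0 < t by rewrite invr_gt0.
have ts : t <= s by rewrite -[s]invrK lef_pV2 ?posrE//; lra.
have tp : t `^ p <= eta / 3.
  by rewrite -sp; apply: ge0_ler_powR; rewrite ?nnegrE ?(ltW p0) ?(ltW t0) ?(ltW s0).
have Tt : T `^ p * t <= eta / 3.
  rewrite ler_pdivrMr// (_ : eta / 3 * j.+1%:R = eta * (j.+1%:R / 3)); last by field.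
  have h : 3 * T `^ p / eta <= j.+1%:R by lra.
  by move: h; rewrite ler_pdivrMr//; lra.
have [N hN] := close j; exists N => n Nn; have {}hN := hN n Nn.
have mE : measurable [set w : O n | t < `|D w|].
  have : measurable_fun setT (fun w : O n => t < `|D w|).
    by apply: measurable_fun_ltr => //; exact: measurableT_comp.
  have mt1 : measurable [set true] by [].
  by move=> /(_ measurableT _ mt1); rewrite setTI preimage_true.
have mI : measurable_fun setT (\1_[set w | t < `|D w|] : O n -> R) by exact: measurable_indic.
have mq : measurable_fun setT (fun w : O n => (D w ^+ q.*2)%:E).
  by apply/measurable_EFinP; exact: measurable_funX.
have ev (w : O n) : `|D w| ^+ q.*2 = D w ^+ q.*2.
  by rewrite -muln2 mulnC !exprM real_normK// num_real.
have q0 (w : O n) : 0 <= D w ^+ q.*2 by rewrite -ev exprn_ge0.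
apply: (@le_trans _ _ (\int[Q n]_w ((t `^ p)%:E + ((T `^ p)%:E * (\1_[set w | t < `|D w|] w)%:E +
    (T^-1)%:E * (D w ^+ q.*2)%:E)))%E).
  apply: ge0_le_integral => //.
  - apply/measurable_EFinP; apply: (measurableT_comp (measurable_powR p)).
    exact: measurableT_comp.
  - apply: emeasurable_funD => //; apply: emeasurable_funD.
      by apply: measurable_funeM; exact/measurable_EFinP.
    exact: measurable_funeM.
  - move=> w _; rewrite -!EFinM -!EFinD lee_fin addrA.
    by have := powR_three_terms p0 t0 T1 (normr_ge0 (D w)); rewrite ev indicE mem_setE.
rewrite ge0_integralD//; last 3 first.
- by move=> w _; rewrite lee_fin powR_ge0.
- move=> w _; rewrite -!EFinM -EFinD lee_fin; apply: addr_ge0; apply: mulr_ge0 => //.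
  by rewrite invr_ge0 ltW.
- apply: emeasurable_funD; last exact: measurable_funeM.
  by apply: measurable_funeM; exact/measurable_EFinP.
rewrite integral_cst// [X in (_ * X)%E](@probability_setT _ _ _ (Q n)) mule1 ge0_integralD//; last 4 first.
- by move=> w _; rewrite -EFinM lee_fin mulr_ge0.
- by apply: measurable_funeM; exact/measurable_EFinP.
- by move=> w _; rewrite -EFinM lee_fin mulr_ge0 ?invr_ge0 ?(ltW T0).
- exact: measurable_funeM.
rewrite ge0_integralZl//; last exact/measurable_EFinP.
rewrite ge0_integralZl//; last 2 first.
- by move=> w _; rewrite lee_fin.
- by rewrite lee_fin invr_ge0 ltW.
rewrite integral_indic// setIT.
apply: (@le_trans _ _ ((t `^ p)%:E + ((T `^ p)%:E * t%:E + (T^-1)%:E * C%:E))%E).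
  apply: leeD => //; apply: leeD; first by apply: lee_wpmul2l; rewrite ?lee_fin.
  apply: lee_wpmul2l; first by rewrite lee_fin invr_ge0 ltW.
  by apply: le_trans (hC0 n) _; rewrite lee_fin ler_norm.
by rewrite -!EFinM -!EFinD lee_fin [_^-1 * C]mulrC; lra.
Qed.

(** Markov's inequality: over the whole space, any version [Y] of the conditional expectation has
    the integral of the [p]-th power itself. *)
Lemma cond_exp_vanishes (G : forall n, set (set (O n))) (p : R) (Y : forall n, O n -> \bar R) :
  0 < p -> (forall n, G n setT) -> (forall n S, G n S -> measurable S) ->
  (forall n, cond_exp_version (Q n) (G n) (fun w => (`|D w| `^ p)%:E) (Y n)) ->
  forall eps : R, 0 < eps -> (fun n => fine (Q n [set w | (eps%:E < Y n w)%E])) @ \oo --> (0 : R).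
Proof.
move=> p0 GT mG hY eps eps0; apply/cvgrPdist_le => e e0.
have [N hN] := moment_vanishes p0 (mulr_gt0 eps0 e0).
exists N => // n /= /hN {}hN; have [Y0 [mY hS]] := hY n.
have mYn : measurable_fun setT (Y n).
  by move=> _ B mB; rewrite setTI; apply: mG; exact: mY.
have iY := hS _ (GT n); rewrite -iY in hN.
have mE : measurable [set w | (eps%:E < Y n w)%E].
  have := emeasurable_fun_o_infty measurableT mYn eps%:E.
  by rewrite setTI.
have hm : (eps%:E * Q n [set w | (eps%:E < Y n w)%E] <= (eps * e)%:E)%E.
  apply: le_trans hN; rewrite -(integral_cst _ mE).
  apply: (@le_trans _ _ (\int[Q n]_(w in [set w | (eps%:E < Y n w)%E]) Y n w)%E).
    apply: ge0_le_integral => //; first by move=> w _; rewrite lee_fin ltW.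
      exact: measurable_funTS.
    by move=> w /ltW.
  by apply: ge0_subset_integral.
have fQ := fin_num_measure (Q n) _ mE.
rewrite -(fineK fQ) -EFinM lee_fin ler_pM2l// in hm.
by rewrite sub0r normrN ger0_norm// fine_ge0.
Qed.

End ConditionalLimit.

Lemma image_probability_exists (R : realType) d1 d2 (T1 : measurableType d1)
    (T2 : measurableType d2) (P : probability T1 R) (phi : T1 -> T2) :
  measurable_fun setT phi ->
  exists mu : probability T2 R, forall A, mu A = P (phi @^-1` A).
Proof.
move=> mphi; pose m := image_measure P mphi.
have mT : m setT = 1%E by exact: (@probability_setT _ _ _ P).
pose mu : probability T2 R :=
  HB.pack (m : set T2 -> \bar R) (Measure.class m) (Measure_isProbability.Build _ _ _ m mT).
by exists mu.
Qed.

Lemma coupling_even_moment (R : realType) d (Om : measurableType d) (P : probability Om R)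
    (gam : probability R R) G Q (u : Om -> R) k (A B : R) :
  is_coupling P gam G Q -> measurable_fun setT u ->
  (\int[P]_w (u w ^+ k.*2)%:E <= A%:E)%E -> (\int[gam]_x (x ^+ k.*2)%:E <= B%:E)%E ->
  (\int[Q]_z ((u z.1 - z.2) ^+ k.*2)%:E <= (2 ^+ k.*2 * (A + B))%:E)%E.
Proof.
move=> [h1 h2 _] mu hA hB.
have ev (x : R) : 0 <= x ^+ k.*2 by rewrite -mul2n exprM exprn_ge0// sqr_ge0.
have m1 : measurable_fun setT (fun w => (u w ^+ k.*2)%:E).
  by apply/measurable_EFinP; exact: measurable_funX.
have m2 : measurable_fun setT (fun x : R => (x ^+ k.*2)%:E).
  by apply/measurable_EFinP; exact: measurable_funX.
have q1 : measurable_fun setT (fun z : Om * R => (u z.1 ^+ k.*2)%:E).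
  exact: (measurableT_comp m1 measurable_fst).
have q2 : measurable_fun setT (fun z : Om * R => (z.2 ^+ k.*2)%:E).
  exact: (measurableT_comp m2 measurable_snd).
have mu1 : measurable_fun setT (fun z : Om * R => u z.1).
  exact: (measurableT_comp mu measurable_fst).
apply: (@le_trans _ _ (\int[Q]_z ((2 ^+ k.*2)%:E * ((u z.1 ^+ k.*2)%:E + (z.2 ^+ k.*2)%:E)))%E).
  apply: ge0_le_integral => //.
  - by move=> z _; rewrite lee_fin.
  - apply/measurable_EFinP; apply: measurable_funX; apply: measurable_funB => //.
  - by apply: measurable_funeM; exact: emeasurable_funD.
  - by move=> z _; rewrite -EFinD -EFinM lee_fin; exact: exprB_even_le.
rewrite ge0_integralZl//; last 2 first.
- exact: emeasurable_funD.
- by move=> z _; rewrite -EFinD lee_fin addr_ge0.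
rewrite EFinM; apply: lee_wpmul2l; first by rewrite lee_fin exprn_ge0.
rewrite ge0_integralD//; last 2 first.
- by move=> z _; rewrite lee_fin.
- by move=> z _; rewrite lee_fin.
rewrite EFinD; apply: leeD.
  rewrite -(ge0_integral_image (m1 := Q) measurable_fst (m2 := P) (g := fun w => (u w ^+ k.*2)%:E))//.
  by move=> w; rewrite lee_fin.
rewrite -(ge0_integral_image (m1 := Q) measurable_snd (m2 := gam) (g := fun x => (x ^+ k.*2)%:E))//.
Qed.

Section CouplingSequence.
Context (R : realType) (r : nat) (f : {ffun 'I_r -> bool} -> bool) (delta K : R) (L : nat).
Hypothesis f1 : forall S : {set 'I_r}, #|S| = 1%N -> fhat R f S = 0.
Hypothesis delta0 : 0 < delta.
Hypothesis K0 : 0 < K.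
Hypothesis r0 : (0 < r)%N.
Hypothesis nu0 : forall m, 0 < nu f delta m.+1.
Variable M : nat -> pre_model r delta K L.
Notation vtx n := (@mvtx _ _ _ _ _ (M n)).
Variables (j : forall n, mV (M n)) (b : forall n, mE (M n)).
Hypothesis bj : forall n, b n \in dpart (vtx n) (j n).
Hypothesis P2 : forall n, P2_holds f (M n).
Hypothesis degree : forall D, exists N, forall n, (N <= n)%N -> (D <= md (M n))%N.
Context (dO : nat -> measure_display) (Om : forall n, measurableType (dO n)).
Variables (P : forall n, probability (Om n) R) (Zc : forall n, Om n -> cfg R (mV (M n))).
Hypothesis mZ : forall n, measurable_fun setT (@Zc n).
Hypothesis lawZ : forall n A, measurable A -> P n (@Zc n @^-1` A) = mmu (M n) A.
Variable m : nat.
Hypothesis mL : (m < L)%N.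
Notation gam := (gaussP (nu f delta m.+1)).
Notation G n := (pulled_events (@Zc n) (~: leaf (vtx n) m.+1 (j n) (b n))%SET).

Definition gap n (z : Om n * R) : R := vf f m.+1 (j n) (b n) (Zc z.1) - z.2.

Let rate_small eta : 0 < eta -> exists N, forall n, (N <= n)%N -> rate (M n) <= eta.
Proof.
move=> eta0; have [N hN] := degree (Num.truncn (eta ^+ 2)^-1).+1.
exists N => n /hN h; have d0 : 0 < (md (M n))%:R :> R by rewrite ltr0n; apply: leq_trans h.
rewrite /rate -[eta]invrK lef_pV2 ?posrE ?invr_gt0 ?sqrtr_gt0//.
rewrite -[leLHS]ger0_norm ?invr_ge0 ?(ltW eta0)// -sqrtr_sqr ler_sqrt// exprVn.
apply: (@le_trans _ _ (Num.truncn (eta ^+ 2)^-1).+1%:R); last by rewrite ler_nat.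
by rewrite ltW// real_truncnS_gt// num_real.
Qed.

Let mvfZ n : measurable_fun setT (fun w => vf f m.+1 (j n) (b n) (@Zc n w)).
Proof.
have [_ [mv _] _ _ _] := @node_facts _ _ _ _ _ _ f1 delta0 K0 (M n) m.+1 mL (j n) (b n).
exact: (measurableT_comp mv (@mZ n)).
Qed.

Lemma measurable_gap n : measurable_fun setT (@gap n).
Proof.
by apply: measurable_funB => //; exact: (measurableT_comp (@mvfZ n) measurable_fst).
Qed.

Lemma coupling_sequence : exists Q : forall n, probability (Om n * R)%type R,
  [/\ forall n, is_coupling (P n) gam (G n) (Q n),
      forall k, exists C, forall n, (\int[Q n]_z (gap z ^+ k.*2)%:E <= C%:E)%E &
      forall i, exists N, forall n, (N <= n)%N ->
        (Q n [set z | (i.+1%:R^-1 < `|gap z|)%R] <= (i.+1%:R^-1)%:E)%E].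
Proof.
pose far n (Q : probability (Om n * R)%type R) (e : R) := Q [set z | e < `|gap z|].
pose valid n Q := is_coupling (P n) gam (G n) Q.
have mfar n e : measurable [set z : Om n * R | e < `|gap z|].
  have : measurable_fun setT (fun z : Om n * R => e < `|gap z|).
    by apply: measurable_fun_ltr => //; apply: measurableT_comp => //; exact: measurable_gap.
  have mt1 : measurable [set true] by [].
  by move=> /(_ measurableT _ mt1); rewrite setTI preimage_true.
have far_le n (Q : probability (Om n * R)%type R) e e' : e <= e' -> (far n Q e' <= far n Q e)%E.
  move=> ee'; apply: le_measure; rewrite ?inE//; try exact: mfar.
  by move=> z /=; exact: le_lt_trans.
have ex_valid n : exists Q, valid n Q.
  by apply: product_is_coupling => S; exact: measurable_pulled_events.
(* The [n]-th coupling competes for the first [n + 1] tolerances only; a fixed tolerance [i] is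
   among them as soon as [n >= i]. *)
have best n := best_coupling (@far_le n) (ex_valid n) n.+1.
pose Q n := s2val (cid2 (best n)).
have vQ n : valid n (Q n) by rewrite /Q; case: cid2.
have bQ n k : (k < n.+1)%N ->
    (exists2 Q', valid n Q' & (far n Q' (k.+1%:R^-1)%R <= (k.+1%:R^-1)%:E)%E) ->
    (far n (Q n) (k.+1%:R^-1)%R <= (k.+1%:R^-1)%:E)%E by rewrite /Q; case: cid2 => ? _ /=; apply.
exists Q; split => //.
  move=> k; have [C [C0 hC]] := node_moments f1 delta0 K0 (f := f) mL.
  have hW1 := gaussP_weight (nu0 m).
  exists (2 ^+ k.*2 * (C k + EE gam (fun x => x ^+ k.*2))) => n.
  apply: (coupling_even_moment (vQ n) (@mvfZ n)).
    have [_ pv _ _ _] := @node_facts _ _ _ _ _ _ f1 delta0 K0 (M n) m.+1 mL (j n) (b n).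
    have pvk := pgX k.*2 pv.
    rewrite -(ge0_integral_image (m1 := P n) (@mZ n) (m2 := mmu (M n))
      (g := fun z => (vf f m.+1 (j n) (b n) z ^+ k.*2)%:E) (@lawZ n))//.
    - by rewrite (E_fin (hW delta0 (M n)) pvk) lee_fin; have [] := hC (M n) (j n) (b n) k.
    - by apply/measurable_EFinP; case: pvk.
    - by move=> z; rewrite lee_fin -mul2n exprM exprn_ge0// sqr_ge0.
  by rewrite (E_fin hW1 (pgX k.*2 (pg_id R))).
move=> i; have i0 : 0 < i.+1%:R^-1 :> R by rewrite invr_gt0.
have [eta eta0 heta] := close_coupling f1 delta0 K0 r0 nu0 mL i0.
have [N hN] := rate_small eta0; exists (maxn N i) => n; rewrite geq_max => /andP[Nn in_].
apply: bQ => //.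
have := heta (M n) (@P2 n) (hN n Nn) (j n) (b n) (bj n) _ _ (P n) _ (@mZ n) (@lawZ n).
by move=> [Q' v' h']; exists Q'.
Qed.

End CouplingSequence.

Theorem mainTheorem16
  (R : realType) (r : nat) (f : {ffun 'I_r -> bool} -> bool) (delta K : R) (l : nat)
  (V E : nat -> finType) (vtx : forall n, E n -> 'I_r -> V n) (deg : nat -> nat)
  (Fto Fv : nat -> nat -> seq R -> R)
  (i : forall n, V n) (a : forall n, E n)
  (dO : nat -> measure_display) (Om : forall n, measurableType (dO n))
  (P : forall n, probability (Om n) R) (Z : forall n, V n -> Om n -> R) :
  (2 <= r)%N ->
  (forall S : {set 'I_r}, #|S| = 1%N -> fhat R f S = 0) ->
  0 < delta -> 0 < K ->
  (* hypergraphs: d-index-regular, factor graph without cycles of length < 4L+4 *)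
  (forall n, index_regular (vtx n) (deg n)) ->
  (forall n, girth_ge (vtx n) (4 * Lof delta + 4)) ->
  (* d -> oo along the sequence *)
  (forall M : nat, exists N : nat, forall n, (N <= n)%N -> (M <= deg n)%N) ->
  (* nonlinearities F_{->,m}, F_m : R^m -> [-K,K], 0 <= m <= L-1 *)
  (forall n m, (m < Lof delta)%N -> forall t : m.-tuple R,
      `|Fto n m t| <= K /\ `|Fv n m t| <= K) ->
  (forall n m, (m < Lof delta)%N ->
      measurable_fun setT (fun t : m.-tuple R => Fto n m t) /\
      measurable_fun setT (fun t : m.-tuple R => Fv n m t)) ->
  (* z^0_j i.i.d. N(0, delta) *)
  (forall n, iid_gauss (P n) (Z n) delta) ->
  (* Property (P2) *)
  (forall n m, (m < Lof delta)%N -> forall (j : V n) (b : E n), b \in dpart (vtx n) j ->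
      (\int[P n]_w ((Avar f (vtx n) (deg n) (Fto n) (Fv n) (fun k => Z n k w) m j) ^+ 2)%:E
         = (delta / nu f delta m.+1)%:E)%E /\
      (\int[P n]_w ((Amsg f (vtx n) (deg n) (Fto n) (fun k => Z n k w) m j b) ^+ 2)%:E
         = (delta / nu f delta m.+1)%:E)%E) ->
  (* the fixed variable i, factor a in \partial i, and 1 <= l <= L *)
  (forall n, a n \in dpart (vtx n) (i n)) ->
  (1 <= l <= Lof delta)%N ->
  exists (dQ : nat -> measure_display) (Om' : forall n, measurableType (dQ n))
         (Q : forall n, probability (Om' n) R) (pi : forall n, Om' n -> Om n)
         (U : forall n, Om' n -> R),
    (* (Om', Q) is an extension of (Om, P) via pi *)
    (forall n, measurable_fun setT (pi n) /\
       forall A : set (Om n), measurable A -> Q n (pi n @^-1` A) = P n A) /\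
    (* U ~ N(0, nu_l) *)
    (forall n, measurable_fun setT (U n) /\
       forall A : set R, measurable A -> Q n (U n @^-1` A) = gauss (nu f delta l) A) /\
    (* U independent of G_i^{l-1} *)
    (forall n, indep_rv_sigma (Q n) (U n)
        (gen_sigma (fun k => Z n k \o pi n) (vball (vtx n) l.-1 (i n)))) /\
    (* plim E[ |u^l_{i->a} - U|^p | G_i^{l-1} ] = 0 for all p > 0 *)
    (forall p : R, 0 < p -> forall Y : forall n, Om' n -> \bar R,
       (forall n, cond_exp_version (Q n)
          (gen_sigma (fun k => Z n k \o pi n) (vball (vtx n) l.-1 (i n)))
          (fun w => (`|umsg f (vtx n) (deg n) (Fto n) (fun k => Z n k (pi n w)) l (i n) (a n)
                        - U n w| `^ p)%:E)
          (Y n)) ->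
       forall eps : R, 0 < eps ->
       (fun n => fine (Q n [set w | (eps%:E < Y n w)%E])) @ \oo --> (0 : R)).
Proof.
move=> r2 f1 delta0 K0 hreg hgirth hdeg Fbd Fmeas hZ hP2 ai /andP[l1 lL].
case: l l1 lL => // m _ mL.
have r0 : (0 < r)%N by exact: leq_trans r2.
pose Zc n (w : Om n) : cfg R (V n) := fun k => Z n k w.
have mZ n : measurable_fun setT (@Zc n).
  by apply: measurable_to_cfg => k; have [h _] := hZ n; exact: h.
pose muS n := cid (image_probability_exists (P n) (@mZ n)).
pose mu n : probability (cfg R (V n)) R := projT1 (muS n).
have lawZ n A : measurable A -> P n (@Zc n @^-1` A) = mu n A.
  by move=> _; rewrite /mu; case: (muS n) => ? /= ->.
have murect n (A : V n -> set R) : (forall j, measurable (A j)) ->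
    mu n (rect A) = (\prod_j gaussP delta (A j))%E.
  move=> mA; rewrite -lawZ; last exact: measurable_rect.
  have [_ h] := hZ n; transitivity (\prod_(j : V n) gauss delta (A j))%E.
    rewrite -h//; congr (P n _); apply/seteqP; split => w /=; first by move=> hw j _; exact: hw.
    by move=> hw j; exact: hw.
  by apply: eq_bigr => j _; rewrite gaussPE.
(* The degree is a multiple of [r], and nonzero because of the factor [a n]. *)
have deg2 n : (2 <= deg n)%N.
  have [_ [c1 c2]] := hreg n; have := c2 (i n) (Ordinal r0); set x := (X in (X * r)%N).
  have : (0 < #|dpart (vtx n) (i n)|)%N by apply/card_gt0P; exists (a n).
  rewrite c1; move: (deg n) x r2 => D x r2 D0 e; case: x e => [|x] e; first by rewrite -e in D0.
  by rewrite -e mulSn (leq_trans r2)// leq_addr.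
pose M n : pre_model r delta K (Lof delta) := @PreModel R r delta K (Lof delta) (V n) (E n)
  (@vtx n) (deg n) (Fto n) (mu n) (@murect n) (hreg n) (hgirth n) (deg2 n)
  (fun k kL t => proj1 (Fbd n k kL t)) (fun k kL => proj1 (Fmeas n k kL)).
have nf n := @node_facts _ _ _ _ _ _ f1 delta0 K0 (M n).
pose u n (w : Om n) := vf f (M := M n) m.+1 (i n) (a n) (Zc n w).
have mu_ n : measurable_fun setT (@u n).
  have [_ [mv _] _ _ _] := nf n m.+1 mL (i n) (a n).
  exact: (measurableT_comp mv (@mZ n)).
have GT n O (g : O -> Om n) : gen_sigma (fun k => Z n k \o g) (vball (vtx n) m (i n)) setT.
  have [s0 sC _] := @smallest_sigma_algebra _ setT
    (\big[setU/set0]_(j in vball (vtx n) m (i n)) preimage_set_system setT (Z n j \o g) measurable).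
  by have := sC _ s0; rewrite setD0.
(* Independence is obtained from the larger sigma-algebra of all coordinates off the deepest layer,
   hence from [G_i^(l-1)]. *)
have inB n : vball (vtx n) m (i n) \subset (~: leaf (vtx n) m.+1 (i n) (a n))%SET.
  apply/fintype.subsetP => x xb; rewrite finset.in_setC; apply: contraL xb => xl.
  by apply: (leaf_notin_vball (hgirth n)) xl; rewrite ltnW.
have gP n O (g : O -> Om n) S : gen_sigma (fun k => Z n k \o g) (vball (vtx n) m (i n)) S ->
    exists2 S0, pulled_events (@Zc n) (~: leaf (vtx n) m.+1 (i n) (a n))%SET S0 & S = g @^-1` S0.
  move=> h; have [S0 h0 e] := @gen_sigma_pulled _ _ _ _ (@Zc n) O
    (fun k => Z n k \o g) g _ S (fun _ _ => erefl) h.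
  by exists S0 => //; exact: (pulled_eventsW (inB n)) h0.
(* If [f] is constant, all messages vanish and [U = 0] works on the original space, its law being
   the Dirac mass; otherwise the extension is the product with [R]. *)
have [fhat0|nu0] := nu_gt0_or_const delta0 f1; last first.
  have P2 n : P2_holds f (M n).
    move=> k kL j b bj; have [_ h] := hP2 n k kL j b bj.
    have [_ _ [maf _] _ _] := nf n k.+1 kL j b.
    rewrite /EE /Rintegral (ge0_integral_image (m1 := P n) (@mZ n) (m2 := mmu (M n))
      (g := fun z => (af f (M := M n) k.+1 j b z ^+ 2)%:E) (@lawZ n))/=.
    - by have := congr1 fine h; apply.
    - by apply/measurable_EFinP; exact: measurable_funX.
    - by move=> z; rewrite lee_fin sqr_ge0.
  have [Q [cQ hmom hfar]] := coupling_sequence f1 delta0 K0 r0 nu0 (M := M) ai P2 hdeg mZ lawZ mL.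
  exists (fun n => (dO n, default_measure_display).-prod)%mdisp, (fun n => (Om n * R)%type : measurableType _), Q,
    (fun n => fst), (fun n => snd).
  split; [|split; [|split]].
  - move=> n; split; first exact: measurable_fst.
    by have [h _ _] := cQ n.
  - move=> n; split; first exact: measurable_snd.
    by move=> A mA; have [_ h _] := cQ n; rewrite -(gaussPE A (nu0 m)); exact: h.
  - move=> n A S mA /gP[S0 G0 ->]; have [h1 h2 h3] := cQ n.
    rewrite h3// h2// h1//; exact: measurable_pulled_events G0.
  move=> p p0 Y hY.
  have mgap n := @measurable_gap _ _ _ _ _ _ f1 delta0 K0 M i a _ Om Zc mZ m mL n.
  have step := cond_exp_vanishes mgap hmom hfar
    (G := fun n => gen_sigma (fun k => Z n k \o fst) (vball (vtx n) m (i n))) p0.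
  apply: step hY.
  - by move=> n; exact: GT.
  - move=> n S /gP[S0 G0 ->]; have mS0 := measurable_pulled_events (@mZ n) G0.
    by rewrite -[X in measurable X]setTI; exact: measurable_fst.
have nu0 : nu f delta m.+1 = 0.
  rewrite nuE big1 ?mulr0// => io _; rewrite /nuG big1// => S Sio.
  by rewrite fhat0 ?expr0n ?mul0r//; apply/finset.set0Pn; exists io.
have u0 n (w : Om n) : u n w = 0.
  rewrite /u vfS// big1 ?mulr0// => c _; rewrite /Xf /Dfat.
  rewrite !big1 ?subrr// => io _; rewrite /fderiv big1// => S Sio;
    by rewrite fhat0 ?mul0r//; apply/finset.set0Pn; exists io.
exists dO, Om, P, (fun n => idfun), (fun n => fun=> 0).
split; [|split; [|split]].
- by move=> n; split; first exact: measurable_id.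
- move=> n; split; first exact: measurable_cst.
  move=> A mA; rewrite /gauss nu0 lexx indicE preimage_cst.
  by case: ifP => _; [exact: (@probability_setT _ _ _ (P n))|rewrite measure0].
- move=> n A S mA GS; rewrite preimage_cst; case: ifP => _.
    by rewrite setTI [X in (X * _)%E](@probability_setT _ _ _ (P n)) mul1e.
  by rewrite set0I !measure0 mul0e.
move=> p p0 Y hY.
apply: (cond_exp_vanishes (Q := P) (D := fun n w => u n w - 0) _ _ _ p0 _ _ hY).
- by move=> n; apply: measurable_funB.
- move=> k; exists 1 => n; rewrite (eq_integral (cst ((0 ^+ k.*2 : R)%:E))); last first.
    by move=> w _; rewrite u0 subr0.
  rewrite integral_cst// [X in (_ * X)%E](@probability_setT _ _ _ (P n)) mule1 lee_fin.
  by rewrite expr0n; case: eqP.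
- move=> k; exists 0%N => n _; rewrite (_ : [set w | _] = set0) ?measure0 ?lee_fin ?invr_ge0//.
  by apply/seteqP; split => // w /=; rewrite u0 subr0 normr0 ltNge invr_ge0 ler0n.
- by move=> n; exact: GT.
- by move=> n S /gP[S0 G0 ->]; exact: (measurable_pulled_events (@mZ n) G0).
Qed.
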